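(* Fix $T\in(0,\infty)$, $n\ge1$ and $\boldsymbol x=(x_1,\ldots,x_n)\in\mathcal{X}_n^{\mathbb{H}}$. For $\kappa\in(0,4]$ let $\boldsymbol X^\kappa$ be the unique strong solution of the SDE system $$\mathrm{d}X_t^j=\sqrt\kappa\,\mathrm{d}B_t^j+\sum_{i\ne j}\frac{4}{X_t^j-X_t^i}\,\mathrm{d}t,\qquad1\le j\le n,$$ with initial data $\boldsymbol X_0^\kappa=\boldsymbol x$, where $B^1,\ldots,B^n$ are independent standard one-dimensional Brownian motions. Then the family of laws of $\{\boldsymbol X^\kappa\}_{\kappa\in(0,4]}$ satisfies the large deviation principle in the space $\mathrm{C}([0,T],\mathcal{X}_n^{\mathbb{H}})$ as $\kappa\to0+$ with good rate function $$\mathcal{I}(\boldsymbol X_{[0,T]})=\frac12\int_0^T\sum_{j=1}^n\Big(\dot X_t^j-\sum_{i\ne j}\frac{4}{X_t^j-X_t^i}\Big)^2\mathrm{d}t$$ if $\boldsymbol X$ is absolutely continuous on $[0,T]$ and $\boldsymbol X_0=\boldsymbol x$, and $\mathcal{I}(\boldsymbol X_{[0,T]})=\infty$ otherwise.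
   Context: $\mathcal{X}_n^{\mathbb{H}}=\{(x_1,\ldots,x_n)\in\mathbb{R}^n:x_1<\cdots<x_n\}$. $\mathrm{C}([0,T],\mathcal{X}_n^{\mathbb{H}})$ is the space of continuous functions from $[0,T]$ to $\mathcal{X}_n^{\mathbb{H}}$ with the topology of uniform convergence. For $\kappa\le4$ the solution (Dyson Brownian motion with parameter $\beta=8/\kappa$) exists in $\mathcal{X}_n^{\mathbb{H}}$ for all time. Large deviation principle (speed $\kappa^{-1}$): for open $O$, $\liminf_{\kappa\to0+}\kappa\log\mathbb{P}[\boldsymbol X^\kappa\in O]\ge-\inf_O\mathcal{I}$; for closed $F$, $\limsup_{\kappa\to0+}\kappa\log\mathbb{P}[\boldsymbol X^\kappa\in F]\le-\inf_F\mathcal{I}$. A rate function is good if its sublevel sets at finite levels are compact. *)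

(* Defs.v *)
From HB Require Import structures.
From mathcomp Require Import all_boot all_order all_algebra.
From mathcomp Require Import all_classical all_reals all_analysis.
Import Order.TTheory GRing.Theory Num.Theory.
Import numFieldNormedType.Exports.

Set Implicit Arguments.
Unset Strict Implicit.
Unset Printing Implicit Defensive.

Local Open Scope classical_set_scope.
Local Open Scope ring_scope.

(** * Large deviation principles *)

Section large_deviations.
Context {R : realType} {E : topologicalType}.
Local Open Scope ereal_scope.

Definition rate_function (I : E -> \bar R) :=
  (forall f, 0 <= I f) /\ lower_semicontinuous I.

Definition good_rate_function (I : E -> \bar R) :=
  rate_function I /\ forall M : R, compact [set f | I f <= M%:E].

(** Only open and closed sets are ever measured, so [mu k] is a plain set
    function.  [lne 0 = -oo] and [ereal_inf set0 = +oo]. *)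
Definition ldp_0right (mu : R -> set E -> \bar R) (I : E -> \bar R) :=
  (forall O : set E, open O ->
     - ereal_inf (I @` O) <=
       limf_einf (fun k : R => k%:E * lne (mu k O)) (0%R : R)^'+) /\
  (forall F : set E, closed F ->
     limf_esup (fun k : R => k%:E * lne (mu k F)) (0%R : R)^'+ <=
       - ereal_inf (I @` F)).

Definition law d (Omega : measurableType d) (P : probability Omega R)
    (X : Omega -> E) (A : set E) : \bar R := P (X @^-1` A).

End large_deviations.

(** * Brownian motion *)

Section brownian_motion.
Context {R : realType} {d : measure_display} {Omega : measurableType d}.
Variable P : probability Omega R.

Definition increment (B : R -> Omega -> R) (s t : R) (w : Omega) : R :=
  B t w - B s w.

(** Processes indexed by times in [R]; only nonnegative times matter. *)
Record brownian_motion (B : R -> Omega -> R) : Prop := BrownianMotion {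
  bm_measurable : forall t : R, 0 <= t -> measurable_fun [set: Omega] (B t) ;
  bm_start : {ae P, forall w, B 0 w = 0} ;
  bm_continuous :
    {ae P, forall w, {within `[0, +oo[, continuous (fun t => B t w)}} ;
  (* the second parameter of [normal_prob] is the standard deviation *)
  bm_gaussian : forall s t : R, 0 <= s -> s < t ->
    forall A : set R, measurable A ->
      P (increment B s t @^-1` A) = normal_prob 0 (Num.sqrt (t - s)) A ;
  bm_independent : forall (m : nat) (t : nat -> R) (A : 'I_m -> set R),
    0 <= t 0%N -> (forall i : 'I_m, t i <= t i.+1) ->
    (forall i, measurable (A i)) ->
    P (\bigcap_(i in [set: 'I_m]) increment B (t i) (t i.+1) @^-1` A i)
    = (\prod_(i < m) P (increment B (t i) (t i.+1) @^-1` A i))%E }.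

Definition process_events (S : set R) (B : R -> Omega -> R) :
    set (set Omega) :=
  [set A | exists s U, [/\ S s, measurable U & A = B s @^-1` U]].

Definition independent_processes n (B : 'I_n -> R -> Omega -> R) :=
  forall A : 'I_n -> set Omega,
    (forall j, <<s process_events `[0, +oo[ (B j) >> (A j)) ->
    P (\bigcap_(j in [set: 'I_n]) A j) = (\prod_(j < n) P (A j))%E.

(** The natural filtration of [B], augmented by the [P]-null events. *)
Definition augmented_filtration n (B : 'I_n -> R -> Omega -> R) (t : R) :
    set (set Omega) :=
  <<s (\bigcup_(j in [set: 'I_n]) process_events `[0, t] (B j))
      `|` [set N | measurable N /\ P N = 0%E] >>.

End brownian_motion.

(** * Paths in the chamber *)

Definition chamber {R : realType} (n : nat) : set 'rV[R]_n :=
  [set x | forall i j : 'I_n, (i < j)%N -> x 0 i < x 0 j].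
Arguments chamber {R} n : simpl never.

Section paths.
Context {R : realType}.
Variables (T : R) (n : nat).

(** [C([0,T], chamber)], with the topology induced by uniform convergence.
    Both sets are coerced to their types of elements, which carry the
    structures induced by [R] and by ['rV[R]_n]. *)
Definition path_space : Type :=
  initial_topology
    ((fun f => f : `[0, T]%classic -> chamber n)
     : continuousType `[0, T]%classic (@chamber R n) ->
       {uniform `[0, T]%classic -> chamber n}).

HB.instance Definition _ := Uniform.on path_space.

Definition eval_path (f : path_space) : `[0, T]%classic -> chamber n :=
  Continuous.sort f.

(** [path_coord f j] extends the [j]-th coordinate of [f] by [0] off [[0,T]], so
    that the library's derivative and integral apply to it. *)
Definition path_coord (f : path_space) (j : 'I_n) : R -> R :=
  'valL_0 (fun t : `[0, T]%classic => \val (eval_path f t) 0 j).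

Definition drift (f : path_space) (j : 'I_n) (t : R) : R :=
  \sum_(i < n | i != j) 4 / (path_coord f j t - path_coord f i t).

Record strong_solution d (Omega : measurableType d) (P : probability Omega R)
    (B : 'I_n -> R -> Omega -> R) (kappa : R) (x : 'rV[R]_n)
    (X : Omega -> path_space) : Prop := StrongSolution {
  sol_adapted : forall t : R, t \in `[0, T] -> forall j (U : set R),
    measurable U ->
    augmented_filtration P B t ((fun w => path_coord (X w) j t) @^-1` U) ;
  sol_start : {ae P, forall w, forall j, path_coord (X w) j 0 = x 0 j} ;
  sol_sde : {ae P, forall w, forall t : R, t \in `[0, T] -> forall j,
    path_coord (X w) j t =
      x 0 j + Num.sqrt kappa * B j t w
      + \int[lebesgue_measure]_(s in `[0, t]) drift (X w) j s} }.

End paths.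

Definition absolutely_continuous_on {R : realType} (a b : R) (f : R -> R) :=
  forall e : R, 0 < e -> exists2 delta : R, 0 < delta &
    forall (m : nat) (u v : 'I_m -> R),
      (forall i, [/\ a <= u i, u i < v i & v i <= b]) ->
      trivIset [set: 'I_m] (fun i => `]u i, v i[%classic) ->
      \sum_(i < m) (v i - u i) < delta ->
      \sum_(i < m) `|f (v i) - f (u i)| < e.

(** The integrand is nonnegative, so the integral is always defined in
    [[0, +oo]]; an absolutely continuous path is derivable almost everywhere. *)
Definition dyson_rate {R : realType} (T : R) (n : nat) (x : 'rV[R]_n)
    (f : path_space T n) : \bar R :=
  if `[< (forall j, absolutely_continuous_on 0 T (path_coord f j)) /\
         (forall j, path_coord f j 0 = x 0 j) >]
  then ((2^-1)%:E * \int[lebesgue_measure]_(t in `[0%R, T])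
         (\sum_(j < n) (derive1 (path_coord f j) t - drift f j t) ^+ 2)%:E)%E
  else +oo%E.

(* Main.v *)
(** The noise of a path is [phi = X - \int drift X], and [I X <= M] iff the discrete
    energies [\sum (phi v - phi u) ^ 2 / (v - u)] over disjoint intervals are all at
    most [2 * M].  In this form the rate function is visibly lower semicontinuous.
    A logarithmic energy grows at most linearly in [I], so the particles of a path
    stay apart by a gap depending only on [M]; the sublevel sets are thus
    equicontinuous and closed in the chamber, hence compact.

    Lower bound: over a fine mesh the increments of [sqrt kappa * B] are independent
    Gaussians and follow those of [phi] with probability at least
    [C * expR (- (E + eta) / kappa)], chaining controls the oscillation inside each
    cell, and a path whose noise is close to [phi] is close to [X] by a Gronwall
    argument.

    Upper bound: outside an event of probability [C * expR (- (alpha - eta) / kappa)]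
    the interpolation [v] of [sqrt kappa * B] over the mesh has energy at most
    [2 * alpha] and is close to [sqrt kappa * B].  The path [v + \int drift X] is then
    close to [X], and its rate is at most any prescribed [alpha' > alpha].  A closed
    set disjoint from the compact set [I <= alpha'] lies at positive distance from
    it, so that it contains no such [X]. *)

Require Import Defs.
From HB Require Import structures.
From mathcomp Require Import all_boot all_order all_algebra.
From mathcomp Require Import all_classical all_reals all_analysis.
From mathcomp Require Import measurable_realfun ring lra zify.
Import Order.TTheory GRing.Theory Num.Theory.
Import numFieldNormedType.Exports.

Set Implicit Arguments.
Unset Strict Implicit.
Unset Printing Implicit Defensive.

Local Open Scope classical_set_scope.
Local Open Scope ring_scope.

(** * Absolutely continuous functions *)

Section absolute_continuity.
Context {R : realType}.
Implicit Types (a b : R) (f : R -> R) (p q : R * R) (s : seq (R * R)).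

(** The drift is singular at collisions, so the map from noise to path is not globally Lipschitz and
    no contraction principle applies directly. Lipschitz estimates for the drift hold only where a
    gap is known: each use either starts from the gap of a fixed path or recovers a gap by a
    continuity argument in time. The rate function is defined by derivatives, which exist only
    almost everywhere, while the estimates need increments. The bridge is the fundamental theorem of
    calculus for absolutely continuous functions, obtained from Jordan decomposition and
    Radon-Nikodym. Every [kappa] comes with its own probability space, so the probability bounds
    have a constant [C] chosen before the space, the Brownian motions and [kappa]. This works
    because the mesh stays fixed while [kappa] tends to [0]: combinatorial prefactors are constants,
    invisible to [kappa * ln], and a fine mesh pushes the rate of an oscillation inside a cell above
    any prescribed level. *)

Definition apart p q := (p.2 <= q.1) || (q.2 <= p.1).

Definition subitv a b p := [&& a <= p.1, p.1 < p.2 & p.2 <= b].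

(** Absolute continuity with lists in place of indexed families, so that families can be
    concatenated and refined. The last inequality is not strict, so that it survives suprema. *)
Definition small_increments a b f (e delta : R) := forall s,
  all (subitv a b) s -> pairwise apart s ->
  \sum_(p <- s) (p.2 - p.1) < delta ->
  \sum_(p <- s) `|f p.2 - f p.1| <= e.

Lemma apart_sym p q : apart p q = apart q p.
Proof. by rewrite /apart orbC. Qed.

Lemma absolutely_continuous_small a b f : absolutely_continuous_on a b f ->
  forall e, 0 < e -> exists2 delta, 0 < delta & small_increments a b f e delta.
Proof.
move=> acf e e0; have [delta d0 H] := acf e e0; exists delta => // s sab ps sd.
have /= := H (size s) (fun i => (nth (0, 0) s i).1) (fun i => (nth (0, 0) s i).2).
rewrite -(big_mkord xpredT (fun i => (nth (0, 0) s i).2 - (nth (0, 0) s i).1)).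
rewrite -(big_mkord xpredT
  (fun i => `|f (nth (0, 0) s i).2 - f (nth (0, 0) s i).1|)).
rewrite -(big_nth (0, 0) xpredT (fun p => p.2 - p.1)).
rewrite -(big_nth (0, 0) xpredT (fun p => `|f p.2 - f p.1|)) => /(_ _ _ sd) K.
apply/ltW/K.
  by move=> i; have /(all_nthP (0, 0))/(_ i (ltn_ord i))/and3P[? ? ?] := sab.
have Hp i j : (i < j < size s)%N -> apart (nth (0, 0) s i) (nth (0, 0) s j).
  move=> /andP[ij js]; apply: (pairwiseP (0, 0) ps) => //.
  by rewrite inE (ltn_trans ij js).
move=> i j _ _ [x [/=]]; rewrite !in_itv/= => /andP[x1 x2] /andP[y1 y2].
apply/val_inj => /=; apply/eqP; rewrite eqn_leq; apply/andP; split.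
  rewrite leqNgt; apply/negP => ji.
  by have /orP[] := Hp _ _ (introT andP (conj ji (ltn_ord i))); lra.
rewrite leqNgt; apply/negP => ij.
by have /orP[] := Hp _ _ (introT andP (conj ij (ltn_ord j))); lra.
Qed.

Fixpoint pieces (u : R) (r : seq R) : seq (R * R) :=
  if r is v :: r' then (u, v) :: pieces v r' else [::].

Lemma pieces_subitv u r : path <%O u r -> all (subitv u (last u r)) (pieces u r).
Proof.
elim: r u => //= v r IH u /andP[uv vr]; have IHv := IH _ vr.
have vl : v <= last v r by have := itv_partition_le (conj vr (eqxx _)).
rewrite /subitv/= lexx uv vl/=.
apply: sub_all IHv => -[p q]/= /and3P[vp pq ql].
by rewrite pq ql (le_trans (ltW uv) vp).
Qed.

Lemma pieces_apart u r : path <%O u r -> pairwise apart (pieces u r).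
Proof.
elim: r u => //= v r IH u /andP[uv vr]; rewrite IH// andbT.
by apply: sub_all (pieces_subitv vr) => -[p q] /and3P[/= vp _ _]; rewrite /apart/= vp.
Qed.

Lemma pieces_length u r :
  \sum_(p <- pieces u r) (p.2 - p.1) = last u r - u.
Proof.
elim: r u => [|v r IH] u/=; first by rewrite big_nil subrr.
by rewrite big_cons/= IH; ring.
Qed.

Lemma pieces_variation f u r : path <%O u r ->
  \sum_(p <- pieces u r) `|f p.2 - f p.1| = variation u (last u r) f r.
Proof.
move=> ur; rewrite variation_zip//.
elim: r u {ur} => [|v r IH] u/=; first by rewrite !big_nil.
by rewrite !big_cons/= IH.
Qed.

(** Total variation inherits the modulus of absolute continuity. Induction on [t] subdivides its
    head by an arbitrary partition and moves the pieces into [s]; the supremum over partitions then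
    yields the variation of the head. *)
Lemma small_variation a b f e delta : small_increments a b f e delta ->
  forall s t, all (subitv a b) (s ++ t) -> pairwise apart (s ++ t) ->
  \sum_(p <- s ++ t) (p.2 - p.1) < delta ->
  ((\sum_(p <- s) `|f p.2 - f p.1|)%:E +
    \sum_(p <- t) total_variation p.1 p.2 f <= e%:E)%E.
Proof.
move=> H s t; elim: t s => [|[u v] t IH] s.
  by rewrite cats0 big_nil adde0 lee_fin => h1 h2 h3; exact: H.
rewrite all_cat /= pairwise_cat/= big_cat/= !big_cons/=.
move=> /and3P[sab uvab tab] /and4P[+ ps put pt] lt.
rewrite allrel_consr => /andP[suv st].
have uv : u < v by case/and3P: uvab.
set Y := ((\sum_(p <- s) `|f p.2 - f p.1|)%:E +
  \sum_(p <- t) total_variation p.1 p.2 f)%E.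
have Y0 : (0 <= Y)%E.
  rewrite adde_ge0 ?lee_fin ?sumr_ge0//.
  rewrite big_seq sume_ge0// => p /(allP tab)/and3P[_ /ltW pp _].
  exact: total_variation_ge0.
have K r : itv_partition u v r -> ((variation u v f r)%:E + Y <= e%:E)%E.
  move=> [ur /eqP rv]; rewrite addeA -EFinD.
  have := IH (pieces u r ++ s).
  rewrite [X in (X%:E + _)%E]big_cat/= pieces_variation// rv; apply.
  - rewrite -catA all_cat all_cat sab tab !andbT.
    have := pieces_subitv ur; rewrite rv.
    apply: sub_all => -[p q]/= /and3P[/= up pq qv].
    case/and3P: uvab => /= au _ vb.
    by rewrite /subitv/= pq (le_trans au up) (le_trans qv vb).
  - have ruv q : apart q (u, v) -> all (apart q) (pieces u r).
      move=> /orP[/=|/=] h; apply: sub_all (pieces_subitv ur) => -[x y] /and3P[/= ux xy].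
        by move=> _; rewrite /apart/= (le_trans h ux).
      by rewrite rv => yv; rewrite /apart/= (le_trans yv h) orbT.
    rewrite -catA pairwise_cat pieces_apart// pairwise_cat ps pt st !andbT/=.
    rewrite allrelC; apply/allrelP => q p; rewrite mem_cat => /orP[qs|qt] pr.
      by rewrite apart_sym; move: p pr; apply/allP/ruv; exact: (allP suv).
    rewrite apart_sym; move: p pr; apply/allP/ruv; rewrite apart_sym.
    exact: (allP put).
  - rewrite -catA !big_cat/= pieces_length rv; lra.
(* The trivial partition bounds [Y], which can therefore be moved across an inequality of extended
   reals. *)
have Yfin : Y \is a fin_num.
  rewrite ge0_fin_numE//.
  have := K [:: v] (itv_partition1 uv).
  rewrite -leeBrDl// => /le_lt_trans; apply.
  by rewrite -EFinB ltry.
rewrite addeCA -leeBrDr//.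
apply: ge_ereal_sup => _ [_ [r ruv <-]  <-].
by rewrite leeBrDr//; exact: K.
Qed.

Lemma subitv1 a b u v : a <= u -> u < v -> v <= b -> all (subitv a b) [:: (u, v)].
Proof. by move=> h1 h2 h3; rewrite /= /subitv/= h1 h2 h3. Qed.

Lemma small_variation1 a b f e delta u v : small_increments a b f e delta ->
  a <= u -> u < v -> v <= b -> v - u < delta ->
  (total_variation u v f <= e%:E)%E.
Proof.
move=> H au uv vb uvd.
have := small_variation H (s := [::]) (t := [:: (u, v)]).
rewrite /= !big_cons !big_nil /= addr0 adde0 add0e; apply => //.
exact: subitv1.
Qed.

(** [[a, b]] is covered by finitely many intervals of length at most [delta / 2], each of variation
    at most [1]. *)
Lemma absolutely_continuous_TV_fin a b f : a <= b ->
  absolutely_continuous_on a b f -> total_variation a b f \is a fin_num.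
Proof.
move=> ab /absolutely_continuous_small/(_ 1 ltr01)[delta d0 H].
have [N bN] : exists N : nat, b - a < N%:R * (delta / 2).
  exists (Num.bound ((b - a) / (delta / 2))).
  by rewrite -ltr_pdivrMr ?divr_gt0// archi_boundP// divr_ge0 ?subr_ge0// ltW// divr_gt0.
have K (m : nat) c : a <= c -> c <= b -> c - a <= m%:R * (delta / 2) ->
    (total_variation a c f <= m%:R%:E)%E.
  elim: m c => [|m IH] c ac cb; first rewrite mul0r.
    move=> ca; have -> : c = a by apply/le_anti/andP; split; lra.
    by rewrite total_variationxx lexx.
  rewrite -(natr1 m).
  move=> cm; have [cm'|cm'] := leP (c - a) (m%:R * (delta / 2)).
    by apply: (le_trans (IH _ ac cb cm')); rewrite lee_fin lerDl.
  have [am|am] := leP (c - delta / 2) a.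
    have [->|ac'] := eqVneq a c; first by rewrite total_variationxx lee_fin.
    apply: (@le_trans _ _ 1%:E); last by rewrite lee_fin lerDr.
    by apply: (small_variation1 H) => //; [rewrite lt_neqAle ac'|lra].
  rewrite (@total_variationD _ _ _ (c - delta / 2)) ?(ltW am)//; last lra.
  rewrite EFinD leeD//.
    by apply: IH; [exact: ltW|lra|rewrite mulrDl mul1r in cm; lra].
  by apply: (small_variation1 H) => //; lra.
have := K N b ab (lexx _) (ltW bN); rewrite ge0_fin_numE ?total_variation_ge0//.
by move=> /le_lt_trans; apply; rewrite ltry.
Qed.

Lemma small_increments_dist a b f :
  (forall e, 0 < e -> exists2 delta, 0 < delta & small_increments a b f e delta) ->
  forall e, 0 < e -> exists2 delta, 0 < delta &
    forall u v, a <= u <= b -> a <= v <= b -> `|v - u| < delta -> `|f v - f u| <= e.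
Proof.
move=> Hf e e0; have [delta d0 H] := Hf e e0; exists delta => // u v uab vab.
wlog uv : u v uab vab / u <= v.
  move=> K; have /orP[uv|vu] := le_total u v; first exact: K.
  by rewrite distrC [leLHS]distrC; exact: K.
move: uv; rewrite le_eqVlt => /orP[/eqP->|uv]; first by rewrite !subrr normr0 ltW.
have /andP[au _] := uab; have /andP[_ vb] := vab.
rewrite (@ger0_norm _ (v - u)) ?subr_ge0 ?(ltW uv)// => uvd.
by have := H [:: (u, v)]; rewrite !big_cons !big_nil/= !addr0; apply => //; exact: subitv1.
Qed.

Lemma absolutely_continuous_dist a b f : absolutely_continuous_on a b f ->
  forall e, 0 < e -> exists2 delta, 0 < delta &
    forall u v, a <= u <= b -> a <= v <= b -> `|v - u| < delta -> `|f v - f u| <= e.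
Proof. by move=> /absolutely_continuous_small; exact: small_increments_dist. Qed.

End absolute_continuity.

(** * Stieltjes measures and Lebesgue densities *)

Section monotone_density.
Context {R : realType}.
Implicit Types (a b : R).
Notation mu := (@lebesgue_measure R).

Lemma open_itv_apart (u v u' v' : R) : u < v -> u' < v' ->
  `]u, v[%classic `&` `]u', v'[%classic = set0 -> apart (u, v) (u', v').
Proof.
move=> uv uv' /seteqP[+ _]; rewrite /apart/=.
have [//|h1] := leP v u'; have [//|h2] := leP v' u.
set x := Num.max u u'; set y := Num.min v v'.
have xy : x < y by rewrite /x /y gt_max !lt_min; apply/andP; split; apply/andP.
move=> /(_ ((x + y) / 2))[]; rewrite /= !in_itv/=.
have : u <= x by rewrite le_max lexx.
have : u' <= x by rewrite le_max lexx orbT.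
have : y <= v by rewrite ge_min lexx.
have : y <= v' by rewrite ge_min lexx orbT.
by move=> *; split; apply/andP; split; lra.
Qed.

Variable F : cumulative R R.
Local Notation nu := (lebesgue_stieltjes_measure F).

Lemma lebesgue_stieltjes_oc (u v : R) : u <= v -> nu `]u, v]%classic = (F v - F u)%:E.
Proof.
move=> uv; rewrite /lebesgue_stieltjes_measure/= /measure_extension.
rewrite measurable_mu_extE/=; last exact: is_ocitv.
by rewrite wlength_itv_bnd.
Qed.

(* An open set is a countable union of disjoint intervals; finitely many of them are
   handled by the smallness of the increments, and continuity from below concludes. *)
Lemma open_lebesgue_stieltjes_le a b e delta (U : set R) :
  small_increments a b F e delta -> open U -> U `<=` `]a, b[ ->
  (mu U < delta%:E)%E -> (nu U <= e%:E)%E.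
Proof.
move=> H oU Uab Ud.
have [I [Io tI UI]] := OpenSetDisjointItvs.open_disjoint_itv oU.
pose l q := inf (I q); pose r q := sup (I q).
have Iab q : I q `<=` `]a, b[ by move=> x Ix; apply: Uab; rewrite UI; exists q.
have IE q : I q !=set0 -> [/\ I q = `]l q, r q[%classic, a <= l q, l q < r q & r q <= b].
  move=> [x Ix]; have [oI iI] := Io q.
  have Ib y : I q y -> a < y < b by move=> /Iab; rewrite /= in_itv.
  have hl : has_lbound (I q) by exists a => y /Ib/andP[/ltW].
  have hu : has_ubound (I q) by exists b => y /Ib/andP[_ /ltW].
  have E : I q = `]l q, r q[%classic.
    by rewrite -[LHS](interior_id _).1// interval_bounded_interior//; apply/seteqP; split => y; rewrite /= in_itv.
  split=> //.
  - by apply: lb_le_inf; [exists x|move=> y /Ib/andP[/ltW]].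
  - by move: Ix; rewrite E/= in_itv/= => /andP[]; exact: lt_trans.
  - by apply: ge_sup; [exists x|move=> y /Ib/andP[_ /ltW]].
(* The half-open hull of [I q] has measure exactly [F (r q) - F (l q)], whatever the jumps of
   [F]. *)
pose J q := if I q == set0 then set0 else `]l q, r q]%classic.
have mI q : measurable (I q) by apply: open_measurable; have [] := Io q.
have mJ q : measurable (J q) by rewrite /J; case: ifP.
have IJ q : I q `<=` J q.
  rewrite /J; case: eqP => [->//|/eqP/set0P/IE[-> _ _ _]] x /=.
  by rewrite !in_itv/= => /andP[-> /ltW].
have mU : measurable U by exact: open_measurable.
apply: (@le_trans _ _ (\sum_(0 <= q <oo) nu (J q))%E).
  apply: measure_sigma_subadditive => //.
  by rewrite UI; exact: subset_bigcup.
apply: lime_le.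
  exact: is_cvg_nneseries.
near=> N.
pose s := [seq (l q, r q) | q <- iota 0 N & I q != set0].
have -> : (\sum_(0 <= q < N) nu (J q) = (\sum_(p <- s) `|F p.2 - F p.1|)%:E)%E.
  rewrite /s big_map big_filter -sumEFin [RHS]big_mkcond/= /index_iota subn0.
  apply: eq_bigr => q _; rewrite /J; case: eqP => [_|/eqP/set0P/IE[_ _ lr _]]/=.
    by rewrite measure0.
  rewrite lebesgue_stieltjes_oc ?(ltW lr)// ger0_norm// subr_ge0.
  by apply: cumulative_is_nondecreasing; exact: ltW.
rewrite lee_fin; apply: H.
- apply/allP => p /mapP[q]; rewrite mem_filter => /andP[/set0P/IE[_ al lr rb] _] ->.
  by rewrite /subitv/= al lr rb.
- rewrite pairwise_map; apply: (@sub_in_pairwise _ (fun q => I q != set0) ltn).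
  + move=> p q; rewrite -!topredE/= => /set0P/IE[Ep _ lp _] /set0P/IE[Eq _ lq _] pq.
    apply: open_itv_apart => //; rewrite -Ep -Eq.
    apply: contrapT => /eqP/set0P[x [xp xq]].
    by have := tI p q Logic.I Logic.I (ex_intro _ x (conj xp xq)) => E; rewrite E ltnn in pq.
  + exact: filter_all.
  + rewrite -sorted_pairwise; last exact: ltn_trans.
    by apply: sorted_filter; [exact: ltn_trans|exact: iota_ltn_sorted].
- rewrite -lte_fin; apply: le_lt_trans Ud.
  rewrite /s big_map big_filter -sumEFin big_mkcond/=.
  have -> : U = \bigcup_q I q by [].
  rewrite measure_bigcup//.
  apply: (@le_trans _ _ (\sum_(0 <= q < N) mu (I q))%E).
    rewrite /index_iota subn0 lee_sum// => q _.
    case: eqP => [_|/eqP/set0P/IE[-> _ lr _]]/=; first by [].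
    by rewrite lebesgue_measure_itv/= lte_fin lr EFinB.
  rewrite [leRHS](_ : _ = (\sum_(0 <= i <oo) mu (I i))%E).
    exact: nneseries_lim_ge.
  by apply: eq_eseriesl => i; rewrite in_setT.
  by move=> i _; exact: mI.
Unshelve. all: by end_near. Qed.

(** Outer regularity puts the null set into an open set of small Lebesgue measure, hence of small
    Stieltjes measure. Open subsets of []a, b[] miss the point [b], which is covered by a short
    interval []c, b]]. *)
Lemma lebesgue_stieltjes_null a b (A : set R) : a < b ->
  (forall e, 0 < e -> exists2 delta, 0 < delta & small_increments a b F e delta) ->
  measurable A -> mu A = 0%E -> nu (A `&` `]a, b]) = 0%E.
Proof.
move=> ab H mA A0; apply/eqP; rewrite eq_le measure_ge0 andbT.
apply/lee_addgt0Pr => e e0; rewrite add0e.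
have [delta d0 He] := H (e / 2) (divr_gt0 e0 (ltr0n _ 2)).
pose A' := A `&` `]a, b[%classic.
have mA' : measurable A' by exact: measurableI.
have A'0 : mu A' = 0%E.
  by apply/eqP; rewrite eq_le measure_ge0 andbT -A0 le_measure ?inE//; exact: subIsetl.
have [|U [oU A'U UA']] := @lebesgue_regularity_outer R A' delta mA' _ d0.
  by rewrite [X in (X < _)%E]A'0 ltry.
have mU : measurable U by exact: open_measurable.
have Ud : (mu (U `&` `]a, b[) < delta%:E)%E.
  apply: (@le_lt_trans _ _ (mu U)).
    by rewrite le_measure ?inE//; exact: measurableI.
  rewrite -(@setDUK _ A' U)// measureU//; last 2 first.
    exact: measurableD.
    by rewrite setDE setICA setICr setI0.
  by rewrite [X in (X + _)%E]A'0 add0e.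
have nuA' : (nu A' <= (e / 2)%:E)%E.
  apply: (@le_trans _ _ (nu (U `&` `]a, b[))).
    rewrite le_measure ?inE//; first exact: measurableI.
    by move=> x [Ax xab]; split => //; apply: A'U; split.
  apply: (open_lebesgue_stieltjes_le He _ _ Ud); last exact: subIsetr.
  by apply: openI => //; exact: interval_open.
pose c := Num.max a (b - delta / 2).
have cb : c < b by rewrite gt_max ab/= gtrBl divr_gt0.
have nub : (nu [set b] <= (e / 2)%:E)%E.
  apply: (@le_trans _ _ (nu `]c, b]%classic)).
    by rewrite le_measure ?inE// => x ->/=; rewrite in_itv/= cb lexx.
  rewrite lebesgue_stieltjes_oc ?(ltW cb)// lee_fin.
  apply: le_trans (ler_norm _) _.
  have := He [:: (c, b)]; rewrite !big_cons !big_nil/= !addr0; apply => //.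
    by apply: subitv1 => //; rewrite le_max lexx.
  have : b - delta / 2 <= c by rewrite le_max lexx orbT.
  by move=> ?; lra.
apply: (@le_trans _ _ (nu (A' `|` [set b]))).
  rewrite le_measure ?inE//; [exact: measurableI|exact: measurableU|].
  move=> x [Ax]/=; rewrite in_itv/= => /andP[ax]; rewrite le_eqVlt => /predU1P[->|xb].
    by right.
  by left; split => //; rewrite /= in_itv/= ax.
apply: (le_trans (measureU2 _ _ _)) => //.
by rewrite [e in leRHS](splitr e) EFinD leeD.
Qed.

End monotone_density.

(** The density is the Radon-Nikodym derivative of the Stieltjes measure of [F], restricted to []a,
    b]] to make it finite. *)
Lemma monotone_integral {R : realType} (a b : R) (F : R -> R) : a < b ->
  nondecreasing F -> right_continuous F ->
  (forall e, 0 < e -> exists2 delta, 0 < delta & small_increments a b F e delta) ->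
  exists2 g : R -> R, (@lebesgue_measure R).-integrable setT (EFin \o g) &
    forall t, a <= t <= b -> F t - F a = \int[lebesgue_measure]_(s in `[a, t]) g s.
Proof.
move=> ab ndF rcF H.
pose Fc : cumulative R R := HB.pack F (isCumulative.Build R _ R F ndF rcF).
have moo : (lebesgue_stieltjes_measure Fc `]a, b]%classic < +oo)%E.
  by rewrite [X in (X < _)%E]lebesgue_stieltjes_oc ?(ltW ab)// ltry.
have mD : (measurable : set (set (measurableTypeR R))) `]a, b]%classic by exact: measurable_itv.
pose nu' : {finite_measure set (measurableTypeR R) -> \bar R} :=
  @mfrestr _ (measurableTypeR R) R _ (lebesgue_stieltjes_measure Fc) mD moo.
have dom : nu' `<< lebesgue_measure.
  move=> N N0 A mA AN.
  exact: (@lebesgue_stieltjes_null R Fc a b A ab H mA (N0 A mA AN)).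
pose h := Radon_Nikodym_SigmaFinite.f nu' (@lebesgue_measure R).
have hfin := Radon_Nikodym_SigmaFinite.f_fin_num dom.
have hint := Radon_Nikodym_SigmaFinite.f_integrable dom.
have hE : h = EFin \o (fine \o h) by apply/funext => x /=; rewrite fineK.
exists (fine \o h); first by rewrite -hE.
move=> t /andP[at_ tb].
rewrite -Rintegral_itv_obnd_cbnd; last first.
  by rewrite -hE; apply: integrableS hint.
rewrite /Rintegral -[F t - F a]/(fine (F t - F a)%:E); congr fine.
rewrite -[(F t - F a)]/(Fc t - Fc a) -lebesgue_stieltjes_oc//.
transitivity (nu' `]a, t]%classic).
  rewrite /nu' /= /mfrestr /mrestr/=; congr (lebesgue_stieltjes_measure Fc _).
  apply/seteqP; split => x /=; last by case.
  by rewrite !in_itv/= => /andP[-> xt]; rewrite xt (le_trans xt tb).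
rewrite (Radon_Nikodym_SigmaFinite.f_integral dom)//.
by apply: eq_integral => x _; rewrite fineK.
Qed.

Section clamp.
Context {R : realType}.
Implicit Types (a b t : R) (f : R -> R).

(** The retraction of the line onto [[a, b]]. Composition with it turns a function known on [[a, b]]
    into one continuous on the whole line, which spares the subspace topology. *)
Definition clamp a b t := Num.max a (Num.min t b).

Lemma clamp_itv a b t : a <= b -> a <= clamp a b t <= b.
Proof. by move=> ab; rewrite le_max lexx/= ge_max ab ge_min lexx orbT. Qed.

Lemma clamp_id a b t : a <= t <= b -> clamp a b t = t.
Proof. by move=> /andP[at_ tb]; rewrite /clamp (min_idPl tb) (max_idPr at_). Qed.

Lemma clamp_dist a b s t : `|clamp a b t - clamp a b s| <= `|t - s|.
Proof.
wlog st : s t / s <= t.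
  by move=> H; have /orP[/H//|/H] := le_total s t; rewrite distrC [leRHS]distrC.
rewrite /clamp (@ger0_norm _ (t - s)) ?subr_ge0//.
have h : Num.min s b <= Num.min t b by rewrite le_min !ge_min st lexx orbT.
have h' : Num.min t b - Num.min s b <= t - s.
  by rewrite /Num.min; case: ltP => ?; case: ltP => ?; lra.
rewrite ger0_norm; last by rewrite subr_ge0 ge_max !le_max lexx h orbT.
by rewrite /Num.max; case: ltP => ?; case: ltP => ?; lra.
Qed.

Lemma clamp_le a b : {homo clamp a b : s t / s <= t}.
Proof.
move=> s t st; rewrite /clamp ge_max !le_max lexx/=.
by rewrite [X in _ || X]le_min !ge_min st lexx !orbT.
Qed.

Lemma continuous_clamp a b f : a <= b ->
  (forall e, 0 < e -> exists2 delta, 0 < delta &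
    forall u v, a <= u <= b -> a <= v <= b -> `|v - u| < delta -> `|f v - f u| <= e) ->
  continuous (f \o clamp a b).
Proof.
move=> ab H t; apply/cvgrPdist_le => e e0.
have [delta d0 He] := H e e0.
near=> s; apply: He; rewrite ?clamp_itv//.
apply: le_lt_trans (clamp_dist _ _ _ _) _.
by near: s; exact: cvgr_dist_lt.
Unshelve. all: by end_near. Qed.

End clamp.

(** Jordan decomposition [f = G - (G - f)] with [G] the total variation: both terms are
    nondecreasing, and their increments are controlled by those of [G]. *)
Lemma absolutely_continuous_integral {R : realType} (a b : R) (f : R -> R) : a < b ->
  absolutely_continuous_on a b f ->
  exists2 g : R -> R, (@lebesgue_measure R).-integrable setT (EFin \o g) &
    forall t, a <= t <= b -> f t - f a = \int[lebesgue_measure]_(s in `[a, t]) g s.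
Proof.
move=> ab acf.
have TVfin u v : a <= u -> u <= v -> v <= b -> total_variation u v f \is a fin_num.
  move=> au uv vb; rewrite ge0_fin_numE ?total_variation_ge0//.
  have /fin_numPlt/andP[_] := absolutely_continuous_TV_fin (ltW ab) acf.
  apply: le_lt_trans.
  rewrite (total_variationD f au (le_trans uv vb)) (total_variationD f uv vb).
  by rewrite addeCA leeDl// adde_ge0// total_variation_ge0.
pose G t := fine (total_variation a t f).
have GD u v : a <= u -> u <= v -> v <= b -> G v - G u = fine (total_variation u v f).
  move=> au uv vb; rewrite /G (total_variationD f au uv) fineD; first by rewrite addrC addKr.
    by apply: TVfin => //; exact: le_trans vb.
  exact: TVfin.
have Gge u v : a <= u -> u <= v -> v <= b -> `|f v - f u| <= G v - G u.
  move=> au uv vb; rewrite GD// -lee_fin fineK; first exact: total_variation_ge.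
  exact: TVfin.
have H e : 0 < e -> exists2 delta, 0 < delta & small_increments a b G e delta.
  move=> e0; have [delta d0 K] := absolutely_continuous_small acf e0.
  exists delta => // s sab ps sd.
  have := small_variation K (s := [::]) sab ps sd.
  rewrite big_nil add0e => /(le_trans _); rewrite -lee_fin; apply.
  rewrite -sumEFin le_eqVlt; apply/orP; left; apply/eqP; apply: eq_big_seq => p /(allP sab).
  move=> /and3P[ap /ltW pp pb]; rewrite ger0_norm ?(le_trans (normr_ge0 _) (Gge _ _ ap pp pb))//.
  by rewrite GD// fineK// TVfin.
have contG := small_increments_dist H.
have ab' := ltW ab.
(* Used for [K = G] with [c = 1] and for [K = G - f] with [c = 2]. The clamp makes [K] monotone on
   the whole line. *)
have mono K c : (forall u v, a <= u -> u <= v -> v <= b -> 0 <= K v - K u <= c * (G v - G u)) -> 0 < c ->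
    exists2 g : R -> R, (@lebesgue_measure R).-integrable setT (EFin \o g) &
    forall t, a <= t <= b -> K t - K a = \int[lebesgue_measure]_(s in `[a, t]) g s.
  move=> HK c0; have [| | |g ig gE] := @monotone_integral R a b (K \o clamp a b) ab.
  - move=> u v uv /=; have /andP[au ub] := clamp_itv u ab'; have /andP[av vb] := clamp_itv v ab'.
    by rewrite -subr_ge0; have /andP[] := HK _ _ au (clamp_le a b uv) vb.
  - apply: right_continuousW; apply: continuous_clamp => // e e0.
    have [delta d0 Hd] := contG (e / c) (divr_gt0 e0 c0).
    exists delta => // u v uab vab uvd; have := Hd _ _ uab vab uvd.
    case/andP: uab => au ub; case/andP: vab => av vb.
    rewrite ler_pdivlMr// mulrC.
    have [uv|/ltW vu] := leP u v.
      have /andP[h1 h2] := HK _ _ au uv vb.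
      by apply: le_trans; rewrite (ger0_norm h1); apply: (le_trans h2); rewrite ler_pM2l// ler_norm.
    have /andP[h1 h2] := HK _ _ av vu ub.
    apply: le_trans; rewrite distrC (ger0_norm h1); apply: (le_trans h2).
    by rewrite ler_pM2l// distrC ler_norm.
  - move=> e e0; have [delta d0 Hd] := H (e / c) (divr_gt0 e0 c0).
    exists delta => // s sab ps sd; have := Hd s sab ps sd.
    rewrite ler_pdivlMr// mulrC; apply: le_trans.
    rewrite mulr_sumr big_seq [leRHS]big_seq ler_sum// => p /(allP sab)/and3P[ap /ltW pp pb].
    rewrite /= !clamp_id ?ap ?(le_trans pp)// ?pb ?(le_trans ap pp)//.
    have /andP[h1 h2] := HK _ _ ap pp pb; rewrite ger0_norm//; apply: (le_trans h2).
    by rewrite ler_pM2l// ler_norm.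
  - exists g => // t tab; rewrite -gE//= !clamp_id// lexx.
    by case/andP: tab => at_ tb; exact: le_trans at_ tb.
have [u v au uv vb|//|g1 ig1 g1E] := mono G 1.
  by rewrite mul1r lexx andbT; apply: le_trans (Gge _ _ _ _ _).
have [u v au uv vb|//|g2 ig2 g2E] := mono (fun t => G t - f t) 2.
  by have := Gge u v au uv vb; rewrite ler_norml => /andP[? ?]; apply/andP; split; lra.
exists (g1 \- g2).
  rewrite [X in _.-integrable _ X](_ : _ = (EFin \o g1) \- (EFin \o g2))%E.
    exact: integrableB.
  by apply/funext => x.
move=> t tab; rewrite RintegralB//; [|exact: integrableS ig1|exact: integrableS ig2].
by rewrite -g1E// -g2E//; ring.
Qed.

Import HBNNSimple.

(** * Almost everywhere statements and derivatives *)

Section almost_everywhere_lemmas.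
Context d (T : measurableType d) (R : realType) (mu : {measure set T -> \bar R}).
Implicit Types P Q : T -> Prop.

Lemma ae_imply P Q : (forall x, P x -> Q x) ->
  {ae mu, forall x, P x} -> {ae mu, forall x, Q x}.
Proof.
by move=> PQ; apply: filterS.
Qed.

Lemma ae_and P Q : {ae mu, forall x, P x} -> {ae mu, forall x, Q x} ->
  {ae mu, forall x, P x /\ Q x}.
Proof. by move=> aP aQ; apply: filterI => //; exact: (ae_filter_ringOfSetsType mu). Qed.

Lemma ae_forall_ord n (P : 'I_n -> T -> Prop) :
  (forall i, {ae mu, forall x, P i x}) -> {ae mu, forall x, forall i, P i x}.
Proof.
by move=> aP; apply: filter_forall => //; exact: (ae_filter_ringOfSetsType mu).
Qed.

End almost_everywhere_lemmas.

Section ae_derivative.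
Context {R : realType}.
Notation mu := (@lebesgue_measure R).

Lemma integrable_itv (g : R -> R) (i : interval R) :
  mu.-integrable setT (EFin \o g) -> mu.-integrable [set` i] (EFin \o g).
Proof. by move=> ig; apply: integrableS ig => //; exact: measurable_itv. Qed.

Lemma Rintegral_cst_itv (c s t : R) : s <= t -> \int[mu]_(r in `[s, t]) c = c * (t - s).
Proof.
move=> st; rewrite /Rintegral (@integral_cst _ _ _ _ _ _ c%:E)//= lebesgue_measure_itv/= lte_fin.
case: ltP => [_|ts]; first by rewrite -EFinB.
by rewrite (_ : t - s = 0) ?mulr0 ?mule0//; apply/eqP; rewrite subr_eq0 eq_le ts st.
Qed.

Lemma absolutely_continuous_derive (a b : R) (f : R -> R) : a < b ->
  absolutely_continuous_on a b f ->
  exists2 g : R -> R, mu.-integrable setT (EFin \o g) &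
    (forall t, a <= t <= b -> f t - f a = \int[mu]_(s in `[a, t]) g s) /\
    {ae mu, forall t, a < t < b -> is_derive t 1 f (g t)}.
Proof.
move=> ab /(absolutely_continuous_integral ab)[g ig gE]; exists g => //; split => //.
have := @FTC1 R g (BLeft a).
have loc : locally_integrable [set: R] g by apply: open_integrable_locally => //; exact: openT.
move=> /(_ (fun y => integrable_itv _ ig) loc).
apply: ae_imply => t + /andP[at_ tb].
rewrite /= lte_fin => /(_ at_)[dF FE].
have D : is_derive t 1 (fun s => \int[mu]_(s in `[a, s]) g s + f a) (g t).
  rewrite -[g t]addr0; apply: is_deriveD; rewrite -FE derive1E.
  exact: DeriveDef.
apply: near_eq_is_derive D.
have : t \in `]a, b[ by rewrite in_itv/= at_ tb.
move=> /near_in_itvoo; apply: filterS => s; rewrite in_itv/= => /andP[as_ sb].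
by rewrite -gE ?subrK// !ltW.
Qed.

Lemma absolutely_continuous_derive1 (a b : R) (f : R -> R) : a < b ->
  absolutely_continuous_on a b f ->
  {ae mu, forall t, a < t < b -> is_derive t 1 f (derive1 f t)}.
Proof.
move=> ab acf; have [g _ [_]] := absolutely_continuous_derive ab acf.
by apply: ae_imply => t + /[dup] tab => /(_ tab) Dt; rewrite derive1E derive_val.
Qed.

Lemma ae_neq (c : R) : {ae mu, forall t, t != c}.
Proof.
exists [set c]; split; [exact: measurable_set1|exact: lebesgue_measure_set1|].
by move=> t /= /negP; rewrite negbK => /eqP.
Qed.

Lemma ae_itvoo (a b : R) : {ae mu, forall t, a <= t <= b -> a < t < b}.
Proof.
apply: ae_imply (ae_and (ae_neq a) (ae_neq b)) => t [ta tb] /andP[at_ tb'].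
by rewrite !lt_neqAle eq_sym ta tb at_ tb'.
Qed.

(** Integrands made of [derive1] come without a measurability proof, so the comparison goes through
    the simple functions below [f]: cutting one by the complement of [N] keeps its integral and puts
    it below [g]. *)
Lemma le_integral_ae (D : set R) (f g : R -> \bar R) : measurable D ->
  (forall x, D x -> 0 <= f x)%E -> (forall x, D x -> 0 <= g x)%E ->
  {ae mu, forall x, D x -> (f x <= g x)%E} ->
  (\int[mu]_(x in D) f x <= \int[mu]_(x in D) g x)%E.
Proof.
move=> mD f0 g0 [N [mN N0 fg]].
have ge0 (h : R -> \bar R) : (forall x, D x -> 0 <= h x)%E -> forall x, (0 <= (h \_ D) x)%E.
  by move=> h0 x; rewrite patchE; case: ifPn => // /[1!inE]/h0.
rewrite integral_mkcond [leRHS]integral_mkcond ge0_integralTE; last exact: ge0.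
rewrite ge0_integralTE; last exact: ge0.
apply: ge_ereal_sup => _ [h hf <-].
have mC : measurable (~` N) by exact: measurableC.
pose k := proj_nnsfun h mC.
apply: le_ereal_sup_tmp; exists (sintegral mu k).
  exists k; last by [].
  move=> x; rewrite /k /= mindicE.
  case: (boolP (x \in ~` N)) => [|_]; last by rewrite mulr0; exact: ge0.
  rewrite inE => Nx; rewrite mulr1; apply: (le_trans (hf x)).
  rewrite !patchE; case: ifPn => // /[1!inE] Dx.
  by apply: contrapT => nfg; apply: Nx; apply: fg => /(_ Dx).
rewrite -!integralT_nnsfun le_eqVlt; apply/orP; left; apply/eqP.
apply: ae_eq_integral => //.
- exact/measurable_EFinP.
- exact/measurable_EFinP.
- exists N; split => // x /= /not_implyP[_]; apply: contraPP => Nx.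
  by rewrite /k /= mindicE mem_set// mulr1.
Qed.

Lemma ge0_integral_ae_eq (D : set R) (f g : R -> \bar R) : measurable D ->
  (forall x, D x -> 0 <= f x)%E -> (forall x, D x -> 0 <= g x)%E ->
  {ae mu, forall x, D x -> f x = g x} ->
  (\int[mu]_(x in D) f x = \int[mu]_(x in D) g x)%E.
Proof.
move=> mD f0 g0 fg; apply/le_anti/andP; split; apply: le_integral_ae => //;
  by apply: ae_imply fg => x + Dx => /(_ Dx) ->.
Qed.

End ae_derivative.

(** * Discrete energies *)

Section energy.
Context {R : realType} (a b : R) (n : nat).
Notation mu := (@lebesgue_measure R).
Implicit Types (phi : 'I_n -> R -> R) (K : R).

Definition energy_le phi K := forall (m : nat) (u v : 'I_m -> R),
  (forall i, [/\ a <= u i, u i < v i & v i <= b]) ->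
  trivIset [set: 'I_m] (fun i => `]u i, v i[%classic) ->
  \sum_(i < m) \sum_(j < n) (phi j (v i) - phi j (u i)) ^+ 2 / (v i - u i) <= K.

(** Cauchy-Schwarz, obtained by integrating [0 <= (g - c) ^+ 2] with [c] the mean of [g] over the
    interval. *)
Lemma itv_square_integral (g : R -> R) (u v : R) : u < v ->
  mu.-integrable setT (EFin \o g) ->
  (((\int[mu]_(t in `]u, v]) g t) ^+ 2 / (v - u))%:E <=
    \int[mu]_(t in `]u, v]) (g t ^+ 2)%:E)%E.
Proof.
move=> uv ig.
have igI : mu.-integrable `]u, v] (EFin \o g) by exact: integrable_itv.
have [->|] := eqVneq (\int[mu]_(t in `]u, v]) (g t ^+ 2)%:E)%E +oo%E.
  by rewrite leey.
rewrite -ltey => Sfin.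
have mg : measurable_fun `]u, v]%classic g by apply/measurable_EFinP; exact: measurable_int igI.
have ig2 : mu.-integrable `]u, v] (EFin \o (fun t => g t ^+ 2)).
  apply/integrableP; split.
    by apply/measurable_EFinP; exact: measurable_funX.
  by under eq_integral do rewrite /= ger0_norm ?sqr_ge0//.
set D := \int[mu]_(t in `]u, v]) g t; set c := D / (v - u).
have vu : 0 < v - u by rewrite subr_gt0.
have icst : mu.-integrable `]u, v] (EFin \o (fun=> c ^+ 2)).
  apply/integrableP; split; first exact: measurable_cst.
  rewrite /= integral_cst//= lebesgue_measure_itv/= lte_fin uv -EFinB -EFinM.
  exact: ltry.
have icg : mu.-integrable `]u, v] (EFin \o (fun t => 2 * c * g t)).
  rewrite (_ : EFin \o _ = (fun t => (2 * c)%:E * (EFin \o g) t)%E)//.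
  exact: integrableZl.
have -> : D ^+ 2 / (v - u) = \int[mu]_(t in `]u, v]) (2 * c * g t - c ^+ 2).
  rewrite RintegralB// RintegralZl// -/D [X in _ = _ - X]/Rintegral.
  rewrite (@integral_cst _ _ _ _ _ _ (c ^+ 2)%:E)//= lebesgue_measure_itv/= lte_fin uv -EFinB/= /c.
  by field; rewrite gt_eqF.
rewrite -[leRHS]fineK; last first.
  by rewrite ge0_fin_numE// integral_ge0// => t _; rewrite lee_fin sqr_ge0.
rewrite lee_fin; apply: le_Rintegral => //.
  exact: (integrableB _ icg icst).
move=> t _; rewrite -subr_ge0 (_ : _ - _ = (g t - c) ^+ 2) ?sqr_ge0//; ring.
Qed.

Lemma energy_le_of_derive phi K : a < b ->
  (forall j, absolutely_continuous_on a b (phi j)) ->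
  (\int[mu]_(t in `[a, b]) (\sum_(j < n) (derive1 (phi j) t) ^+ 2)%:E <= K%:E)%E ->
  energy_le phi K.
Proof.
move=> ab acphi EK.
(* [g j] is an integrable, hence measurable, version of the derivative; its squares can be
   integrated term by term over disjoint intervals. *)
have /choice[g Hg] j : exists g : R -> R, mu.-integrable setT (EFin \o g) /\
    ((forall t, a <= t <= b -> phi j t - phi j a = \int[mu]_(s in `[a, t]) g s) /\
    {ae mu, forall t, a < t < b -> is_derive t 1 (phi j) (g t)}).
  by have [g ? ?] := absolutely_continuous_derive ab (acphi j); exists g.
pose h t := (\sum_(j < n) (g j t ^+ 2)%:E)%E.
have mg j : measurable_fun setT (g j).
  by apply/measurable_EFinP; have [/measurable_int] := Hg j.
have mgX j : measurable_fun setT (fun t => (g j t ^+ 2)%:E).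
  by apply/measurable_EFinP; exact: measurable_funX.
have mh : measurable_fun setT h by exact: emeasurable_sum.
have h0 t : (0 <= h t)%E by apply: sume_ge0 => j _; rewrite lee_fin sqr_ge0.
have hK : (\int[mu]_(t in `[a, b]) h t <= K%:E)%E.
  apply: le_trans EK; apply: le_integral_ae => //.
    by move=> t _; rewrite lee_fin sumr_ge0// => j _; rewrite sqr_ge0.
  have := ae_and (ae_itvoo a b) (ae_forall_ord (fun j => (Hg j).2.2)).
  apply: ae_imply => t [oo Ht]; rewrite /= in_itv/= => /oo tab.
  rewrite /h -sumEFin lee_sum// => j _; rewrite derive1E.
  by have -> := @derive_val _ _ _ _ _ _ _ (Ht j tab).
move=> m u v uv tuv; rewrite -lee_fin; apply: le_trans hK.
pose I i := `]u i, v i[%classic.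
have mI i : measurable (I i) by exact: measurable_itv.
pose U := \big[setU/set0]_(i <- index_enum 'I_m) I i.
apply: (@le_trans _ _ (\int[mu]_(t in U) h t)%E); last first.
  apply: ge0_subset_integral => //.
  - by apply: bigsetU_measurable => i _; exact: measurable_itv.
  - exact: measurable_funTS.
  - rewrite /U => t; rewrite -bigcup_seq => -[i _]; rewrite /I /= !in_itv/= => /andP[ut tv].
    have [au _ vb] := uv i.
    by rewrite (le_trans au (ltW ut)) (le_trans (ltW tv) vb).
rewrite ge0_integral_bigsetU ?index_enum_uniq//; last 2 first.
- by apply: sub_trivIset tuv.
- exact: measurable_funTS.
rewrite -sumEFin; apply: lee_sum => i _.
have [au uvi vb] := uv i.
have intE j : phi j (v i) - phi j (u i) = \int[mu]_(t in `]u i, v i]) g j t.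
  have [igj [phiE _]] := Hg j.
  rewrite -(@Rintegral_itvB _ _ (BLeft a) (BRight (v i))).
  - rewrite -(phiE (v i)) ?vb ?(le_trans au (ltW uvi))//.
    rewrite -(phiE (u i)) ?au ?(le_trans (ltW uvi) vb)//; ring.
  - exact: integrable_itv.
  - by rewrite bnd_simp.
  - by rewrite bnd_simp ltW.
rewrite (_ : I i = [set` Interval (BSide false (u i)) (BSide true (v i))])//.
rewrite integral_itv_bndo_bndc; last exact: measurable_funTS.
rewrite /h ge0_integral_sum//; last 2 first.
- by move=> j; exact: (measurable_funTS (mgX j)).
- by move=> j t _; rewrite lee_fin sqr_ge0.
rewrite -sumEFin lee_sum// => j _; rewrite intE; apply: itv_square_integral => //.
by have [] := Hg j.
Qed.

Lemma absolutely_continuous_of_energy phi K j : energy_le phi K ->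
  absolutely_continuous_on a b (phi j).
Proof.
move=> H e e0.
have K0 : 0 <= K.
  have := H 0%N (fun=> 0) (fun=> 0); rewrite big_ord0; apply; first by case.
  by case.
(* With this weight the energy term is below [e / 2], and so is the length term once the total
   length is below [e * l]. *)
pose l := e / (K + 1).
have l0 : 0 < l by rewrite divr_gt0// ltr_wpDl.
exists (e * l); first by rewrite mulr_gt0.
move=> m u v uv tuv suv.
have KE := H m u v uv tuv.
(* AM-GM: [`|D| <= l / 2 * (D ^+ 2 / w) + w / (2 * l)]. *)
apply: (@le_lt_trans _ _ (\sum_(i < m)
   (l / 2 * ((phi j (v i) - phi j (u i)) ^+ 2 / (v i - u i)) + (v i - u i) / (2 * l)))).
  apply: ler_sum => i _; have [_ uvi _] := uv i.
  set D := phi j _ - _; set w := v i - u i.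
  have w0 : 0 < w by rewrite subr_gt0.
  have sE : `|D| ^+ 2 = D ^+ 2 by rewrite real_normK// num_real.
  rewrite -sE -subr_ge0.
  rewrite (_ : _ - _ = (l * `|D| - w) ^+ 2 / (2 * l * w)).
    by rewrite divr_ge0 ?sqr_ge0// mulr_ge0 ?ltW// mulr_gt0.
  by field; rewrite !gt_eqF.
rewrite big_split/= -mulr_sumr -mulr_suml.
have h1 : l / 2 * (\sum_(i < m) (phi j (v i) - phi j (u i)) ^+ 2 / (v i - u i)) <= l / 2 * K.
  apply: ler_wpM2l; first by rewrite divr_ge0// ltW.
  apply: (le_trans _ KE); apply: ler_sum => i _.
  rewrite (bigD1 j)//= lerDl sumr_ge0// => k _.
  by have [_ uvi _] := uv i; rewrite divr_ge0 ?sqr_ge0// subr_ge0 ltW.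
have h2 : (\sum_(i < m) (v i - u i)) / (2 * l) < e / 2.
  rewrite ltr_pdivrMr; last by rewrite mulr_gt0.
  by have -> : e / 2 * (2 * l) = e * l by field.
apply: le_lt_trans (lerD h1 (lexx _)) _.
have h3 : l / 2 * K < e / 2.
  have : l * (K + 1) = e by rewrite /l divfK// gt_eqF// ltr_wpDl.
  nra.
lra.
Qed.

Lemma le_limn_einf (u : (\bar R)^nat) (x : R) :
  (forall e, 0 < e -> \forall m \near \oo, ((x - e)%:E <= u m)%E) ->
  (x%:E <= limn_einf u)%E.
Proof.
move=> H; apply/lee_subgt0Pr => e e0; rewrite limn_einf_lim.
have [N _ HN] := H e e0.
apply: lime_ge; first exact: is_cvg_einfs.
exists N => // m /= Nm; apply: le_ereal_inf_tmp => _ [k /= mk <-].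
by rewrite -EFinB; apply: HN => /=; exact: leq_trans mk.
Qed.

Lemma limn_einf_le (u : (\bar R)^nat) (x : \bar R) :
  (forall m, (u m <= x)%E) -> (limn_einf u <= x)%E.
Proof.
move=> H; rewrite limn_einf_lim; apply: lime_le; first exact: is_cvg_einfs.
apply: nearW => m; apply: le_trans (H m).
by apply: ereal_inf_lbound; exists m => /=.
Qed.

(* Difference quotients over intervals that contain [t] but need not start at it:
   these are the slopes of the piecewise linear interpolations in the next lemma. *)
Lemma straddle_quotient (f : R -> R) (t d e : R) : is_derive t 1 f d -> 0 < e ->
  exists2 eta, 0 < eta & forall u v, u <= t -> t <= v -> u < v -> v - u < eta ->
    `|(f v - f u) / (v - u) - d| <= e.
Proof.
move=> /is_derive1_caratheodory[g [fg cg gd]] e0.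
have /cvgrPdist_le/(_ e e0)/nbhs_ballP[eta /= eta0 Heta] := cg.
exists eta => // u v ut tv uv vu.
have vu0 : 0 < v - u by rewrite subr_gt0.
have -> : (f v - f u) / (v - u) - d =
    ((g v - d) * (v - t) + (g u - d) * (t - u)) / (v - u).
  have -> : f v - f u = g v * (v - t) - g u * (u - t) by rewrite -!fg; ring.
  by field; rewrite gt_eqF.
rewrite normrM normfV (gtr0_norm vu0) ler_pdivrMr//.
apply: le_trans (ler_normD _ _) _; rewrite !normrM.
have -> : e * (v - u) = e * (v - t) + e * (t - u) by ring.
have Hv : `|g v - d| <= e.
  by rewrite distrC -gd; apply: Heta; rewrite /ball/= ler0_norm; lra.
have Hu : `|g u - d| <= e.
  by rewrite distrC -gd; apply: Heta; rewrite /ball/= ger0_norm; lra.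
by apply: lerD; [rewrite (@ger0_norm _ (v - t)) ?subr_ge0//|
  rewrite (@ger0_norm _ (t - u)) ?subr_ge0//]; apply: ler_wpM2r => //; rewrite subr_ge0.
Qed.

(* Fatou's lemma along the squared slopes over uniform partitions. *)
Lemma derive_of_energy_le phi K : a < b -> energy_le phi K ->
  (\int[mu]_(t in `[a, b]) (\sum_(j < n) (derive1 (phi j) t) ^+ 2)%:E <= K%:E)%E.
Proof.
move=> ab H.
have acphi j := absolutely_continuous_of_energy j H.
pose h m : R := (b - a) / m.+1%:R.
have h0 m : 0 < h m by rewrite divr_gt0// subr_gt0.
pose p m i : R := a + i%:R * h m.
have pS m i : p m i.+1 - p m i = h m by rewrite /p -natr1; ring.
pose c m i := \sum_(j < n) ((phi j (p m i.+1) - phi j (p m i)) / h m) ^+ 2.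
have c0 m i : 0 <= c m i by apply: sumr_ge0 => j _; exact: sqr_ge0.
pose q m t := (\sum_(i < m.+1) (c m i)%:E * (\1_(`[p m i, p m i.+1[%classic : set R) t)%:E)%E.
have mq m : measurable_fun setT (q m).
  apply: emeasurable_sum => i; apply: emeasurable_funM; first exact: measurable_cst.
  by apply/measurable_EFinP; exact: measurable_indic.
have q0 m t : (0 <= q m t)%E.
  by apply: sume_ge0 => i _; rewrite mule_ge0 ?lee_fin.
have intq m : (\int[mu]_(t in `[a, b]) q m t <= K%:E)%E.
  rewrite ge0_integral_sum//; last 2 first.
  - move=> i; apply: measurable_funTS; apply: emeasurable_funM; first exact: measurable_cst.
    by apply/measurable_EFinP; exact: measurable_indic.
  - by move=> i t _; rewrite mule_ge0 ?lee_fin.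
  apply: (@le_trans _ _ (\sum_(i < m.+1) (c m i * h m)%:E)%E).
    apply: lee_sum => i _; rewrite ge0_integralZl//; last 2 first.
    - by apply/measurable_EFinP; apply: measurable_funTS; exact: measurable_indic.
    - by rewrite lee_fin.
    rewrite EFinM lee_wpmul2l ?lee_fin// integral_indic//.
    apply: (@le_trans _ _ (mu `[p m i, p m i.+1[%classic)).
      by rewrite le_measure ?inE//; exact: measurableI.
    rewrite lebesgue_measure_itv/= lte_fin -subr_gt0 pS h0 -EFinB pS.
    exact: lexx.
  rewrite sumEFin lee_fin.
  apply: le_trans (H m.+1 (fun i => p m i) (fun i => p m i.+1) _ _).
  - apply: ler_sum => i _; rewrite pS mulr_suml; apply: ler_sum => j _.
    by rewrite le_eqVlt; apply/orP; left; apply/eqP; field; rewrite gt_eqF.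
  - move=> i; split.
    + by rewrite lerDl mulr_ge0// ltW.
    + by rewrite -subr_gt0 pS.
    + have : p m i.+1 <= p m m.+1 by rewrite lerD2l ler_wpM2r ?ler_nat// ltW.
      by rewrite {2}/p /h mulrC divfK// addrC subrK.
  - move=> i j _ _ [x [/=]]; rewrite !in_itv/= => /andP[x1 x2] /andP[y1 y2].
    have lt k l : p m k < p m l.+1 -> (k <= l)%N.
      by rewrite /p ltrD2l ltr_pM2r// ltr_nat ltnS.
    apply/val_inj => /=; apply/eqP; rewrite eqn_leq.
    by rewrite (lt _ _ (lt_trans x1 y2)) (lt _ _ (lt_trans y1 x2)).
apply: (@le_trans _ _ (\int[mu]_(t in `[a, b]) limn_einf (q^~ t))%E); last first.
  apply: le_trans (fatou _ _ _ _) _ => //.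
  - by move=> m; exact: (measurable_funTS (mq m)).
  - exact: limn_einf_le.
apply: le_integral_ae => //.
- by move=> t _; rewrite lee_fin sumr_ge0// => j _; rewrite sqr_ge0.
- move=> t _; apply: le_limn_einf => e e0; apply: nearW => m.
  by apply: le_trans (q0 m t); rewrite lee_fin sub0r oppr_le0 ltW.
have := ae_and (ae_itvoo a b)
  (ae_forall_ord (fun j => absolutely_continuous_derive1 ab (acphi j))).
apply: ae_imply => t [oo Ht]; rewrite /= in_itv/= => /oo tab.
have /andP[/ltW at_ tb'] := tab.
apply: le_limn_einf => e e0.
pose d j := derive1 (phi j) t.
pose S := \sum_(j < n) `|d j|.
have S0 : 0 <= S by apply: sumr_ge0.
(* Since [Q ^+ 2 >= d ^+ 2 + 2 * d * (Q - d)], an error [e'] in every slope lowers the sum of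
   squares by at most [2 * S * e' <= e]. *)
pose e' := e / (2 * (S + 1)).
have e'0 : 0 < e' by rewrite divr_gt0// mulr_gt0// ltr_wpDl.
have /choice[eta Heta] j : exists eta, 0 < eta /\ forall u v, u <= t -> t <= v -> u < v -> v - u < eta ->
    `|(phi j v - phi j u) / (v - u) - d j| <= e'.
  by have [eta ? ?] := straddle_quotient (Ht j tab) e'0; exists eta.
have : \forall m \near \oo, forall j, h m < eta j.
  apply: filter_forall => j; have [eta0 _] := Heta j.
  have := @cvg_harmonic R.
  move=> /cvgrPdist_lt/(_ (eta j / (b - a))); rewrite divr_gt0 ?subr_gt0// => /(_ isT).
  apply: filterS => m; rewrite sub0r normrN ger0_norm ?harmonic_ge0//= ltr_pdivlMr ?subr_gt0//.
  by rewrite mulrC.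
apply: filterS => m Hm.
have [i iE] : exists i : 'I_m.+1, p m i <= t < p m i.+1.
  have x0 : 0 <= (t - a) / h m by rewrite divr_ge0 ?subr_ge0// ltW.
  have /andP[i1 i2] := truncn_itv x0.
  set i := Num.trunc _ in i1 i2.
  have im : (i < m.+1)%N.
    rewrite -(ltr_nat R); apply: le_lt_trans i1 _.
    rewrite ltr_pdivrMr// /h mulrC divfK//; lra.
  exists (Ordinal im) => /=; rewrite /p; apply/andP; split.
    by move: i1; rewrite ler_pdivlMr//; lra.
  by move: i2; rewrite ltr_pdivrMr//; lra.
apply: (@le_trans _ _ (c m i)%:E).
  rewrite lee_fin lerBlDr -[leLHS]/(\sum_(j < n) d j ^+ 2).
  have : \sum_(j < n) (d j ^+ 2 - 2 * `|d j| * e') <= c m i.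
    apply: ler_sum => j _.
    have [_ /(_ (p m i) (p m i.+1))] := Heta j.
    rewrite pS; case/andP: iE => it ti /(_ it (ltW ti)).
    rewrite -subr_gt0 pS => /(_ (h0 m) (Hm j)).
    set Q := _ / h m; rewrite ler_norml => /andP[Q1 Q2].
    have : `|d j * (Q - d j)| <= `|d j| * e'.
      by rewrite normrM ler_wpM2l// ler_norml Q1 Q2.
    rewrite ler_norml => /andP[D1 _].
    by have := sqr_ge0 (Q - d j); nra.
  rewrite sumrB -mulr_suml -mulr_sumr -/S => HH.
  have : e' * (2 * (S + 1)) = e by rewrite /e' divfK// mulf_neq0// gt_eqF// ltr_wpDl.
  move: HH; move: (\sum_(j < n) d j ^+ 2) (c m i) => A B; nra.
rewrite /q (bigD1 i)//= indicE mem_set ?mule1; last by rewrite /= in_itv.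
by rewrite leeDl// sume_ge0// => k _; rewrite mule_ge0 ?lee_fin.
Qed.

End energy.

(** * Closure properties of absolute continuity *)

Section ac_closure.
Context {R : realType}.
Notation mu := (@lebesgue_measure R).
Implicit Types (a b : R) (f g : R -> R).

(** The common source of the closure properties: two functions [u] give sums, one gives Lipschitz
    compositions, and the identity gives Lipschitz functions such as the integral of the drift. *)
Lemma absolutely_continuous_lip a b (n : nat) (f : R -> R) (u : 'I_n -> R -> R) (L : R) :
  (forall j, absolutely_continuous_on a b (u j)) ->
  (forall s t, a <= s <= b -> a <= t <= b ->
    `|f t - f s| <= L * \sum_(j < n) `|u j t - u j s|) ->
  absolutely_continuous_on a b f.
Proof.
move=> acu Hf e e0.
pose c := e / (n.+1%:R * (`|L| + 1)).
have L0 : 0 < `|L| + 1 by rewrite ltr_wpDl.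
have c0 : 0 < c by rewrite divr_gt0// mulr_gt0.
have /choice[delta Hd] j : exists delta, 0 < delta /\ forall (m : nat) (u0 v : 'I_m -> R),
      (forall i, [/\ a <= u0 i, u0 i < v i & v i <= b]) ->
      trivIset [set: 'I_m] (fun i => `]u0 i, v i[%classic) ->
      \sum_(i < m) (v i - u0 i) < delta ->
      \sum_(i < m) `|u j (v i) - u j (u0 i)| < c.
  by have [delta ? ?] := acu j c c0; exists delta.
pose dl := \big[Num.min/1]_(j < n) delta j.
have dl0 : 0 < dl.
  by rewrite /dl; elim/big_ind: _ => // [x y x0 y0|j _]; [rewrite lt_min x0|exact: (Hd j).1].
have dlj j : dl <= delta j by exact: bigmin_le_cond.
exists dl => // m p q pq tpq spq.
apply: (@le_lt_trans _ _ (\sum_(i < m) (`|L| + 1) * \sum_(j < n) `|u j (q i) - u j (p i)|)).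
  apply: ler_sum => i _; have [ap /ltW pqi qb] := pq i.
  apply: (le_trans (Hf _ _ _ _)).
  - by rewrite ap (le_trans pqi qb).
  - by rewrite qb (le_trans ap pqi).
  - apply: ler_wpM2r; first by apply: sumr_ge0.
    by apply: (le_trans (ler_norm _)); rewrite lerDl.
rewrite -mulr_sumr exchange_big/=.
apply: (@le_lt_trans _ _ ((`|L| + 1) * \sum_(j < n) c)).
  apply: ler_wpM2l; first exact: ltW.
  apply: ler_sum => j _; apply: ltW; apply: (Hd j).2 => //.
  exact: lt_le_trans spq (dlj j).
rewrite sumr_const card_ord -mulr_natr.
have cE : c * (n.+1%:R * (`|L| + 1)) = e by rewrite /c divfK// mulf_neq0// gt_eqF.
rewrite -{}cE -natr1.
have : 0 < c * (`|L| + 1) by rewrite mulr_gt0.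
by set C := c; set M := `|L| + 1; move=> ?; nra.
Qed.

Lemma absolutely_continuous_comp a b f (F : R -> R) (D : R -> Prop) (L : R) :
  absolutely_continuous_on a b f ->
  (forall t, a <= t <= b -> D (f t)) ->
  (forall x y, D x -> D y -> `|F y - F x| <= L * `|y - x|) ->
  absolutely_continuous_on a b (F \o f).
Proof.
move=> acf fD FL.
apply: (@absolutely_continuous_lip _ _ 1 _ (fun=> f) L) => // s t sab tab.
by rewrite big_ord1; apply: FL; exact: fD.
Qed.

Lemma absolutely_continuousD a b f g :
  absolutely_continuous_on a b f -> absolutely_continuous_on a b g ->
  absolutely_continuous_on a b (f \+ g).
Proof.
move=> acf acg.
apply: (@absolutely_continuous_lip _ _ 2 _ (fun i => if i == ord0 then f else g) 1).
  by move=> j; case: ifP.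
move=> s t _ _; rewrite mul1r big_ord_recl big_ord1/=.
rewrite (_ : f t + g t - (f s + g s) = (f t - f s) + (g t - g s)); last ring.
exact: ler_normD.
Qed.

Lemma absolutely_continuousZ a b f c :
  absolutely_continuous_on a b f -> absolutely_continuous_on a b (fun t => c * f t).
Proof.
move=> acf; apply: (@absolutely_continuous_comp _ _ f (fun x => c * x) (fun=> True) `|c|) => //.
by move=> x y _ _; rewrite -mulrBr normrM.
Qed.

Lemma absolutely_continuousB a b f g :
  absolutely_continuous_on a b f -> absolutely_continuous_on a b g ->
  absolutely_continuous_on a b (f \- g).
Proof.
move=> acf acg.
have := absolutely_continuousD acf (absolutely_continuousZ (-1) acg).
by congr absolutely_continuous_on; apply/funext => t /=; rewrite mulN1r.
Qed.

Lemma absolutely_continuous_cst a b (c : R) : absolutely_continuous_on a b (fun=> c).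
Proof.
by move=> e e0; exists 1 => // m u v _ _ _; rewrite big1// => i _; rewrite subrr normr0.
Qed.

Lemma absolutely_continuous_sum a b (I : Type) (r : seq I) (P : pred I) (f : I -> R -> R) :
  (forall i, P i -> absolutely_continuous_on a b (f i)) ->
  absolutely_continuous_on a b (fun t => \sum_(i <- r | P i) f i t).
Proof.
move=> acf; elim: r => [|i r IH].
  have := @absolutely_continuous_cst a b 0.
  by congr absolutely_continuous_on; apply/funext => t; rewrite big_nil.
case Pi : (P i); last first.
  by move: IH; congr absolutely_continuous_on; apply/funext => t; rewrite big_cons Pi.
have := absolutely_continuousD (acf i Pi) IH.
by congr absolutely_continuous_on; apply/funext => t; rewrite big_cons Pi.
Qed.

Lemma absolutely_continuous_continuous a b f : a <= b -> absolutely_continuous_on a b f ->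
  continuous (f \o clamp a b).
Proof. by move=> ab /absolutely_continuous_dist; exact: continuous_clamp. Qed.

Lemma absolutely_continuous_ln a b f c : 0 < c ->
  absolutely_continuous_on a b f -> (forall t, a <= t <= b -> c <= f t) ->
  absolutely_continuous_on a b (fun t => ln (f t)).
Proof.
move=> c0 acf fc.
apply: (@absolutely_continuous_comp _ _ f (@ln R) (fun x => c <= x) c^-1) => //.
have K x y : c <= x -> c <= y -> x <= y -> `|ln y - ln x| <= c^-1 * `|y - x|.
  move=> cx cy xy; have x0 := lt_le_trans c0 cx; have y0 := lt_le_trans c0 cy.
  rewrite ger0_norm ?subr_ge0 ?ler_ln ?posrE// ger0_norm ?subr_ge0//.
  rewrite -ln_div ?posrE//.
  rewrite (_ : y / x = 1 + (y - x) / x); last by field; rewrite gt_eqF.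
  apply: le_trans (le_ln1Dx _) _.
    by rewrite (lt_le_trans (ltrN10 _))// divr_ge0 ?subr_ge0// ltW.
  by rewrite mulrC ler_wpM2r ?subr_ge0// lef_pV2.
move=> x y cx cy; have [xy|/ltW yx] := leP x y; first exact: K.
by rewrite distrC (distrC y); exact: K.
Qed.

Lemma absolutely_continuous_sqr a b f : a <= b -> absolutely_continuous_on a b f ->
  absolutely_continuous_on a b (fun t => f t ^+ 2).
Proof.
move=> ab acf.
have cf := absolutely_continuous_continuous ab acf.
have [M HM] : exists M, forall t, a <= t <= b -> `|f t| <= M.
  have cnf : {within `[a, b], continuous (fun t => `|(f \o clamp a b) t|)}.
    apply: continuous_subspaceT => t; apply: continuous_comp; first exact: cf.
    exact: norm_continuous.
  have [c _ Hc] := EVT_max ab cnf.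
  exists `|f (clamp a b c)| => t tab.
  by have := Hc t; rewrite in_itv/= clamp_id//; apply.
apply: (@absolutely_continuous_comp _ _ f (fun x => x ^+ 2) (fun x => `|x| <= M) (2 * M)) => //.
move=> x y xM yM; rewrite subr_sqr mulrC normrM ler_wpM2r//.
by apply: (le_trans (ler_normD _ _)); lra.
Qed.

Lemma absolutely_continuous_growth a b (H rho : R -> R) (K c1 c2 : R) : a < b ->
  absolutely_continuous_on a b H -> (forall t, 0 <= rho t) -> 0 < c1 -> 0 <= c2 ->
  (\int[mu]_(t in `[a, b]) (rho t)%:E <= K%:E)%E ->
  {ae mu, forall t, a < t < b -> forall d, is_derive t 1 H d ->
    d <= c1 * rho t + c2} ->
  forall t, a <= t <= b -> H t <= H a + c1 * K + c2 * (b - a).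
Proof.
move=> ab acH rho0 c10 c20 rK Hd t /andP[at_ tb].
have [g ig [gE gd]] := absolutely_continuous_derive ab acH.
have mg : measurable_fun setT g by apply/measurable_EFinP; exact: measurable_int ig.
(* [rho] need not be measurable. It is replaced by the least nonnegative [q] with
   [g <= c1 * q + c2], which is measurable and almost everywhere at most [rho]. *)
pose q t := Num.max 0 ((g t - c2) / c1).
have mq : measurable_fun setT q.
  apply: measurable_maxr; first exact: measurable_cst.
  by apply: measurable_funM => //; apply: measurable_funB.
have q0 s : 0 <= q s by rewrite le_max lexx.
have qK : (\int[mu]_(s in `[a, b]) (q s)%:E <= K%:E)%E.
  apply: le_trans rK; apply: le_integral_ae => //.
  - by move=> s _; rewrite lee_fin.
  - by move=> s _; rewrite lee_fin.
  have := ae_and (ae_itvoo a b) (ae_and gd Hd).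
  apply: ae_imply => s [oo [gs Hs]]; rewrite /= in_itv/= => /oo sab.
  by rewrite lee_fin ge_max rho0/= ler_pdivrMr// lerBlDr mulrC; exact: Hs (gs sab).
have qfin : (\int[mu]_(s in `[a, b]) (q s)%:E < +oo)%E.
  by apply: le_lt_trans qK _; rewrite ltry.
have iq : mu.-integrable `[a, b] (EFin \o q).
  apply/integrableP; split.
    by apply/measurable_EFinP; exact: (measurable_funTS mq).
  by under eq_integral do rewrite /= ger0_norm ?q0//.
have iqt : mu.-integrable `[a, t] (EFin \o q).
  apply: integrableS iq => //.
  by move=> s /=; rewrite !in_itv/= => /andP[-> st]; rewrite (le_trans st tb).
have igt := integrable_itv `[a, t] ig.
have icst : mu.-integrable `[a, t] (EFin \o (fun=> c2)).
  apply/integrableP; split; first exact: measurable_cst.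
  rewrite /= integral_cst//= lebesgue_measure_itv/= lte_fin; case: ifP => _.
    by rewrite -EFinB -EFinM ltry.
  by rewrite mule0 ltry.
have icq : mu.-integrable `[a, t] (EFin \o (fun s => c1 * q s)).
  rewrite (_ : EFin \o _ = (fun s => c1%:E * (EFin \o q) s)%E)//.
  exact: integrableZl.
have i2 : mu.-integrable `[a, t] (EFin \o (fun s => c1 * q s + c2)).
  exact: (integrableD _ icq icst).
have : H t - H a <= \int[mu]_(s in `[a, t]) (c1 * q s + c2).
  rewrite gE ?at_//; apply: le_Rintegral => // s _.
  rewrite -lerBlDr mulrC -ler_pdivrMr//.
  by rewrite le_max lexx orbT.
rewrite RintegralD// RintegralZl// Rintegral_cst_itv//.
have h1 : c2 * (t - a) <= c2 * (b - a) by rewrite ler_wpM2l// lerD2r.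
have h2 : \int[mu]_(s in `[a, t]) q s <= K.
  rewrite -lee_fin /Rintegral fineK; last first.
    exact: integral_fune_fin_num.
  apply: le_trans qK; apply: ge0_subset_integral => //.
  - by apply/measurable_EFinP; exact: (measurable_funTS mq).
  - by move=> s _; rewrite lee_fin.
  by move=> s /=; rewrite !in_itv/= => /andP[-> st]; rewrite (le_trans st tb).
have h3 : c1 * \int[mu]_(s in `[a, t]) q s <= c1 * K by rewrite ler_wpM2l// ltW.
by move=> h0; have := le_trans h0 (lerD h3 h1); rewrite lerBlDl addrA.
Qed.

End ac_closure.

(** * The gap estimate *)

Section gap_estimate.
Context {R : realType} (n : nat).
Implicit Types (x y : 'I_n -> R) (u : 'I_n -> R -> R).

Definition repulsion x (j : 'I_n) : R := \sum_(i < n | i != j) 4 / (x j - x i).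

(* The first logarithm makes every summand nonnegative, so that a bound on the sum
   bounds each gap from below even when the particles are far from the origin. *)
Definition log_energy x : R := \sum_(i < n) \sum_(j < n | j != i)
  (2 * ln (1 + \sum_(k < n) x k ^+ 2) - ln ((x i - x j) ^+ 2)).

(** With [W] the sum of squares, the left side is at most [2 * W <= (1 + W) ^+ 2]. This is what
    makes the summands of [log_energy] nonnegative. *)
Lemma sqr_gap_le x i j : (x i - x j) ^+ 2 <= (1 + \sum_(k < n) x k ^+ 2) ^+ 2.
Proof.
have [->|ij] := eqVneq i j.
  by rewrite subrr expr0n/= sqr_ge0.
have : x i ^+ 2 + x j ^+ 2 <= \sum_(k < n) x k ^+ 2.
  rewrite (bigD1 i)//= lerD2l (bigD1 j)//=; last by rewrite eq_sym.
  by rewrite lerDl sumr_ge0// => k _; rewrite sqr_ge0.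
set W := \sum_(k < n) _ => W0.
by have := sqr_ge0 (x i + x j); have := sqr_ge0 (x i - x j); have := sqr_ge0 W; nra.
Qed.

Lemma sqr_gap_ge x i j : i != j -> (forall k l, k != l -> x k != x l) ->
  expR (- log_energy x) <= (x i - x j) ^+ 2.
Proof.
move=> ij xinj.
set W := \sum_(k < n) x k ^+ 2.
have W0 : 0 <= W by apply: sumr_ge0 => k _; exact: sqr_ge0.
have lW : 0 <= ln (1 + W) by rewrite ln_ge0// lerDl.
have d0 k l : l != k -> 0 < (x k - x l) ^+ 2.
  by move=> lk; rewrite exprn_even_gt0//= subr_eq0 eq_sym xinj.
have t0 k l : l != k -> 0 <= 2 * ln (1 + W) - ln ((x k - x l) ^+ 2).
  move=> lk; rewrite subr_ge0 mulr_natl -lnXn ?ltr_pwDl//.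
  by rewrite ler_ln ?posrE ?d0 ?exprn_gt0 ?ltr_pwDl// sqr_gap_le.
rewrite -[leRHS]lnK ?posrE ?d0//; last by rewrite eq_sym.
rewrite ler_expR lerNl.
apply: (@le_trans _ _ (2 * ln (1 + W) - ln ((x i - x j) ^+ 2))); first by rewrite lerDr mulr_ge0.
rewrite /log_energy (bigD1 i)//= (bigD1 j)/=; last by rewrite eq_sym.
rewrite -addrA lerDl addr_ge0//.
  by apply: sumr_ge0 => l /andP[li _]; exact: t0.
by apply: sumr_ge0 => k _; apply: sumr_ge0 => l lk; exact: t0.
Qed.

(** Pair [(i, j)] with [(j, i)]. For [c = x] the right side is twice the number of ordered pairs;
    for [c] a velocity it is, up to sign, the derivative of the logarithmic interaction. *)
Lemma sum_repulsion x (c : 'I_n -> R) :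
  \sum_(j < n) c j * repulsion x j =
  2 * \sum_(i < n) \sum_(j < n | j != i) (c i - c j) / (x i - x j).
Proof.
pose S := \sum_(i < n) \sum_(j < n | j != i) c i / (x i - x j).
have -> : \sum_(j < n) c j * repulsion x j = 4 * S.
  rewrite /S mulr_sumr; apply: eq_bigr => i _; rewrite mulr_sumr mulr_sumr.
  by apply: eq_bigr => j _; rewrite mulrCA.
have -> : \sum_(i < n) \sum_(j < n | j != i) (c i - c j) / (x i - x j) = S + S.
  have SE : S = \sum_(i < n) \sum_(j < n | j != i) c j / (x j - x i).
    rewrite /S (exchange_big_dep predT)//=; apply: eq_bigr => i _.
    by apply: eq_bigl => j; rewrite eq_sym.
  rewrite {2}SE /S -big_split/=; apply: eq_bigr => i _.
  rewrite -big_split/=; apply: eq_bigr => j _.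
  by rewrite mulrBl -[x j - x i]opprB invrN mulrN.
ring.
Qed.

Lemma is_derive_bigsum (I : Type) (r : seq I) (P : pred I) (f : I -> R -> R) (df : I -> R) (t : R) :
  (forall i, P i -> is_derive t 1 (f i) (df i)) ->
  is_derive t 1 (fun s => \sum_(i <- r | P i) f i s) (\sum_(i <- r | P i) df i).
Proof.
move=> fd; elim: r => [|i r IH].
  rewrite big_nil; have := is_derive_cst (0 : R) t (1 : R).
  by congr is_derive; apply/funext => s; rewrite big_nil.
rewrite big_cons; case: ifP => Pi; last first.
  by move: IH; congr is_derive; apply/funext => s; rewrite big_cons Pi.
have := is_deriveD (fd i Pi) IH.
by congr is_derive; apply/funext => s; rewrite big_cons Pi.
Qed.

Lemma is_derive_ln_comp (f : R -> R) (t d : R) : 0 < f t -> is_derive t 1 f d ->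
  is_derive t 1 (fun s => ln (f s)) (d / f t).
Proof.
move=> f0 fd; have := @is_derive1_comp R (@ln R) f t _ _ (is_derive1_ln f0) fd.
by rewrite mulrC.
Qed.

Lemma is_derive_sqr_comp (f : R -> R) (t d : R) : is_derive t 1 f d ->
  is_derive t 1 (fun s => f s ^+ 2) (2 * f t * d).
Proof.
move=> fd; apply: is_derive_eq.
by rewrite /GRing.scale/=; ring.
Qed.

Lemma is_derive_log_energy u (d : 'I_n -> R) (t : R) :
  (forall k l, k != l -> u k t != u l t) ->
  (forall j, is_derive t 1 (u j) (d j)) ->
  is_derive t 1 (fun s => log_energy (u^~ s))
   (\sum_(i < n) \sum_(j < n | j != i)
     (2 * ((\sum_(k < n) 2 * u k t * d k) / (1 + \sum_(k < n) u k t ^+ 2)) -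
      2 * (d i - d j) / (u i t - u j t))).
Proof.
move=> uinj ud.
have W0 : 0 <= \sum_(k < n) u k t ^+ 2 by apply: sumr_ge0 => k _; exact: sqr_ge0.
apply: is_derive_bigsum => i _; apply: is_derive_bigsum => j ji.
have uij : u i t - u j t != 0 by rewrite subr_eq0 eq_sym uinj.
apply: is_deriveB.
  have H : is_derive t 1 (fun s => ln (1 + \sum_(k < n) u k s ^+ 2))
    ((\sum_(k < n) 2 * u k t * d k) / (1 + \sum_(k < n) u k t ^+ 2)).
    apply: is_derive_ln_comp; first by rewrite ltr_pwDl.
    rewrite -[X in is_derive _ _ _ X]add0r; apply: is_deriveD.
    apply: is_derive_bigsum => k _; exact: is_derive_sqr_comp.
  exact: is_deriveZ.
have -> : 2 * (d i - d j) / (u i t - u j t) =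
   2 * (u i t - u j t) * (d i - d j) / (u i t - u j t) ^+ 2 by field.
apply: (@is_derive_ln_comp (fun s => (u i s - u j s) ^+ 2)).
  by rewrite exprn_even_gt0.
by apply: (@is_derive_sqr_comp (fun s => u i s - u j s)); exact: is_deriveB.
Qed.

(* The repulsion [b] is minus the gradient of the second logarithm, which thus
   contributes [- d * b = - (b + psi) * b <= psi ^ 2]; in the first one the
   contribution of [b] is bounded because [x * b] is constant. *)
Lemma log_energy_growth x (d : 'I_n -> R) (P := (\sum_(i < n) \sum_(j < n | j != i) 1 : R)) :
  (forall k l, k != l -> x k != x l) ->
  \sum_(i < n) \sum_(j < n | j != i)
     (2 * ((\sum_(k < n) 2 * x k * d k) / (1 + \sum_(k < n) x k ^+ 2)) -
      2 * (d i - d j) / (x i - x j)) <=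
  (2 * P + 1) * \sum_(j < n) (d j - repulsion x j) ^+ 2 + 2 * P * (1 + 4 * P).
Proof.
move=> xinj.
set W := \sum_(k < n) x k ^+ 2; set b := repulsion x.
pose psi j := d j - b j.
set E := \sum_(j < n) (d j - b j) ^+ 2.
have W0 : 0 <= W by apply: sumr_ge0 => k _; exact: sqr_ge0.
have E0 : 0 <= E by apply: sumr_ge0 => k _; exact: sqr_ge0.
have P0 : 0 <= P by apply: sumr_ge0 => i _; apply: sumr_ge0.
set D := \sum_(k < n) 2 * x k * d k.
have -> : \sum_(i < n) \sum_(j < n | j != i)
     (2 * (D / (1 + W)) - 2 * (d i - d j) / (x i - x j)) =
   2 * (D / (1 + W)) * P - \sum_(j < n) d j * b j.
  rewrite /b sum_repulsion /P mulr_sumr mulr_sumr -sumrB; apply: eq_bigr => i _.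
  rewrite mulr_sumr mulr_sumr -sumrB; apply: eq_bigr => j _.
  by rewrite mulr1 -mulrA.
have xb : \sum_(j < n) x j * b j = 2 * P.
  rewrite /b sum_repulsion; congr (_ * _); apply: eq_bigr => i _; apply: eq_bigr => j ji.
  by rewrite divff// subr_eq0 eq_sym xinj.
have DW : D <= W + E + 4 * P.
  have -> : D = \sum_(k < n) 2 * x k * psi k + 2 * \sum_(j < n) x j * b j.
    rewrite /D mulr_sumr -big_split/=; apply: eq_bigr => k _; rewrite /psi; ring.
  rewrite xb mulrA -natrM lerD2r /W /E -big_split/=; apply: ler_sum => k _.
  by have := sqr_ge0 (x k - psi k); rewrite /psi; nra.
have dbE : - \sum_(j < n) d j * b j <= E.
  rewrite /E -sumrN; apply: ler_sum => j _.
  by have := sqr_ge0 (d j - b j / 2); have := sqr_ge0 (b j); nra.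
have W1 : 0 < 1 + W by rewrite ltr_pwDl.
have : D / (1 + W) <= 1 + E + 4 * P.
  by rewrite ler_pdivrMr//; nra.
by move=> h; nra.
Qed.

(** Integrates [log_energy_growth] along [u]. One [g] serves every horizon [s <= T], as required
    when the bound is applied on an initial interval in [path_shadowing]. *)
Lemma gap_bound x (T K : R) : (forall k l, k != l -> x k != x l) -> exists2 g : R, 0 < g &
  forall (s : R) u, 0 < s -> s <= T ->
    (forall j, absolutely_continuous_on 0 s (u j)) ->
    (forall t, 0 <= t <= s -> forall k l, k != l -> u k t != u l t) ->
    (forall j, u j 0 = x j) ->
    (\int[lebesgue_measure]_(t in `[0%R, s])
      (\sum_(j < n) (derive1 (u j) t - repulsion (u^~ t) j) ^+ 2)%:E <= K%:E)%E ->
    forall t, 0 <= t <= s -> forall k l, k != l -> g <= `|u k t - u l t|.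
Proof.
move=> xinj.
pose P : R := \sum_(i < n) \sum_(j < n | j != i) 1.
have P0 : 0 <= P by apply: sumr_ge0 => i _; apply: sumr_ge0.
exists (Num.sqrt (expR (- (log_energy x + (2 * P + 1) * K + 2 * P * (1 + 4 * P) * T)))).
  by rewrite sqrtr_gt0 expR_gt0.
move=> s u s0 sT acu uinj ux uK t ts k l kl.
rewrite -sqrtr_sqr ler_wsqrtr//; apply: le_trans (sqr_gap_ge kl (uinj t ts)).
rewrite ler_expR lerN2.
pose H r := log_energy (u^~ r).
have -> : log_energy x = H 0 by rewrite /H; congr log_energy; apply/funext => j; rewrite ux.
pose rho r := \sum_(j < n) (derive1 (u j) r - repulsion (u^~ r) j) ^+ 2.
have c2 : 0 <= 2 * P * (1 + 4 * P) by rewrite mulr_ge0 ?addr_ge0 ?mulr_ge0.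
apply: (@le_trans _ _ (H 0 + (2 * P + 1) * K + 2 * P * (1 + 4 * P) * (s - 0))); last first.
  by rewrite subr0 lerD2l ler_wpM2l.
apply: (@absolutely_continuous_growth _ 0 s H rho) => //.
- apply: absolutely_continuous_sum => i _; apply: absolutely_continuous_sum => j ji.
  apply: absolutely_continuousB.
    apply: absolutely_continuousZ.
    apply: (@absolutely_continuous_ln _ _ _ _ 1) => //.
      apply: absolutely_continuousD; first exact: absolutely_continuous_cst.
      by apply: absolutely_continuous_sum => m _; apply: absolutely_continuous_sqr => //; exact: ltW.
    by move=> r _; rewrite lerDl sumr_ge0// => m _; exact: sqr_ge0.
  have acij : absolutely_continuous_on 0 s (fun r => (u i r - u j r) ^+ 2).
    by apply: absolutely_continuous_sqr; [exact: ltW|exact: absolutely_continuousB].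
  have cij := absolutely_continuous_continuous (ltW s0) acij.
  (* This minimum is positive but depends on [u]. It serves only to make the logarithm absolutely
     continuous and does not enter [g]. *)
  have [c] := EVT_min (ltW s0) (continuous_subspaceT cij).
  rewrite in_itv/= => c01 Hc.
  apply: (@absolutely_continuous_ln _ _ _ _ ((u i c - u j c) ^+ 2)) => //.
    by rewrite exprn_even_gt0//= subr_eq0 eq_sym uinj.
  move=> r r01; have := Hc r; rewrite in_itv/= !clamp_id//; exact.
- by move=> r; apply: sumr_ge0 => j _; exact: sqr_ge0.
- by rewrite ltr_wpDl ?mulr_ge0.
have := ae_forall_ord (fun j => absolutely_continuous_derive1 s0 (acu j)).
apply: ae_imply => r Hr rs d Hdr.
have rs' : 0 <= r <= s by case/andP: rs => /ltW -> /ltW ->.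
have D := is_derive_log_energy (uinj r rs') (fun j => Hr j rs).
have <- := @derive_val _ _ _ _ _ _ _ Hdr.
rewrite [leLHS](@derive_val _ _ _ _ _ _ _ D); exact: log_energy_growth (uinj r rs').
Qed.

End gap_estimate.

(** * The topology of the path space *)

Section path_space_topology.
Context {R : realType} (T : R) (n : nat).
Implicit Types (f g : path_space (R:=R) T n).

Definition path_time (t : R) (tT : 0 <= t <= T) : `[0, T]%classic :=
  exist _ t (mem_set tT).

Lemma path_coord_val f j (y : `[0, T]%classic) :
  path_coord f j (\val y) = \val (eval_path f y) 0 j.
Proof. by rewrite /path_coord /= oinv_set_val valK. Qed.

Lemma path_time_itv (y : `[0, T]%classic) : 0 <= \val y <= T.
Proof. by case: y => t tT /=; have := set_mem tT; rewrite /= in_itv. Qed.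

Lemma path_coordE f j t (tT : 0 <= t <= T) :
  path_coord f j t = \val (eval_path f (path_time tT)) 0 j.
Proof. by rewrite -(path_coord_val f j (path_time tT)). Qed.

Lemma path_coord_lt f t (i j : 'I_n) : 0 <= t <= T -> (i < j)%N ->
  path_coord f i t < path_coord f j t.
Proof.
move=> tT ij; rewrite !(path_coordE _ _ tT).
by have := set_valP (eval_path f (path_time tT)); exact.
Qed.

Lemma path_coord_neq f t : 0 <= t <= T ->
  forall i j, i != j -> path_coord f i t != path_coord f j t.
Proof.
move=> tT i j; rewrite neq_ltn => /orP[ij|ji]; first by rewrite lt_eqF// path_coord_lt.
by rewrite gt_eqF// path_coord_lt.
Qed.

Definition path_near f (e : R) g := forall t, 0 <= t <= T -> forall j,
  `|path_coord g j t - path_coord f j t| < e.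

Lemma path_nearP f e g : 0 < e -> path_near f e g <->
  forall y : `[0, T]%classic, ball (\val (eval_path f y)) e (\val (eval_path g y)).
Proof.
move=> e0; split=> [fg y|fg t tT j].
  split=> // i j; rewrite (ord1 i) /ball/= distrC -!path_coord_val; apply: fg; exact: path_time_itv.
have [_ /(_ 0 j)] := fg (path_time tT).
by rewrite /ball/= distrC -!path_coord_val.
Qed.

(** Reduces the topology of the path space to [path_near], in which the later neighbourhood
    arguments are phrased. *)
Lemma nbhs_path f (V : set (path_space (R:=R) T n)) :
  nbhs f V <-> exists2 e : R, 0 < e & forall g, path_near f e g -> V g.
Proof.
split.
  move=> [_ [[B oB <-] fB BV]].
  have /uniform_nbhs[E [[W entW WE] EB]] : nbhs (f : {uniform `[0, T]%classic -> @chamber R n}) B.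
    exact: open_nbhs_nbhs.
  move: entW; rewrite -entourage_ballE => -[e /= e0 eW].
  exists e => // g /(path_nearP _ _ e0) fg; apply: BV => /=; apply: EB => y _; apply: WE; apply: eW.
  exact: fg.
move=> [e e0 eV].
have : nbhs (f : {uniform `[0, T]%classic -> @chamber R n}) 
   [set g : {uniform `[0, T]%classic -> @chamber R n} | forall y, ball (\val (f y)) e (\val (g y))].
  apply/uniform_nbhs.
  exists [set xy : @chamber R n * @chamber R n | ball (\val xy.1) e (\val xy.2)]; split.
    exists [set xy | ball xy.1 e xy.2]. 
      by rewrite -entourage_ballE; exists e.
    by move=> x.
  move=> g Hg y. exact: Hg.
rewrite nbhsE => -[B [oB Bf] Be].
rewrite nbhsE; exists (((fun f => f : `[0, T]%classic -> chamber n)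
     : continuousType `[0, T]%classic (@chamber R n) ->
       {uniform `[0, T]%classic -> chamber n}) @^-1` B); first by split => //; exists B.
by move=> g /Be gb; apply: eV; apply/(path_nearP _ _ e0).
Qed.

Lemma path_coord_continuous f : 0 <= T -> forall j, continuous (path_coord f j \o clamp 0 T).
Proof.
move=> T0 j.
have cp (t : R) : 0 <= clamp 0 T t <= T by exact: clamp_itv.
have -> : path_coord f j \o clamp 0 T =
    (fun M : 'rV[R]_n => M 0 j) \o set_val \o eval_path f \o (fun t => path_time (cp t)).
  by apply/funext => t /=; rewrite (path_coordE _ _ (cp t)).
have cpt : continuous (fun t => path_time (cp t)).
  apply/continuousP => A [B oB <-].
  have -> : (fun t => path_time (cp t)) @^-1` (set_val @^-1` B) = clamp 0 T @^-1` B by [].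
  apply: open_comp => // s _.
  apply/cvgrPdist_le => e e0; near=> r; apply: le_trans (clamp_dist _ _ _ _) _.
  near: r; exact: cvgr_dist_le.
move=> t; apply: continuous_comp; first exact: cpt.
apply: continuous_comp.
  have [[cf]] := Continuous.class f.
  by have := cf; apply.
apply: continuous_comp; first exact: initial_continuous.
exact: coord_continuous.
Unshelve. all: by end_near. Qed.

Lemma path_of_coord (u : 'I_n -> R -> R) : 0 <= T -> (forall j, continuous (u j)) ->
  (forall t, 0 <= t <= T -> forall i j : 'I_n, (i < j)%N -> u i t < u j t) ->
  exists f : path_space (R:=R) T n, forall t, 0 <= t <= T -> forall j, path_coord f j t = u j t.
Proof.
move=> T0 cu ou.
pose v (t : R) : 'rV[R]_n := \row_j u j t.
have vch (y : `[0, T]%classic) : v (\val y) \in chamber n.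
  by apply/mem_set => i j ij; rewrite !mxE; apply: ou => //; exact: path_time_itv.
pose F (y : `[0, T]%classic) : @chamber R n := exist _ (v (\val y)) (vch y).
have cF : continuous F.
  apply/continuousP => A [B oB <-].
  have -> : F @^-1` (set_val @^-1` B) = set_val @^-1` (v @^-1` B) by [].
  apply: open_comp; first by move=> ? _; exact: initial_continuous.
  apply: open_comp => // t _; apply/cvg_ballP => e e0.
  have : \forall s \near t, forall j, ball (u j t) e (u j s).
    have H j : \forall s \near t, ball (u j t) e (u j s) by exact: cvg_ball (cu j t) e e0.
    exact: (@filter_forall _ _ _ (nbhs t) (nbhs_filter t) H).
  by apply: filterS => s us; split => // i j; rewrite !mxE.
pose f : continuousType `[0, T]%classic (@chamber R n) := HB.pack F (isContinuous.Build _ _ F cF).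
exists f => t tT j; rewrite (path_coordE _ _ tT)/=.
by rewrite mxE.
Qed.

End path_space_topology.

(** * Integrals of continuous functions *)

Section continuous_integrals.
Context {R : realType}.
Notation mu := (@lebesgue_measure R).
Implicit Types (h : R -> R).

Lemma continuous_integrable h (a b : R) : continuous h -> mu.-integrable `[a, b] (EFin \o h).
Proof.
move=> ch; apply: continuous_compact_integrable; first exact: segment_compact.
exact: continuous_subspaceT.
Qed.

Lemma Rintegral_diff h (s t : R) : continuous h -> 0 <= s -> s <= t ->
  \int[mu]_(r in `[0, t]) h r - \int[mu]_(r in `[0, s]) h r = \int[mu]_(r in `[s, t]) h r.
Proof.
move=> ch s0 st.
rewrite (@Rintegral_itvB _ _ (BLeft 0) (BRight t)) ?bnd_simp//.
  rewrite Rintegral_itv_obnd_cbnd//.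
  apply: integrableS (continuous_integrable s t ch) => //.
  by move=> r /=; rewrite !in_itv/= => /andP[/ltW -> ->].
exact: continuous_integrable.
Qed.

Lemma Rintegral_le_itv h k (s t : R) : s <= t -> continuous h -> continuous k ->
  (forall r, s <= r <= t -> h r <= k r) ->
  \int[mu]_(r in `[s, t]) h r <= \int[mu]_(r in `[s, t]) k r.
Proof.
by move=> st ch ck hk; apply: le_Rintegral => //; exact: continuous_integrable.
Qed.

Lemma normr_Rintegral_le (h k : R -> R) (s t : R) : s <= t -> continuous h -> continuous k ->
  (forall r, s <= r <= t -> `|h r| <= k r) ->
  `|\int[mu]_(r in `[s, t]) h r| <= \int[mu]_(r in `[s, t]) k r.
Proof.
move=> st ch ck hk; apply: (le_trans (le_normr_Rintegral _ _)) => //.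
  exact: continuous_integrable.
apply: Rintegral_le_itv => //.
by move=> r; apply: continuous_comp; [exact: ch|exact: norm_continuous].
Qed.

Lemma normr_Rintegral_itv h (M s t : R) : s <= t -> continuous h ->
  (forall r, s <= r <= t -> `|h r| <= M) ->
  `|\int[mu]_(r in `[s, t]) h r| <= M * (t - s).
Proof.
move=> st ch hM; rewrite -(Rintegral_cst_itv M st); apply: normr_Rintegral_le => //.
exact: cst_continuous.
Qed.

Lemma continuous_bounded_itv h (s t : R) : s <= t -> continuous h ->
  exists2 M, 0 <= M & forall r, s <= r <= t -> `|h r| <= M.
Proof.
move=> st ch.
have cnh : continuous (fun r => `|h r|).
  by move=> r; apply: continuous_comp; [exact: ch|exact: norm_continuous].
have [c _ Hc] := EVT_max st (continuous_subspaceT cnh).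
by exists `|h c| => // r rst; apply: Hc; rewrite in_itv.
Qed.

Lemma is_derive_Rintegral h (a t : R) : continuous h -> a < t ->
  is_derive t 1 (fun r => \int[mu]_(s in `[a, r]) h s) (h t).
Proof.
move=> ch at_.
have [] := @continuous_FTC1 R h (BLeft a) t (t + 1) _ _ _ (ch t).
- by rewrite ltrDl.
- exact: continuous_integrable.
- by rewrite /= lte_fin.
by move=> dF <-; rewrite derive1E; exact: DeriveDef.
Qed.

End continuous_integrals.

(** * The noise of a path *)

Section noise.
Context {R : realType} (n : nat) (s : R).
Notation mu := (@lebesgue_measure R).
Variable u : 'I_n -> R -> R.
Hypotheses (s0 : 0 < s) (cu : forall j, continuous (u j \o clamp 0 s))
  (uinj : forall t, 0 <= t <= s -> forall k l, k != l -> u k t != u l t).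

Definition noise (j : 'I_n) (t : R) : R :=
  u j t - \int[mu]_(r in `[0, t]) repulsion (u^~ r) j.

(** Off [[0, s]] the particles of [u] may meet. Freezing time there gives a drift that is continuous
    on the whole line and has the same integrals within [[0, s]]. *)
Definition clamped_repulsion j r : R := repulsion (fun i => u i (clamp 0 s r)) j.

Lemma continuous_clamped_repulsion j : continuous (clamped_repulsion j).
Proof.
apply: continuous_big => [|i ij t]; first exact: add_continuous.
apply: cvgM; first exact: cvg_cst.
apply: cvgV; last by apply: cvgB; exact: cu.
by rewrite /= subr_eq0 uinj ?clamp_itv ?(ltW s0)// eq_sym.
Qed.

Lemma clamped_repulsionE j r : 0 <= r <= s -> clamped_repulsion j r = repulsion (u^~ r) j.
Proof. by move=> rs; rewrite /clamped_repulsion clamp_id. Qed.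

Lemma Rintegral_clamped_repulsion j t : t <= s ->
  \int[mu]_(r in `[0, t]) clamped_repulsion j r = \int[mu]_(r in `[0, t]) repulsion (u^~ r) j.
Proof.
move=> ts; apply: eq_Rintegral => r; rewrite inE/= in_itv/= => /andP[r0 rt].
by rewrite clamped_repulsionE// r0 (le_trans rt).
Qed.

Lemma absolutely_continuous_repulsion j :
  absolutely_continuous_on 0 s (fun t => \int[mu]_(r in `[0, t]) repulsion (u^~ r) j).
Proof.
have cb := @continuous_clamped_repulsion j.
have [M M0 HM] := continuous_bounded_itv (ltW s0) cb.
apply: (@absolutely_continuous_lip _ _ _ 1 _ (fun _ t => t) M).
  move=> _ e e0; exists e => // m p q pq _ /(le_lt_trans _); apply.
  by apply: ler_sum => i _; have [_ /ltW pqi _] := pq i; rewrite ger0_norm ?subr_ge0.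
have K p q : 0 <= p -> p <= q -> q <= s ->
    `|\int[mu]_(r in `[0, q]) repulsion (u^~ r) j - \int[mu]_(r in `[0, p]) repulsion (u^~ r) j| <=
    M * (q - p).
  move=> p0 pq qs; rewrite -!Rintegral_clamped_repulsion//; last exact: le_trans qs.
  rewrite Rintegral_diff//; apply: normr_Rintegral_itv => // r /andP[pr rq].
  by apply: HM; rewrite (le_trans p0 pr) (le_trans rq qs).
move=> p q /andP[p0 ps] /andP[q0 qs]; rewrite big_ord1.
have [pq|/ltW qp] := leP p q; first by rewrite (@ger0_norm _ (q - p)) ?subr_ge0//; exact: K.
by rewrite distrC (distrC q) (@ger0_norm _ (p - q)) ?subr_ge0//; exact: K.
Qed.

Lemma is_derive_int_repulsion j t : 0 < t < s ->
  is_derive t 1 (fun t => \int[mu]_(r in `[0, t]) repulsion (u^~ r) j) (repulsion (u^~ t) j).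
Proof.
move=> ts; have /andP[t0 ts'] := ts.
have := is_derive_Rintegral (@continuous_clamped_repulsion j) t0.
rewrite clamped_repulsionE ?(ltW t0) ?(ltW ts')//.
apply: near_eq_is_derive.
have : t \in `]0, s[ by rewrite in_itv.
move=> /near_in_itvoo; apply: filterS => r; rewrite in_itv/= => /andP[r0 /ltW rs].
by rewrite Rintegral_clamped_repulsion.
Qed.

Lemma noise_absolutely_continuous j :
  absolutely_continuous_on 0 s (u j) <-> absolutely_continuous_on 0 s (noise j).
Proof.
split=> h; first exact: absolutely_continuousB h (absolutely_continuous_repulsion j).
have := absolutely_continuousD h (absolutely_continuous_repulsion j).
by congr absolutely_continuous_on; apply/funext => t; rewrite /noise/= subrK.
Qed.

Lemma energy_noiseE : (forall j, absolutely_continuous_on 0 s (u j)) ->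
  (\int[mu]_(t in `[0%R, s]) (\sum_(j < n) (derive1 (noise j) t) ^+ 2)%:E =
  \int[mu]_(t in `[0%R, s]) (\sum_(j < n) (derive1 (u j) t - repulsion (u^~ t) j) ^+ 2)%:E)%E.
Proof.
move=> acu; apply: ge0_integral_ae_eq => //.
- by move=> t _; rewrite lee_fin sumr_ge0// => j _; exact: sqr_ge0.
- by move=> t _; rewrite lee_fin sumr_ge0// => j _; exact: sqr_ge0.
have := ae_and (ae_itvoo 0 s)
  (ae_forall_ord (fun j => absolutely_continuous_derive1 s0 (acu j))).
apply: ae_imply => t [oo Ht]; rewrite /= in_itv/= => /oo tab.
congr EFin; apply: eq_bigr => j _; congr (_ ^+ 2).
have D := is_deriveB (Ht j tab) (is_derive_int_repulsion j tab).
by rewrite [in LHS]derive1E [LHS](@derive_val _ _ _ _ _ _ _ D).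
Qed.

(** The bridge between the rate written with derivatives and discrete energies; a finite energy
    brings absolute continuity with it. *)
Lemma energy_noise_le K : energy_le 0 s noise K <->
  (forall j, absolutely_continuous_on 0 s (u j)) /\
  (\int[mu]_(t in `[0%R, s]) (\sum_(j < n) (derive1 (u j) t - repulsion (u^~ t) j) ^+ 2)%:E <= K%:E)%E.
Proof.
split.
  move=> H; have acu j : absolutely_continuous_on 0 s (u j).
    by apply/noise_absolutely_continuous; exact: absolutely_continuous_of_energy H.
  by split => //; rewrite -energy_noiseE//; exact: derive_of_energy_le.
move=> [acu H]; apply: energy_le_of_derive => //.
  by move=> j; apply/noise_absolutely_continuous.
by rewrite energy_noiseE.
Qed.

End noise.

Section rate.
Context {R : realType} (T : R) (n : nat) (x : 'rV[R]_n).
Hypothesis T0 : 0 < T.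
Implicit Types f : path_space T n.

Lemma dyson_rate_ge0 f : (0 <= dyson_rate x f)%E.
Proof.
rewrite /dyson_rate; case: ifP => // _.
rewrite mule_ge0 ?lee_fin ?invr_ge0// integral_ge0// => t _.
by rewrite lee_fin sumr_ge0// => j _; exact: sqr_ge0.
Qed.

Lemma dyson_rate_leP f M : (dyson_rate x f <= M%:E)%E <->
  (forall j, path_coord f j 0 = x 0 j) /\ energy_le 0 T (noise (path_coord f)) (2 * M).
Proof.
have E := energy_noise_le T0 (@path_coord_continuous _ _ _ f (ltW T0)) (@path_coord_neq _ _ _ f) (2 * M).
rewrite /dyson_rate; case: asboolP => [[acf fx]|Nf]; last first.
  split=> [|[fx /E[acf _]]]; first by rewrite leNgt ltry.
  by exfalso; apply: Nf.
have H : ((2^-1)%:E * \int[lebesgue_measure]_(t in `[0%R, T])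
         (\sum_(j < n) (derive1 (path_coord f j) t - drift f j t) ^+ 2)%:E <= M%:E)%E <->
  (\int[lebesgue_measure]_(t in `[0%R, T])
         (\sum_(j < n) (derive1 (path_coord f j) t - drift f j t) ^+ 2)%:E <= (2 * M)%:E)%E.
  set I := (X in ((2^-1)%:E * X)%E).
  have -> : M%:E = ((2^-1)%:E * (2 * M)%:E)%E by rewrite -EFinM mulKf.
  by rewrite lee_pmul2l// lte_fin invr_gt0.
split=> [/H ?|[_ /E[_ ?]]]; last exact/H.
by split => //; apply/E.
Qed.

Lemma rate_gap M : chamber n x -> exists2 g : R, 0 < g & forall f, (dyson_rate x f <= M%:E)%E ->
  forall t, 0 <= t <= T -> forall k l, k != l -> g <= `|path_coord f k t - path_coord f l t|.
Proof.
move=> xch.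
have [k l|g g0 Hg] := @gap_bound R n (x 0) T (2 * M).
  rewrite neq_ltn => /orP[kl|lk]; first by rewrite lt_eqF// xch.
  by rewrite gt_eqF// xch.
exists g => // f /dyson_rate_leP[fx] /(energy_noise_le T0 (@path_coord_continuous _ _ _ f (ltW T0))
  (@path_coord_neq _ _ _ f))[acf EK].
exact: (Hg T (path_coord f) T0 (lexx T) acf (@path_coord_neq _ _ _ f) fx EK).
Qed.

End rate.

(** * Lipschitz dependence of the drift on the path *)

Section perturbation.
Context {R : realType} (n : nat).
Notation mu := (@lebesgue_measure R).

Definition gapped (g : R) (y : 'I_n -> R) := forall k l, k != l -> g <= `|y k - y l|.

Lemma gapped_neq (g : R) y : 0 < g -> gapped g y -> forall k l, k != l -> y k != y l.
Proof.
by move=> g0 gy k l kl; rewrite -subr_eq0 -normr_gt0; exact: lt_le_trans (gy k l kl).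
Qed.

Lemma gapped_near (g e : R) (y z : 'I_n -> R) : gapped g y -> (forall k, `|z k - y k| <= e) ->
  gapped (g - 2 * e) z.
Proof.
move=> gy yz k l kl; have := gy k l kl; have := yz k; have := yz l.
have := ler_normB (y k - z k) (y l - z l).
have := ler_normD (z k - z l) (y k - z k - (y l - z l)).
rewrite (_ : z k - z l + _ = y k - y l); last by ring.
rewrite (distrC (y k) (z k)) (distrC (y l) (z l)); lra.
Qed.

(** A summand of the repulsion changes by [4 * ((y j - z j) - (y i - z i))] over a product of two
    gaps, hence by at most [8 / g ^+ 2 * e]; there are at most [n] summands. *)
Definition repulsion_lip (g : R) : R := n%:R * (8 / g ^+ 2).

Lemma repulsion_lip_ge0 g : 0 <= repulsion_lip g.
Proof. by rewrite mulr_ge0// divr_ge0// sqr_ge0. Qed.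

Lemma repulsion_dist (g e : R) (y z : 'I_n -> R) j : 0 < g -> gapped g y -> gapped g z ->
  (forall k, `|z k - y k| <= e) ->
  `|repulsion z j - repulsion y j| <= repulsion_lip g * e.
Proof.
move=> g0 gy gz yz.
have e0 : 0 <= e by apply: le_trans (yz j).
rewrite /repulsion -sumrB; apply: (le_trans (ler_norm_sum _ _ _)).
apply: (@le_trans _ _ (\sum_(i < n | i != j) (8 / g ^+ 2 * e))); last first.
  apply: (@le_trans _ _ (\sum_(i < n) (8 / g ^+ 2 * e))).
    rewrite big_mkcond/=; apply: ler_sum => i _; case: ifP => // _.
    by rewrite mulr_ge0// divr_ge0// sqr_ge0.
  by rewrite sumr_const card_ord -[X in X <= _]mulr_natl mulrA.
apply: ler_sum => i ij.
have yij := gapped_neq g0 gy ij; have zij := gapped_neq g0 gz ij.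
have y0 : y j - y i != 0 by rewrite subr_eq0 eq_sym.
have z0 : z j - z i != 0 by rewrite subr_eq0 eq_sym.
have -> : 4 / (z j - z i) - 4 / (y j - y i) =
    4 * ((y j - z j) - (y i - z i)) / ((z j - z i) * (y j - y i)).
  by field; rewrite y0 z0.
rewrite normrM normfV ler_pdivrMr; last by rewrite normr_gt0 mulf_neq0.
have h1 : `|4 * ((y j - z j) - (y i - z i))| <= 8 * e.
  rewrite normrM ger0_norm//; have := ler_normB (y j - z j) (y i - z i).
  have := yz i; have := yz j; rewrite (distrC (y j)) (distrC (y i)); lra.
apply: (le_trans h1).
have h2 : g ^+ 2 <= `|(z j - z i) * (y j - y i)|.
  by rewrite normrM expr2 ler_pM ?(ltW g0)//; [apply: gz|apply: gy]; rewrite eq_sym.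
have -> : 8 * e = 8 / g ^+ 2 * e * g ^+ 2 by field; rewrite gt_eqF.
by rewrite ler_wpM2l// mulr_ge0// divr_ge0// sqr_ge0.
Qed.

Lemma int_repulsion_dist (s g e : R) (u v : 'I_n -> R -> R) : 0 < s -> 0 < g ->
  (forall j, continuous (u j \o clamp 0 s)) -> (forall j, continuous (v j \o clamp 0 s)) ->
  (forall t, 0 <= t <= s -> gapped g (u^~ t)) ->
  (forall t, 0 <= t <= s -> gapped g (v^~ t)) ->
  (forall t, 0 <= t <= s -> forall k, `|v k t - u k t| <= e) ->
  forall j p q, 0 <= p -> p <= q -> q <= s ->
  `|\int[mu]_(r in `[p, q]) clamped_repulsion s v j r -
    \int[mu]_(r in `[p, q]) clamped_repulsion s u j r| <= repulsion_lip g * e * (q - p).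
Proof.
move=> s0 g0 cu cv gu gv uv j p q p0 pq qs.
have ui t (ts : 0 <= t <= s) := gapped_neq g0 (gu t ts).
have vi t (ts : 0 <= t <= s) := gapped_neq g0 (gv t ts).
have cru := @continuous_clamped_repulsion R n s u s0 cu ui j.
have crv := @continuous_clamped_repulsion R n s v s0 cv vi j.
rewrite -RintegralB//; [|exact: continuous_integrable..].
apply: normr_Rintegral_itv => //.
  by move=> r; apply: cvgB; [exact: crv|exact: cru].
move=> r _; have rs := clamp_itv r (ltW s0).
by apply: repulsion_dist => //; [exact: gu|exact: gv|exact: uv].
Qed.

End perturbation.

Section path_perturbation.
Context {R : realType} (T : R) (n : nat).
Hypothesis T0 : 0 < T.
Implicit Types f h : path_space (R:=R) T n.

(** Continuity on a compact interval gives each single path a gap, in contrast to the bound of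
    [rate_gap], which is uniform over a sublevel set. *)
Lemma path_gapped f : exists2 g : R, 0 < g & forall t, 0 <= t <= T -> gapped g ((path_coord f)^~ t).
Proof.
have /choice[G HG] (kl : 'I_n * 'I_n) : exists g : R, 0 < g /\ forall t, 0 <= t <= T -> kl.1 != kl.2 ->
    g <= `|path_coord f kl.1 t - path_coord f kl.2 t|.
  have [kl12|kl12] := eqVneq kl.1 kl.2; first by exists 1.
  have cf := @path_coord_continuous _ _ _ f (ltW T0).
  have cd : continuous (fun t => `|(path_coord f kl.1 \o clamp 0 T) t - (path_coord f kl.2 \o clamp 0 T) t|).
    move=> t; apply: cvg_norm; apply: cvgB; exact: cf.
  have [c _ Hc] := EVT_min (ltW T0) (continuous_subspaceT cd).
  exists `|(path_coord f kl.1 \o clamp 0 T) c - (path_coord f kl.2 \o clamp 0 T) c|; split.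
    by rewrite normr_gt0 subr_eq0 /= path_coord_neq// clamp_itv// ltW.
  by move=> t tT _; have := Hc t; rewrite /= (clamp_id tT) in_itv/=; exact.
exists (\big[Num.min/1]_kl G kl).
  by elim/big_ind: _ => // [y z y0 z0|kl _]; [rewrite lt_min y0|exact: (HG kl).1].
move=> t tT k l kl; apply: le_trans ((HG (k, l)).2 t tT kl).
exact: bigmin_le_cond.
Qed.

Lemma noise_dist f (g e : R) h : 0 < g -> (forall t, 0 <= t <= T -> gapped g ((path_coord f)^~ t)) ->
  path_near f e h -> e <= g / 4 -> forall j t, 0 <= t <= T ->
  `|noise (path_coord h) j t - noise (path_coord f) j t| <= e + repulsion_lip n (g / 2) * e * T.
Proof.
move=> g0 gf fh eg j t /andP[t0 tT].
have g20 : 0 < g / 2 by rewrite divr_gt0.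
have gapW (c c' : R) y : c <= c' -> gapped c' y -> @gapped R n c y.
  by move=> cc' cy k l kl; apply: le_trans cc' (cy k l kl).
have H := @int_repulsion_dist R n T (g / 2) e (path_coord f) (path_coord h) T0 g20
  (@path_coord_continuous _ _ _ f (ltW T0)) (@path_coord_continuous _ _ _ h (ltW T0)).
have := H _ _ _ j 0 t (lexx _) t0 tT.
rewrite !Rintegral_clamped_repulsion// subr0 => K.
have e0 : 0 <= e.
  apply/ltW; apply: le_lt_trans (fh 0 _ j); first exact: normr_ge0.
  by rewrite lexx ltW.
have {K} : `|\int[lebesgue_measure]_(r in `[0, t]) repulsion ((path_coord h)^~ r) j -
        \int[lebesgue_measure]_(r in `[0, t]) repulsion ((path_coord f)^~ r) j| <=
      repulsion_lip n (g / 2) * e * T.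
  apply: le_trans (K _ _ _) _.
  - by move=> r rT; apply: gapW (gf r rT); lra.
  (* A deviation [e <= g / 4] leaves [h] a gap of [g - 2 * e >= g / 2]. *)
  - move=> r rT; have := gapped_near (gf r rT) (fun k => ltW (fh r rT k)).
    by apply: gapW; lra.
  - by move=> r rT k; exact: ltW (fh r rT k).
  - by apply: ler_wpM2l => //; rewrite mulr_ge0// repulsion_lip_ge0.
have := fh t _ j; rewrite t0 tT => /(_ isT).
set A := path_coord h j t; set B := path_coord f j t.
rewrite /noise -/A -/B.
set C := Rintegral _ _ _; set D := Rintegral _ _ _.
rewrite (_ : A - C - (B - D) = (A - B) - (C - D)); last by ring.
by move=> h1 h2; apply: le_trans (ler_normB _ _) _; rewrite lerD// ltW.
Qed.

Lemma noise_cvg f j t : 0 <= t <= T ->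
  noise (path_coord h) j t @[h --> f] --> noise (path_coord f) j t.
Proof.
move=> tT; have [g g0 gf] := path_gapped f.
have FF : Filter (nbhs f) := nbhs_filter f.
apply/cvgrPdist_le => e e0.
pose L := 1 + repulsion_lip n (g / 2) * T.
have L0 : 0 < L by rewrite ltr_pwDl// mulr_ge0 ?repulsion_lip_ge0// ltW.
have : nbhs f [set h | path_near f (Num.min (g / 4) (e / L)) h].
  by apply/nbhs_path; exists (Num.min (g / 4) (e / L)) => //; rewrite lt_min !divr_gt0.
apply: filterS => h fh; rewrite distrC.
have mg : Num.min (g / 4) (e / L) <= g / 4 by rewrite ge_min lexx.
have me : Num.min (g / 4) (e / L) <= e / L by rewrite ge_min lexx orbT.
apply: le_trans (noise_dist g0 gf fh mg j tT) _.
move: me; rewrite ler_pdivlMr// /L; set m := Num.min _ _; set K := repulsion_lip _ _.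
by move=> ?; rewrite (_ : m + _ = m * (1 + K * T))//; ring.
Qed.

End path_perturbation.

(** * Goodness of the rate function *)

Section good_rate.
Context {R : realType} (T : R) (n : nat) (x : 'rV[R]_n).
Hypothesis T0 : 0 < T.
Implicit Types f h : path_space T n.

(** A rate above [a] is witnessed by a wrong starting point or by one finite family of intervals
    with energy above [2 * a]; either witness persists on a neighbourhood. *)
Lemma dyson_rate_lsc : lower_semicontinuous (dyson_rate x : path_space T n -> \bar R).
Proof.
move=> f a; rewrite ltNge => /negP /(dyson_rate_leP _ T0) nle.
suff [V fV HV] : exists2 V, nbhs f V & forall h, V h -> ~
  ((forall j, path_coord h j 0 = x 0 j) /\ energy_le 0 T (noise (path_coord h)) (2 * a)).
  by exists V => // h /HV nh; rewrite ltNge; apply/negP => /(dyson_rate_leP _ T0).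
have [fx|] := pselect (forall j, path_coord f j 0 = x 0 j); last first.
  move=> /existsNP[j fj].
  have : path_coord f j 0 - x 0 j != 0 by rewrite subr_eq0; apply/eqP.
  rewrite -normr_gt0 => d0.
  exists [set h | path_near f `|path_coord f j 0 - x 0 j| h].
    by apply/nbhs_path; exists `|path_coord f j 0 - x 0 j|.
  move=> h fh [hx _]; have := fh 0 _ j; rewrite lexx (ltW T0) => /(_ isT).
  by rewrite hx distrC ltxx.
have : ~ energy_le 0 T (noise (path_coord f)) (2 * a) by move=> ?; apply: nle.
move=> /existsNP[m /existsNP[u /existsNP[v /not_implyP[uv /not_implyP[tuv]]]]].
move/negP; rewrite -ltNge => aE.
pose E h := \sum_(i < m) \sum_(j < n)
  (noise (path_coord h) j (v i) - noise (path_coord h) j (u i)) ^+ 2 / (v i - u i).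
have FF : Filter (nbhs f) := nbhs_filter f.
have cE : E h @[h --> f] --> E f.
  apply: cvg_big => [|i _]; first exact: add_continuous.
  apply: cvg_big => [|j _]; first exact: add_continuous.
  have [u0 uvi vT] := uv i.
  have c1 := @noise_cvg R T n T0 f j (v i); have c2 := @noise_cvg R T n T0 f j (u i).
  have c : (noise (path_coord h) j (v i) - noise (path_coord h) j (u i)) @[h --> f] -->
     noise (path_coord f) j (v i) - noise (path_coord f) j (u i).
    apply: cvgB; [apply: c1|apply: c2].
      by rewrite vT (le_trans u0 (ltW uvi)).
    by rewrite u0 (le_trans (ltW uvi) vT).
  by apply: cvgM; [under eq_fun do rewrite expr2; rewrite expr2; exact: cvgM|exact: cvg_cst].
exists [set h | 2 * a < E h]; first exact: (cvgr_gt _ cE).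
by move=> h /= ah [_ /(_ m u v uv tuv)]; rewrite leNgt ah.
Qed.

End good_rate.

Section compact_levels.
Context {R : realType} (T : R) (n : nat) (x : 'rV[R]_n).
Hypotheses (T0 : 0 < T) (xch : chamber n x).
Implicit Types f h : path_space (R:=R) T n.

Lemma rate_noise_increment f M j s t : (dyson_rate x f <= M%:E)%E ->
  0 <= s -> s < t -> t <= T ->
  (noise (path_coord f) j t - noise (path_coord f) j s) ^+ 2 <= 2 * M * (t - s).
Proof.
move=> /(dyson_rate_leP _ T0)[_ EM] s0 st tT.
have := EM 1%N (fun=> s) (fun=> t); rewrite big_ord1.
move=> /(_ _ _)/wrap[]//.
  by move=> i k _ _ _; rewrite (ord1 i) (ord1 k).
rewrite (bigD1 j)//= => H.
rewrite -ler_pdivrMr ?subr_gt0//; apply: le_trans H.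
rewrite lerDl sumr_ge0// => k _; rewrite divr_ge0 ?sqr_ge0// subr_ge0; exact: ltW.
Qed.

Lemma repulsion_bound (g : R) (y : 'I_n -> R) j : 0 < g -> gapped g y ->
  `|repulsion y j| <= n%:R * (4 / g).
Proof.
move=> g0 gy; apply: (le_trans (ler_norm_sum _ _ _)).
apply: (@le_trans _ _ (\sum_(i < n) (4 / g))); last first.
  by rewrite sumr_const card_ord -[X in X <= _]mulr_natl.
rewrite big_mkcond/=; apply: ler_sum => i _; case: ifP => [ij|_]; last by rewrite divr_ge0// ltW.
rewrite normrM normfV ger0_norm// ler_pM2l// lef_pV2 ?posrE//; last first.
  by apply: lt_le_trans g0 _; apply: gy; rewrite eq_sym.
by apply: gy; rewrite eq_sym.
Qed.

(** The noise is Hoelder of exponent [1 / 2]. The free parameter [c] linearizes the square root by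
    AM-GM, and the gap bounds the drift. *)
Lemma rate_increment f M (g c : R) j s t : (dyson_rate x f <= M%:E)%E ->
  0 < g -> (forall r, 0 <= r <= T -> gapped g ((path_coord f)^~ r)) -> 0 < c ->
  0 <= s -> s <= t -> t <= T ->
  `|path_coord f j t - path_coord f j s| <= c + (M / c + n%:R * (4 / g)) * (t - s).
Proof.
move=> fM g0 gf c0 s0; rewrite le_eqVlt => /orP[/eqP-> _|st tT].
  by rewrite !subrr normr0 mulr0 addr0 ltW.
have cr := @continuous_clamped_repulsion R n T _ T0 (@path_coord_continuous _ _ _ f (ltW T0))
  (@path_coord_neq _ _ _ f) j.
have := rate_noise_increment j fM s0 st tT.
set A := noise _ _ _ - _ => H1.
have -> : path_coord f j t - path_coord f j s =
    A + (\int[lebesgue_measure]_(r in `[s, t]) clamped_repulsion T (path_coord f) j r).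
  rewrite -Rintegral_diff ?(ltW st)// !Rintegral_clamped_repulsion//; last exact: le_trans (ltW st) tT.
  by rewrite /A /noise; ring.
rewrite mulrDl addrA; apply: (le_trans (ler_normD _ _)); apply: lerD.
  rewrite -(ler_pM2r c0) mulrDl mulrAC divfK ?gt_eqF//.
  rewrite -[A ^+ 2]real_normK ?num_real// in H1.
  by have := sqr_ge0 (`|A| - c); have := sqr_ge0 c; nra.
apply: normr_Rintegral_itv => //; first exact: ltW.
by move=> r _; exact: repulsion_bound _ g0 (gf _ (clamp_itv r (ltW T0))).
Qed.

Lemma rate_equicontinuous M e : 0 < e -> exists2 delta : R, 0 < delta &
  forall f, (dyson_rate x f <= M%:E)%E -> forall s t, 0 <= s <= T -> 0 <= t <= T ->
  `|t - s| < delta -> forall j, `|path_coord f j t - path_coord f j s| <= e.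
Proof.
move=> e0; have [g g0 Hg] := rate_gap T0 M xch.
have e20 : 0 < e / 2 by rewrite divr_gt0.
pose C : R := `|M| / (e / 2) + n%:R * (4 / g) + 1.
have C0 : 0 < C.
  by rewrite ltr_wpDl// addr_ge0//; [rewrite divr_ge0// ltW|rewrite mulr_ge0// divr_ge0// ltW].
exists (e / 2 / C); first by rewrite divr_gt0.
move=> f fM s t sT tT + j; wlog st : s t sT tT / s <= t.
  move=> H ts; have /orP[st|ts'] := le_total s t; first exact: H.
  by rewrite distrC; apply: H => //; rewrite distrC.
have /andP[s0 _] := sT; have /andP[_ tT'] := tT.
rewrite ger0_norm ?subr_ge0// ltr_pdivlMr// => std.
apply: le_trans (rate_increment j fM g0 (Hg f fM) e20 s0 st tT') _.
have : (M / (e / 2) + n%:R * (4 / g)) * (t - s) <= C * (t - s).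
  rewrite ler_wpM2r ?subr_ge0// /C -addrA lerD//; last by rewrite lerDl.
  by rewrite ler_wpM2r ?ler_norm// invr_ge0 ltW.
by move: std; rewrite (mulrC _ C); lra.
Qed.

Lemma fmap_ultra (U V : Type) (f : U -> V) (F : set_system U) :
  UltraFilter F -> UltraFilter (fmap f F).
Proof.
move=> UF; have PF : ProperFilter F by exact: (@ultra_proper _ F UF).
apply: Build_UltraFilter => G PG FG; apply/seteqP; split => [|A]; last exact: FG.
move=> A GA; have [//|FA] := in_ultra_setVsetC (f @^-1` A) UF.
have : G (~` A) by apply: FG; rewrite /fmap/= preimage_setC.
move=> GA'; exfalso; apply: (@filter_not_empty _ G).
by rewrite -(setICr A); exact: filterI.
Qed.

(** Arzela-Ascoli along an ultrafilter: bounded coordinates converge pointwise, equicontinuity makes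
    the limit continuous and the convergence uniform, the gap keeps the limit in the open chamber,
    and lower semicontinuity keeps it in the sublevel set. *)
Lemma dyson_rate_compact M : compact [set f : path_space T n | (dyson_rate x f <= M%:E)%E].
Proof.
rewrite compact_ultra => F UF FK /=.
have PF : ProperFilter F by exact: (@ultra_proper _ F UF).
have FF : Filter F by exact: filter_filter.
have [g g0 Hg] := rate_gap T0 M xch.
have T01 : 0 <= T by exact: ltW.
have e0T (t : R) : 0 <= clamp 0 T t <= T by exact: clamp_itv.
have bnd j (t : R) : exists B, forall f, (dyson_rate x f <= M%:E)%E -> `|path_coord f j (clamp 0 T t)| <= B.
  exists (`|x 0 j| + (1 + (M / 1 + n%:R * (4 / g)) * T)) => f fM.
  have /andP[s0 sT] := e0T t; have [fx _] := (dyson_rate_leP x T0 f M).1 fM.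
  have M0 : 0 <= M by rewrite -lee_fin; exact: le_trans (dyson_rate_ge0 _ _) fM.
  have := rate_increment j fM g0 (Hg f fM) ltr01 (lexx 0) s0 sT; rewrite fx subr0 => H.
  rewrite -[path_coord f j _](subrK (x 0 j)) addrC.
  apply: (le_trans (ler_normD _ _)); rewrite lerD2l; apply: (le_trans H).
  by rewrite lerD2l ler_wpM2l// addr_ge0 ?divr_ge0// mulr_ge0// divr_ge0// ltW.
have lim_ex j t : exists l : R, path_coord h j (clamp 0 T t) @[h --> F] --> l.
  have [B HB] := bnd j t.
  pose G := (fun h : path_space T n => path_coord h j (clamp 0 T t)) @ F.
  have UG : UltraFilter G by exact: fmap_ultra.
  have := @segment_compact R (- B) B; rewrite compact_ultra => /(_ G UG)[|l [_ Gl]].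
    rewrite /G /fmap /=; apply: filterS FK => h /HB; rewrite ler_norml /preimage/= in_itv/=; exact.
  by exists l.
have /choice[u0 Hu0] : forall jt : 'I_n * R, exists l : R, path_coord h jt.1 (clamp 0 T jt.2) @[h --> F] --> l.
  by move=> [j t]; exact: lim_ex.
pose u j t := u0 (j, t).
have uc j t : path_coord h j (clamp 0 T t) @[h --> F] --> u j t by exact: (Hu0 (j, t)).
have equi e : 0 < e -> exists2 delta : R, 0 < delta &
  forall s t, `|t - s| < delta -> forall j, `|u j t - u j s| <= e.
  move=> e1; have [delta d0 Hd] := rate_equicontinuous M e1.
  exists delta => // s t std j.
  have C : `|path_coord h j (clamp 0 T t) - path_coord h j (clamp 0 T s)| @[h --> F] --> `|u j t - u j s|.
    by apply: cvg_norm; apply: cvgB; exact: uc.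
  apply: (cvgr_to_le C); apply: filterS FK => h hM; apply: Hd => //.
  exact: le_lt_trans (clamp_dist _ _ _ _) std.
have ucl j t : 0 <= t <= T -> u j t = u j (clamp 0 T t) by move=> tT; rewrite clamp_id.
have gapu t : gapped g (u^~ t).
  move=> k l kl.
  have C : `|path_coord h k (clamp 0 T t) - path_coord h l (clamp 0 T t)| @[h --> F] --> `|u k t - u l t|.
    by apply: cvg_norm; apply: cvgB; exact: uc.
  by apply: (cvgr_to_ge C); apply: filterS FK => h hM; exact: (Hg h hM _ (e0T t)).
(* A limit preserves only the weak order; the uniform gap restores the strict one. *)
have ultu t (i j : 'I_n) : (i < j)%N -> u i t < u j t.
  move=> ij; rewrite lt_neqAle (gapped_neq g0 (gapu t)) ?lt_eqF//=.
  rewrite -subr_ge0.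
  have C : path_coord h j (clamp 0 T t) - path_coord h i (clamp 0 T t) @[h --> F] --> u j t - u i t.
    by apply: cvgB; exact: uc.
  by apply: (cvgr_to_ge C); apply: nearW => h; rewrite subr_ge0 ltW// path_coord_lt.
have cu j : continuous (u j).
  move=> t; apply/cvgrPdist_le => e e0; have [delta d0 Hd] := equi e e0.
  near=> s; rewrite distrC; apply: Hd; rewrite distrC.
  by near: s; exact: cvgr_dist_lt.
have [p pu] := @path_of_coord R T n u T01 cu (fun t _ i j => ultu t i j).
have Fp : F --> p.
  move=> V /nbhs_path[e e0 eV].
  have e40 : 0 < e / 4 by rewrite divr_gt0.
  have [d1 d10 Hd1] := equi _ e40; have [d2 d20 Hd2] := rate_equicontinuous M e40.
  pose Q h (s : R) := forall j, `|path_coord h j (clamp 0 T s) - u j s| < e.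
  (* Compactness of [[0, T]] makes the convergence uniform: near each [t] the error splits into
     convergence at [t] and two equicontinuity terms. *)
  have : \forall h \near F, `[0, T]%classic `<=` Q h.
    apply: ((compact_near_coveringP _).1 (@segment_compact R 0 T) _ F Q FF) => t _.
    exists ([set s | `|t - s| < Num.min d1 d2], [set h | (dyson_rate x h <= M%:E)%E /\
        forall j, `|path_coord h j (clamp 0 T t) - u j t| < e / 4]) => /=.
      split; first by apply/nbhs_ballP; exists (Num.min d1 d2) => //=; rewrite lt_min d10.
      apply: filterI => //; apply: (@filter_forall _ _ _ F FF) => j.
      by have /cvgrPdist_lt/(_ _ e40) := uc j t; apply: filterS => h; rewrite distrC.
    move=> [s h] [/= + [hM ht]] j; rewrite lt_min => /andP[ts1 ts2].
    have h1 := Hd1 _ _ ts1 j.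
    have h2 := Hd2 h hM _ _ (e0T s) (e0T t) (le_lt_trans (clamp_dist _ _ _ _) ts2) j.
    rewrite (_ : _ - _ = (path_coord h j (clamp 0 T t) - u j t) + (u j t - u j s) -
      (path_coord h j (clamp 0 T t) - path_coord h j (clamp 0 T s))); last by ring.
    apply: le_lt_trans (ler_normB _ _) _; apply: le_lt_trans (lerD (ler_normD _ _) (lexx _)) _.
    by have := ht j; lra.
  apply: filterS => h Qh; apply: eV => t tT j; have := Qh t; rewrite /= in_itv/= tT => /(_ isT j).
  by rewrite pu// clamp_id.
exists p; split => //=; rewrite leNgt; apply/negP => pM.
have [V Vp VM] := dyson_rate_lsc T0 pM.
have : F ([set f | (dyson_rate x f <= M%:E)%E] `&` V) by apply: filterI => //; exact: Fp.
move=> /filter_ex[h [hM /VM]]; by rewrite ltNge hM.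
Unshelve. all: by end_near. Qed.

Lemma dyson_rate_good : good_rate_function (dyson_rate x : path_space T n -> \bar R).
Proof.
split; last exact: dyson_rate_compact.
split; first exact: dyson_rate_ge0.
exact: dyson_rate_lsc.
Qed.

End compact_levels.

Lemma exists_natS_gt {R : realType} (K : R) : exists N : nat, K < N.+1%:R.
Proof.
exists (Num.bound `|K|); apply: le_lt_trans (ler_norm _) _.
by apply: lt_trans (archi_boundP (normr_ge0 _)) _; rewrite ltr_nat.
Qed.

(** * Gaussian estimates and chaining *)

Section gaussian_estimates.
Context {R : realType}.
Notation mu := (@lebesgue_measure R).

(* Cameron-Martin for a half line: shifting the mean to [c] costs exactly
   [expR (- c ^+ 2 / (2 * h))] beyond [c]. *)
Lemma normal_pdf_shift_le (h c y : R) : 0 < h -> 0 <= c * (y - c) ->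
  normal_pdf 0 (Num.sqrt h) y <= expR (- c ^+ 2 / (2 * h)) * normal_pdf c (Num.sqrt h) y.
Proof.
move=> h0 cy.
have s0 : Num.sqrt h != 0 by rewrite gt_eqF// sqrtr_gt0.
rewrite !normal_pdfE// mulrCA ler_wpM2l ?normal_peak_ge0//.
rewrite /normal_fun -expRD ler_expR sqr_sqrtr ?(ltW h0)// -mulr_natl subr0.
rewrite -mulrDl ler_wpM2r ?invr_ge0 ?mulr_ge0 ?(ltW h0)//; lra.
Qed.

Lemma normal_prob_half_le (h c : R) (A : set R) : 0 < h -> measurable A ->
  (forall y, A y -> 0 <= c * (y - c)) ->
  (normal_prob 0 (Num.sqrt h) A <= (expR (- c ^+ 2 / (2 * h)))%:E)%E.
Proof.
move=> h0 mA Ac.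
have s0 : Num.sqrt h != 0 by rewrite gt_eqF// sqrtr_gt0.
have mpdf m D : measurable_fun D (fun y => (normal_pdf m (Num.sqrt h) y)%:E).
  by apply/measurable_EFinP; apply: measurable_funTS; exact: measurable_normal_pdf.
rewrite /normal_prob.
apply: (@le_trans _ _ (\int[mu]_(y in A)
    ((expR (- c ^+ 2 / (2 * h)))%:E * (normal_pdf c (Num.sqrt h) y)%:E))%E).
  apply: ge0_le_integral => //.
  - by move=> y _; rewrite lee_fin normal_pdf_ge0.
  - exact: mpdf.
  - by apply: emeasurable_funM; [exact: measurable_cst|exact: mpdf].
  - by move=> y Ay; rewrite -EFinM lee_fin; apply: normal_pdf_shift_le => //; exact: Ac.
rewrite ge0_integralZl; [|by []|exact: mpdf|by move=> y _; rewrite lee_fin normal_pdf_ge0|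
  by rewrite lee_fin expR_ge0].
rewrite -[leRHS]mule1 lee_wpmul2l ?lee_fin ?expR_ge0//.
rewrite -(integral_normal_pdf c (Num.sqrt h)).
apply: ge0_subset_integral => //; first exact: mpdf.
by move=> y _; rewrite lee_fin normal_pdf_ge0.
Qed.

Lemma abs_ge_itvU (a : R) : [set y : R | (a <= `|y|)%R] = `[a, +oo[%classic `|` `]-oo, -a]%classic.
Proof.
by apply/seteqP; split => y /=; rewrite !in_itv/= andbT ler_normr lerNr => /orP.
Qed.

Lemma measurable_abs_ge (a : R) : measurable [set y : R | (a <= `|y|)%R].
Proof. by rewrite abs_ge_itvU; apply: measurableU; exact: measurable_itv. Qed.

Lemma normal_tail (h a : R) : 0 < h -> 0 <= a ->
  (normal_prob 0 (Num.sqrt h) [set y : R | (a <= `|y|)%R] <= (2 * expR (- a ^+ 2 / (2 * h)))%:E)%E.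
Proof.
move=> h0 a0.
have mC (i : interval R) : measurable [set` i] := measurable_itv i.
rewrite abs_ge_itvU.
apply: (le_trans (measureU2 _ _ _)) => //.
have -> : (2 * expR (- a ^+ 2 / (2 * h)))%:E =
   ((expR (- a ^+ 2 / (2 * h)))%:E + (expR (- (- a) ^+ 2 / (2 * h)))%:E)%E.
  by rewrite sqrrN -EFinD mulr_natl mulr2n.
apply: leeD; apply: normal_prob_half_le => //.
  by move=> y; rewrite /= in_itv/= andbT => ay; rewrite mulr_ge0// subr_ge0.
move=> y; rewrite /= in_itv/= => ya; have : 0 <= a * (- a - y) by rewrite mulr_ge0// subr_ge0.
lra.
Qed.

(** On the interval the density is at least its value at distance [|c| + r] from the origin. *)
Lemma normal_lower (h c r : R) : 0 < h -> 0 < r ->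
  ((2 * r * normal_peak (Num.sqrt h) * expR (- (`|c| + r) ^+ 2 / (2 * h)))%:E <=
  normal_prob 0 (Num.sqrt h) [set y : R | (`|y - c| <= r)%R])%E.
Proof.
move=> h0 r0.
have s0 : Num.sqrt h != 0 by rewrite gt_eqF// sqrtr_gt0.
have -> : [set y : R | `|y - c| <= r] = `[c - r, c + r]%classic.
  by apply/seteqP; split => y /=; rewrite in_itv/= ler_distl.
pose K := normal_peak (Num.sqrt h) * expR (- (`|c| + r) ^+ 2 / (2 * h)).
rewrite (_ : 2 * r * _ * _ = K * (2 * r)); last by rewrite /K; ring.
apply: (@le_trans _ _ (\int[mu]_(y in `[(c - r)%R, (c + r)%R]) K%:E)%E).
  rewrite integral_cst//= lebesgue_measure_itv/= lte_fin.
  have -> : c - r < c + r by lra.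
  rewrite -EFinB -EFinM.
  have -> : c + r - (c - r) = 2 * r by ring.
  exact: lexx.
rewrite /normal_prob; apply: ge0_le_integral => //.
- by move=> y _; rewrite lee_fin /K mulr_ge0 ?normal_peak_ge0 ?expR_ge0.
- by apply/measurable_EFinP; apply: measurable_funTS; exact: measurable_normal_pdf.
move=> y; rewrite /= in_itv/= => /andP[y1 y2].
rewrite lee_fin normal_pdfE// /K ler_wpM2l ?normal_peak_ge0//.
rewrite /normal_fun ler_expR sqr_sqrtr ?(ltW h0)// -(mulr_natl h) subr0.
apply: ler_wpM2r; first by rewrite invr_ge0 mulr_ge0// ltW.
rewrite lerN2 -[y ^+ 2]real_normK ?num_real// ler_pXn2r ?nnegrE ?addr_ge0 ?(ltW r0)//.
have := ler_normD c (y - c); rewrite addrC subrK => /le_trans; apply.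
by rewrite lerD2l ler_distl y1 y2.
Qed.

End gaussian_estimates.

Section chaining.
Context {R : realType}.

Lemma within_continuous_dist (A : set R) (b : R -> R) : {within A, continuous b} ->
  forall t, A t -> forall e, 0 < e -> exists2 delta, 0 < delta &
  forall s, A s -> `|t - s| < delta -> `|b t - b s| <= e.
Proof.
move=> cb t At e e0.
have := cb t; rewrite /continuous_at/= /nbhs/= -nbhs_subspace_in// => /cvgrPdist_le/(_ e e0).
rewrite near_withinE => /nbhs_ballP[delta /= d0 Hd].
by exists delta => // s As ts; exact: Hd.
Qed.

(* Summable in [l], yet [chain_bound a l ^ 2] divided by the variance [h / 2 ^ l] of
   a dyadic increment grows like [(9 / 8) ^ l]. *)
Definition chain_bound (a : R) (l : nat) : R := a / 4 * (3 / 4) ^+ l.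

Lemma sum_chain_bound a l : \sum_(k < l) chain_bound a k = a * (1 - (3 / 4) ^+ l).
Proof.
elim: l => [|l IH]; first by rewrite big_ord0 expr0 subrr mulr0.
by rewrite big_ord_recr/= IH /chain_bound exprSr; field.
Qed.

(** The dyadic points [d l] converge to [t] from the left. Each is joined to [p] by passing from
    level [l.+1] to the neighbour of level [l] on the left, at the cost of one increment per level,
    and the values of [chain_bound] sum to at most [a]. *)
Lemma dyadic_chaining (b : R -> R) (p h a : R) : 0 <= p -> 0 < h -> 0 <= a ->
  {within `[0, +oo[, continuous b} ->
  (forall l i, (i < 2 ^ l)%N ->
    `|b (p + i.+1%:R * (h / 2 ^+ l)) - b (p + i%:R * (h / 2 ^+ l))| <= chain_bound a l) ->
  forall t, p <= t <= p + h -> `|b t - b p| <= a.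
Proof.
move=> p0 h0 a0 cb H t /andP[pt tp].
have q0 l : 0 < h / 2 ^+ l :> R by rewrite divr_gt0// exprn_gt0.
(* The right endpoint is a single increment of level [0] away from [p]; for [t < p + h] the index
   [i l] stays below [2 ^ l]. *)
have [->|tph] := eqVneq t (p + h).
  have := H 0%N 0%N isT; rewrite mul0r addr0 mul1r expr0 divr1 /chain_bound expr0 mulr1.
  by move=> /le_trans; apply; lra.
have {tp tph} tp : t < p + h by rewrite lt_neqAle tph.
pose i l := Num.trunc ((t - p) / (h / 2 ^+ l)).
have iP l : (i l)%:R <= (t - p) / (h / 2 ^+ l) < (i l).+1%:R.
  by apply: truncn_itv; rewrite divr_ge0 ?subr_ge0// ltW.
pose d l := p + (i l)%:R * (h / 2 ^+ l).
have dt l : d l <= t < d l + h / 2 ^+ l.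
  have /andP[] := iP l; rewrite ler_pdivlMr// ltr_pdivrMr// -(natr1 (i l)) mulrDl mul1r /d; lra.
have il l : (i l < 2 ^ l)%N.
  rewrite -(ltr_nat R); have /andP[+ _] := iP l => /le_lt_trans; apply.
  rewrite ltr_pdivrMr// natrX mulrCA divff ?mulr1; last by rewrite gt_eqF// exprn_gt0.
  lra.
have K l j : (j < 2 ^ l)%N -> `|b (p + j%:R * (h / 2 ^+ l)) - b p| <= \sum_(k < l.+1) chain_bound a k.
  have cb0 k : 0 <= chain_bound a k by rewrite /chain_bound mulr_ge0 ?exprn_ge0 ?divr_ge0.
  elim: l j => [|l IH] j jl.
    move: jl; rewrite expn0 ltnS leqn0 => /eqP ->.
    by rewrite mul0r addr0 subrr normr0 sumr_ge0.
  rewrite big_ord_recr/=; have := odd_double_half j; set j' := j./2 => jE.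
  have j'l : (j' < 2 ^ l)%N by move: jl; rewrite expnS; case: (odd j) jE; lia.
  have E : p + j'.*2%:R * (h / 2 ^+ l.+1) = p + j'%:R * (h / 2 ^+ l).
    by rewrite -mul2n natrM exprS; field; rewrite expf_neq0.
  have := IH j' j'l; case: (odd j) jE => <- IHj; last first.
    by rewrite add0n E; apply: (le_trans IHj); rewrite lerDl.
  rewrite add1n (_ : b _ - b p = (b (p + j'%:R * (h / 2 ^+ l)) - b p) +
    (b (p + j'.*2.+1%:R * (h / 2 ^+ l.+1)) - b (p + j'%:R * (h / 2 ^+ l)))); last by ring.
  apply: (le_trans (ler_normD _ _)); apply: lerD => //.
  by rewrite -E; apply: H; rewrite expnS; lia.
apply/ler_addgt0Pr => e e0.
have t0 : `[0, +oo[%classic t by rewrite /= in_itv/= andbT (le_trans p0 pt).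
have [delta d0 Hd] := within_continuous_dist cb t0 e0.
have [l hl] : exists l : nat, h / 2 ^+ l < delta.
  have /cvgrPdist_lt/(_ (delta / h)) : (2^-1 : R) ^+ l @[l --> \oo] --> (0 : R).
    by apply: cvg_expr; rewrite ger0_norm// invf_lt1// ltr1n.
  rewrite divr_gt0// => /(_ isT)[l _ /(_ l (leqnn _))] /=.
  rewrite sub0r normrN ger0_norm ?exprn_ge0// ltr_pdivlMr// exprVn => hl.
  by exists l; rewrite mulrC.
have /andP[d1 d2] := dt l.
have tdl : `|b t - b (d l)| <= e.
  apply: Hd; first by rewrite /= in_itv/= andbT addr_ge0// mulr_ge0// ltW.
  rewrite ger0_norm ?subr_ge0//; lra.
rewrite (_ : b t - b p = (b (d l) - b p) + (b t - b (d l))); last by ring.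
apply: (le_trans (ler_normD _ _)); apply: lerD => //.
apply: (le_trans (K l _ (il l))); rewrite sum_chain_bound.
by rewrite ler_piMr// lerBlDr lerDl exprn_ge0// divr_ge0.
Qed.

End chaining.

Section finite_subadditivity.
Context d (T : measurableType d) (R : realType) (P : {measure set T -> \bar R}).

Lemma measure_bigcup_ord_le (m : nat) (A : nat -> set T) : (forall i, measurable (A i)) ->
  (P (\bigcup_(i in `I_m) A i) <= \sum_(i < m) P (A i))%E.
Proof.
move=> mA; apply: (content_subadditive P) => //.
- exact: bigcup_measurable.
- by rewrite -bigcup_mkord.
Qed.

Lemma measure_bigcup_fin_le (I : finType) (A : I -> set T) : (forall i, measurable (A i)) ->
  (P (\bigcup_i A i) <= \sum_i P (A i))%E.
Proof.
move=> mA.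
have -> : \bigcup_i A i = \big[setU/set0]_(i <- index_enum I) A i.
  rewrite -bigcup_seq; apply: eq_bigcupl; split => i // _; exact: mem_index_enum.
elim: (index_enum I) => [|i r IH]; first by rewrite !big_nil measure0.
rewrite !big_cons; apply: (le_trans (measureU2 _ _ _)) => //.
  by apply: bigsetU_measurable => j _; exact: mA.
exact: leeD.
Qed.

Lemma measure_bigcup_nat_le (A : nat -> set T) (K : R) : (forall i, measurable (A i)) ->
  (forall m, \sum_(i < m) P (A i) <= K%:E)%E -> (P (\bigcup_i A i) <= K%:E)%E.
Proof.
move=> mA AK; apply: (@le_trans _ _ (\sum_(0 <= i <oo) P (A i))%E).
  by apply: measure_sigma_subadditive => //; exact: bigcupT_measurable.
apply: lime_le; first exact: is_cvg_nneseries.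
by apply: nearW => m; rewrite /= big_mkord.
Qed.

End finite_subadditivity.

Section oscillation.
Context {R : realType} {d : measure_display} {Omega : measurableType d}.
Variable P : probability Omega R.
Variable B : R -> Omega -> R.
Hypothesis bmB : brownian_motion P B.

Lemma measurable_increment (s t : R) : 0 <= s -> 0 <= t -> measurable_fun setT (increment B s t).
Proof.
by move=> s0 t0; apply: measurable_funB; exact: (bm_measurable bmB).
Qed.

(** A measurable substitute for the event that [k * B] moves by more than [a] during [[p, p + h]]: a
    countable union over dyadic increments, whereas paths are continuous only almost surely. *)
Definition chain_event (k p h a : R) : set Omega :=
  \bigcup_l \bigcup_(i in `I_(2 ^ l))
   [set w | chain_bound a l < k * `|increment B (p + i%:R * (h / 2 ^+ l)) (p + i.+1%:R * (h / 2 ^+ l)) w|].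

Lemma chain_cell_measurable (k s t a : R) : 0 <= s -> 0 <= t ->
  measurable [set w | a < k * `|increment B s t w|].
Proof.
move=> s0 t0.
have mf : measurable_fun setT (fun w => k * `|increment B s t w|).
  apply: measurable_funM; first exact: measurable_cst.
  by apply: measurableT_comp => //; exact: measurable_increment.
rewrite (_ : [set w | _] = setT `&` (fun w => k * `|increment B s t w|) @^-1` `]a, +oo[); last first.
  by rewrite setTI; apply/seteqP; split => w /=; rewrite in_itv/= andbT.
by apply: mf => //; exact: measurable_itv.
Qed.

Lemma measurable_chain_event k p h a : 0 <= p -> 0 <= h -> measurable (chain_event k p h a).
Proof.
move=> p0 h0; apply: bigcupT_measurable => l; apply: bigcup_measurable => i _.
by apply: chain_cell_measurable; rewrite addr_ge0// mulr_ge0// divr_ge0// exprn_ge0.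
Qed.

(** Replaces the geometric growth of the exponent by a linear one, so that the levels are summed as
    a geometric series. *)
Lemma bernoulli_18 (l : nat) : 1 + l%:R / 8 <= (9 / 8 : R) ^+ l.
Proof.
elim: l => [|l IH]; first by rewrite mul0r addr0 expr0.
rewrite exprSr -natr1; apply: (@le_trans _ _ ((1 + l%:R / 8) * (9 / 8))).
  by have : 0 <= l%:R :> R by []; move: (l%:R : R) => x x0; lra.
by rewrite ler_wpM2r// divr_ge0.
Qed.

Lemma increment_tail (s t a : R) : 0 <= s -> s < t -> 0 <= a ->
  (P (increment B s t @^-1` [set y : R | (a <= `|y|)%R]) <= (2 * expR (- a ^+ 2 / (2 * (t - s))))%:E)%E.
Proof.
move=> s0 st a0; rewrite (bm_gaussian bmB)//; first by apply: normal_tail => //; rewrite subr_gt0.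
exact: measurable_abs_ge.
Qed.

(** The exponent of level [l] is [chain_bound a l ^+ 2 / (2 * k ^+ 2 * (h / 2 ^+ l)) = y * (9 / 8)
    ^+ l], whence [32 = 2 * 4 ^ 2]. The threshold [24] gives [expR (- (y / 8)) <= 1 / 4], because
    [expR 3 >= 4]; this beats the [2 ^ l] cells and leaves a geometric series whose sum, at most
    [2], doubles the factor [2] of the tail. *)
Lemma chain_event_prob (k p h a : R) : 0 <= p -> 0 < h -> 0 < k -> 0 < a ->
  24 <= a ^+ 2 / (32 * h * k ^+ 2) ->
  (P (chain_event k p h a) <= (4 * expR (- (a ^+ 2 / (32 * h * k ^+ 2))))%:E)%E.
Proof.
move=> p0 h0 k0 a0; set y := a ^+ 2 / _ => y24.
have q0 l : 0 < h / 2 ^+ l :> R by rewrite divr_gt0// exprn_gt0.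
pose s l i : R := p + i%:R * (h / 2 ^+ l).
have s0 l i : 0 <= s l i by rewrite addr_ge0// mulr_ge0// ltW.
have sS l i : s l i.+1 - s l i = h / 2 ^+ l by rewrite /s -natr1; ring.
have mc l i : measurable [set w | chain_bound a l < k * `|increment B (s l i) (s l i.+1) w|].
  by apply: chain_cell_measurable.
have cell l i : (P [set w | (chain_bound a l < k * `|increment B (s l i) (s l i.+1) w|)%R] <=
    (2 * expR (- (y * (1 + l%:R / 8))))%:E)%E.
  have cb0 : 0 <= chain_bound a l / k.
    by rewrite divr_ge0 ?(ltW k0)// /chain_bound mulr_ge0 ?exprn_ge0 ?divr_ge0// ltW.
  have st : s l i < s l i.+1 by rewrite -subr_gt0 sS.
  apply: (@le_trans _ _ (P (increment B (s l i) (s l i.+1) @^-1` [set y : R | (chain_bound a l / k <= `|y|)%R]))).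
    rewrite le_measure ?inE//.
      rewrite -[X in measurable X]setTI; apply: measurable_increment => //.
      exact: measurable_abs_ge.
    by move=> w /= /ltW; rewrite ler_pdivrMr// mulrC.
  apply: (le_trans (increment_tail (s0 l i) st cb0)).
  rewrite lee_fin ler_pM2l// ler_expR mulNr lerN2 sS.
  have -> : (chain_bound a l / k) ^+ 2 / (2 * (h / 2 ^+ l)) = y * (9 / 8) ^+ l.
    have -> : (9 / 8 : R) ^+ l = ((3 / 4) ^+ l) ^+ 2 * 2 ^+ l.
      by rewrite -exprM mulnC exprM -exprMn; congr (_ ^+ _); field.
    rewrite /y /chain_bound; field.
    by rewrite !gt_eqF// exprn_gt0.
  by rewrite ler_wpM2l ?bernoulli_18//; lra.
clearbody y.
have e4 : expR (- (y / 8)) <= 4^-1.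
  rewrite expRN lef_pV2 ?posrE ?expR_gt0//.
  by apply: le_trans (expR_ge1Dx _); lra.
apply: measure_bigcup_nat_le.
  by move=> l; apply: bigcup_measurable => i _; exact: mc.
move=> m; apply: (@le_trans _ _ (\sum_(l < m) (2 * expR (- y) * 2^-1 ^+ l)%:E)%E).
  apply: lee_sum => l _; apply: (le_trans (measure_bigcup_ord_le _ _ _)).
    by move=> i; exact: mc.
  apply: (@le_trans _ _ (\sum_(i < 2 ^ l) (2 * expR (- (y * (1 + l%:R / 8))))%:E)%E).
    by apply: lee_sum => i _; exact: cell.
  rewrite sumEFin lee_fin sumr_const card_ord -[X in X <= _]mulr_natr natrX.
  have -> : - (y * (1 + l%:R / 8)) = - y + l%:R * - (y / 8) by field.
  rewrite expRD expRM_natl -!mulrA ler_pM2l// ler_pM2l ?expR_gt0// -exprMn.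
  move: e4; move: (expR_ge0 (- (y / 8))); move: (expR (- (y / 8))) => e e0 e4.
  by apply: lerXn2r; rewrite ?nnegrE; lra.
rewrite sumEFin lee_fin -mulr_sumr.
have E : \sum_(l < m) 2^-1 ^+ l = 2 * (1 - 2^-1 ^+ m) :> R.
  elim: m => [|m IH]; first by rewrite big_ord0 expr0 subrr mulr0.
  by rewrite big_ord_recr/= IH exprSr; field.
rewrite E; have : 0 <= (2^-1 : R) ^+ m by rewrite exprn_ge0// invr_ge0.
by have := expR_gt0 (- y); move: (expR _) (_ ^+ m) => u v; nra.
Qed.

Lemma chain_event_oscillation (k p h a : R) w : 0 <= p -> 0 < h -> 0 < k -> 0 <= a ->
  {within `[0, +oo[, continuous (fun t => B t w)} -> ~ chain_event k p h a w ->
  forall t, p <= t <= p + h -> k * `|B t w - B p w| <= a.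
Proof.
move=> p0 h0 k0 a0 cB nC t pt.
rewrite mulrC -ler_pdivlMr//.
apply: (@dyadic_chaining R (fun t => B t w) p h (a / k)) => //.
  by rewrite divr_ge0// ltW.
move=> l i il; rewrite leNgt; apply/negP => H; apply: nC; exists l => //; exists i => //=.
move: H; rewrite /chain_bound /increment.
rewrite (_ : a / k / 4 * (3 / 4) ^+ l = a / 4 * (3 / 4) ^+ l / k); last by field; rewrite gt_eqF.
by rewrite ltr_pdivrMr// => H'; rewrite [ltRHS]mulrC.
Qed.

End oscillation.

(** * Increments over a mesh *)

Section joint_increments.
Context {R : realType} {d : measure_display} {Omega : measurableType d}.
Variables (P : probability Omega R) (n : nat) (B : 'I_n -> R -> Omega -> R).
Hypotheses (bmB : forall j, brownian_motion P (B j)) (indB : independent_processes P B).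
Variables (m : nat) (h : R).
Hypothesis h0 : 0 < h.

Definition mesh_increment (j : 'I_n) (i : nat) : Omega -> R :=
  increment (B j) (i%:R * h) (i.+1%:R * h).

Lemma mesh_step i : i.+1%:R * h - i%:R * h = h.
Proof. by rewrite -natr1; ring. Qed.

Lemma mesh_ge0 i : 0 <= i%:R * h.
Proof. by rewrite mulr_ge0// ltW. Qed.

Lemma measurable_mesh_increment j i (A : set R) : measurable A ->
  measurable (mesh_increment j i @^-1` A).
Proof.
move=> mA; rewrite -[X in measurable X]setTI.
by apply: (measurable_increment (bmB j)) => //; exact: mesh_ge0.
Qed.

Lemma mesh_increment_prob j i (A : set R) : measurable A ->
  P (mesh_increment j i @^-1` A) = normal_prob 0 (Num.sqrt h) A.
Proof.
move=> mA; rewrite /mesh_increment (bm_gaussian (bmB j)) ?mesh_step//; first exact: mesh_ge0.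
by rewrite -subr_gt0 mesh_step.
Qed.

(** Independence enters twice, across [j] and across the increments of one [B j]. The first use
    needs the events of [B j] in the sigma-algebra that it generates. *)
Lemma mesh_joint (A : 'I_n -> 'I_m -> set R) : (forall j i, measurable (A j i)) ->
  P (\bigcap_(j in [set: 'I_n]) \bigcap_(i in [set: 'I_m]) mesh_increment j i @^-1` A j i) =
  (\prod_(j < n) \prod_(i < m) normal_prob 0 (Num.sqrt h) (A j i))%E.
Proof.
move=> mA; rewrite indB.
  apply: eq_bigr => j _.
  rewrite (bm_independent (bmB j) (t := fun i => i%:R * h))//.
  - by apply: eq_bigr => i _; exact: (mesh_increment_prob j i (mA j i)).
  - exact: mesh_ge0.
  - by move=> i; rewrite -subr_ge0 mesh_step ltW.
move=> j.
pose G := process_events `[0, +oo[ (B j).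
have mB (t : R) : 0 <= t -> measurable_fun setT (B j t : g_sigma_algebraType G -> R).
  move=> t0 _ Y mY; rewrite setTI; apply: sub_sigma_algebra.
  by exists t, Y; split => //; rewrite /= in_itv/= t0.
suff : (measurable : set (set (g_sigma_algebraType G))) (\bigcap_(i in [set: 'I_m]) mesh_increment j i @^-1` A j i).
  by [].
apply: fin_bigcap_measurable => // i _.
have mI : measurable_fun setT (mesh_increment j i : g_sigma_algebraType G -> R).
  by apply: measurable_funB; apply: mB; exact: mesh_ge0.
by rewrite -[X in measurable X]setTI; exact: mI.
Qed.

End joint_increments.

(** * Probabilities of energies and tubes over a mesh *)

Section energy_deviation.
Context {R : realType}.
Variables (n m : nat) (h : R).
Hypothesis h0 : 0 < h.

Lemma prode_le (I : finType) (F G : I -> \bar R) : (forall i, 0 <= F i <= G i)%E ->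
  (0 <= \prod_i F i <= \prod_i G i)%E.
Proof.
move=> FG; elim/big_rec2: _ => [|i y1 y2 _ /andP[y0 y12]]; first by rewrite lee_fin ler01 lexx.
by have /andP[F0 FG'] := FG i; rewrite mule_ge0//= lee_pmul.
Qed.

(* The set of increments with energy at least [2 * alpha] is covered, up to the event
   that one increment exceeds [rho], by finitely many boxes whose corner nearest to
   the origin has energy at least [2 * (alpha - eta)]. *)
Lemma mesh_energy_tail (alpha eta : R) : 0 < alpha -> 0 < eta ->
  exists2 C : R, 0 <= C &
  forall (d : measure_display) (Omega : measurableType d) (P : probability Omega R)
    (B : 'I_n -> R -> Omega -> R) (k : R),
    (forall j, brownian_motion P (B j)) -> independent_processes P B -> 0 < k ->
    exists2 A : set Omega, measurable A /\ (P A <= (C * expR (- ((alpha - eta) / k ^+ 2)))%:E)%E &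
      forall w, ~ A w -> \sum_(j < n) \sum_(i < m) (k * mesh_increment B h j i w) ^+ 2 / h <= 2 * alpha.
Proof.
move=> al0 eta0.
pose Q : R := (n * m)%:R + 1.
have Q0 : 0 < Q by rewrite ltr_wpDl.
(* As [rho ^+ 2 >= 2 * h * alpha], a single increment of [k * B] beyond [rho] already costs the rate
   [alpha]. *)
pose rho : R := 2 * h * alpha + 1.
have rho0 : 0 < rho by rewrite ltr_wpDl// !mulr_ge0// ltW.
have rho2 : 2 * h * alpha <= rho ^+ 2.
  by have : 0 <= h * alpha by [rewrite mulr_ge0// ltW]; rewrite /rho; nra.
(* So fine that moving every coordinate by one step [delta] changes the sum of squares by at most
   [2 * h * eta], a loss of [eta] in the exponent. *)
have [N HN] := exists_natS_gt (Q * (2 * rho + rho) * rho / (2 * h * eta)).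
pose delta : R := rho / N.+1%:R.
have delta0 : 0 < delta by rewrite divr_gt0.
have dN : N.+1%:R * delta = rho by rewrite /delta mulrCA divff ?mulr1.
have hdelta : Q * ((2 * rho + delta) * delta) <= 2 * h * eta.
  move: HN; rewrite ltr_pdivrMr ?mulr_gt0// => HN.
  have dr : delta <= rho by rewrite /delta ler_pdivrMr// ler_peMr ?ler1n// ltW.
  have : Q * (2 * rho + rho) * delta <= 2 * h * eta.
    by rewrite /delta mulrA ler_pdivrMr// [leRHS]mulrC; exact: ltW.
  apply: le_trans; rewrite mulrA ler_wpM2r ?(ltW delta0)// ler_wpM2l ?(ltW Q0)//; lra.
pose box := {ffun 'I_n -> {ffun 'I_m -> 'I_N.+1}}.
exists ((n * m)%:R * 2 + #|{: box}|%:R * 2 ^+ (n * m)).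
  by rewrite addr_ge0// mulr_ge0// exprn_ge0.
move=> d Omega P B k bmB indB k0.
pose tail (ji : 'I_n * 'I_m) := mesh_increment B h ji.1 ji.2 @^-1` [set y : R | (rho / k <= `|y|)%R].
(* Only lower bounds on the increments are kept, so that the probability of a cell is a product of
   Gaussian tails; [heavy] tests the far corner of the box instead. *)
pose cell (z : box) := \bigcap_(j in [set: 'I_n]) \bigcap_(i in [set: 'I_m])
  mesh_increment B h j i @^-1` [set y : R | ((z j i)%:R * delta / k <= `|y|)%R].
pose heavy (z : box) := 2 * h * alpha <= \sum_(j < n) \sum_(i < m) ((z j i).+1%:R * delta) ^+ 2.
pose cell' (z : box) := if heavy z then cell z else set0.
have mtail ji : measurable (tail ji).
  by apply: measurable_mesh_increment => //; exact: measurable_abs_ge.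
have mcell z : measurable (cell z).
  apply: fin_bigcap_measurable; first exact: finite_finset.
  move=> j _; apply: fin_bigcap_measurable; first exact: finite_finset.
  by move=> i _; apply: measurable_mesh_increment => //; exact: measurable_abs_ge.
have mcell' z : measurable (cell' z) by rewrite /cell'; case: ifP.
exists ((\bigcup_ji tail ji) `|` (\bigcup_z cell' z)).
  split.
    apply: measurableU; apply: fin_bigcup_measurable => //; exact: finite_finset.
  apply: (le_trans (measureU2 _ _ _)).
  - by apply: fin_bigcup_measurable => //; exact: finite_finset.
  - by apply: fin_bigcup_measurable => //; exact: finite_finset.
  rewrite mulrDl EFinD; apply: leeD.
    apply: (le_trans (measure_bigcup_fin_le _ _)) => //.
    apply: (@le_trans _ _ (\sum_(ji : 'I_n * 'I_m) (2 * expR (- ((alpha - eta) / k ^+ 2)))%:E)%E).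
      apply: lee_sum => ji _.
      have tE : P (tail ji) = normal_prob 0 (Num.sqrt h) [set y : R | (rho / k <= `|y|)%R].
        by apply: (mesh_increment_prob bmB h0); exact: measurable_abs_ge.
      rewrite [X in (X <= _)%E]tE.
      apply: le_trans (normal_tail h0 _) _; first by rewrite divr_ge0// ltW.
      rewrite lee_fin ler_pM2l// ler_expR mulNr lerN2 expr_div_n.
      rewrite ler_pdivlMr ?mulr_gt0// ler_pdivlMr ?exprn_gt0// mulrAC divfK ?gt_eqF ?exprn_gt0//.
      by apply: le_trans rho2; have : 0 < h * eta by [rewrite mulr_gt0]; lra.
    rewrite sumEFin lee_fin sumr_const card_prod !card_ord -[X in X <= _]mulr_natl; lra.
  apply: (le_trans (measure_bigcup_fin_le _ _)) => //.
  apply: (@le_trans _ _ (\sum_(z : box) (2 ^+ (n * m) * expR (- ((alpha - eta) / k ^+ 2)))%:E)%E).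
    apply: lee_sum => z _; rewrite /cell'; case: ifPn => hz; last first.
      by rewrite measure0 lee_fin mulr_ge0 ?exprn_ge0 ?expR_ge0.
    have mZ j i : measurable [set y : R | ((z j i)%:R * delta / k <= `|y|)%R] by exact: measurable_abs_ge.
    rewrite [X in (X <= _)%E](mesh_joint bmB indB h0 mZ).
    pose E := \sum_(j < n) \sum_(i < m) ((z j i)%:R * delta) ^+ 2.
    apply: (@le_trans _ _ (\prod_(j < n) \prod_(i < m) (2 * expR (- ((z j i)%:R * delta / k) ^+ 2 / (2 * h))))%:E).
      rewrite -prodEFin; apply: (andP (prode_le _)).2 => j; rewrite -prodEFin.
      apply: prode_le => i; rewrite measure_ge0 /=.
      by apply: normal_tail => //; rewrite !mulr_ge0 ?invr_ge0 ?(ltW k0)// ltW.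
    rewrite lee_fin.
    have -> : \prod_(j < n) \prod_(i < m) (2 * expR (- ((z j i)%:R * delta / k) ^+ 2 / (2 * h))) =
        2 ^+ (n * m) * expR (- (E / (2 * h * k ^+ 2))).
      transitivity (\prod_(j < n) (2 ^+ m * expR (\sum_(i < m) - ((z j i)%:R * delta / k) ^+ 2 / (2 * h)))).
        apply: eq_bigr => j _; rewrite big_split/= prodr_const card_ord; congr (_ * _).
        by rewrite expR_sum.
      rewrite big_split/= prodr_const card_ord -exprM mulnC -expR_sum; congr (_ * expR _).
      rewrite /E mulr_suml -sumrN; apply: eq_bigr => j _; rewrite mulr_suml -sumrN; apply: eq_bigr => i _.
      by field; rewrite !gt_eqF.
    rewrite ler_wpM2l ?exprn_ge0// ler_expR lerN2.
    have -> : E / (2 * h * k ^+ 2) = E / (2 * h) / k ^+ 2 by field; rewrite !gt_eqF.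
    rewrite ler_wpM2r ?invr_ge0 ?exprn_ge0 ?(ltW k0)// ler_pdivlMr ?mulr_gt0//.
    have : 2 * h * alpha <= E + Q * ((2 * rho + delta) * delta).
      apply: (le_trans hz).
      apply: (@le_trans _ _ (E + \sum_(j < n) \sum_(i < m) ((2 * rho + delta) * delta))).
        rewrite /E -big_split/=; apply: ler_sum => j _; rewrite -big_split/=; apply: ler_sum => i _.
        rewrite -natr1.
        have zr : (z j i)%:R * delta <= rho.
          by rewrite -dN ler_wpM2r ?(ltW delta0)// ler_nat ltnW.
        by nra.
      rewrite lerD2l sumr_const sumr_const !card_ord -mulrnA -[X in X <= _]mulr_natl.
      apply: ler_wpM2r; first by rewrite mulr_ge0 ?addr_ge0 ?mulr_ge0 ?(ltW rho0) ?(ltW delta0).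
      by rewrite /Q [in X in X <= _]mulnC lerDl.
    by lra.
  rewrite sumEFin lee_fin sumr_const -[X in X <= _]mulr_natl; lra.
move=> w nA; rewrite leNgt; apply/negP => Hw; apply: nA.
pose v (j : 'I_n) (i : 'I_m) := k * mesh_increment B h j i w.
have [|ntail] := pselect ((\bigcup_ji tail ji) w); first by left.
right.
have vrho j i : `|v j i| < rho.
  rewrite ltNge; apply/negP => H; apply: ntail; exists (j, i) => //=.
  by rewrite /tail/= ler_pdivrMr// mulrC; move: H; rewrite /v normrM (gtr0_norm k0).
have zP j i : (Num.trunc (`|v j i| / delta) < N.+1)%N.
  have /andP[z1 _] := truncn_itv (divr_ge0 (normr_ge0 (v j i)) (ltW delta0)).
  rewrite -(ltr_nat R); apply: (le_lt_trans z1).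
  by rewrite ltr_pdivrMr// dN.
pose z : box := [ffun j => [ffun i => Ordinal (zP j i)]].
exists z => //.
have zE j i : (z j i : nat) = Num.trunc (`|v j i| / delta) by rewrite !ffunE.
have zb j i : (z j i)%:R * delta <= `|v j i| < (z j i).+1%:R * delta.
  have := truncn_itv (divr_ge0 (normr_ge0 (v j i)) (ltW delta0)).
  by rewrite -zE ler_pdivlMr// ltr_pdivrMr.
rewrite /cell' ifT.
  move=> j _ i _ /=; have /andP[+ _] := zb j i.
  by rewrite ler_pdivrMr// /v normrM (gtr0_norm k0) mulrC [X in _ <= X -> _]mulrC.
rewrite /heavy; have : 2 * alpha < (\sum_(j < n) \sum_(i < m) (v j i) ^+ 2) / h.
  rewrite mulr_suml; apply: (lt_le_trans Hw); apply: ler_sum => j _.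
  by rewrite mulr_suml.
rewrite ltr_pdivlMr// mulrAC => /ltW /le_trans; apply.
apply: ler_sum => j _; apply: ler_sum => i _.
have /andP[_ /ltW zv] := zb j i.
rewrite -[v j i ^+ 2]real_normK ?num_real// ler_pXn2r ?nnegrE//.
by rewrite mulr_ge0// ltW.
Qed.

End energy_deviation.

Section energy_lower_bound.
Context {R : realType}.
Variables (n m : nat) (h : R).
Hypothesis h0 : 0 < h.

(** After division by [k] the tube has radius [e / k >= e], as [k <= 1], so the prefactor does not
    depend on [k]. The exponent is that of [normal_lower], multiplied over the independent
    increments. *)
Lemma mesh_tube_lower (c : 'I_n -> 'I_m -> R) (e : R) : 0 < e ->
  exists2 C : R, 0 < C &
  forall (d : measure_display) (Omega : measurableType d) (P : probability Omega R)
    (B : 'I_n -> R -> Omega -> R) (k : R),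
    (forall j, brownian_motion P (B j)) -> independent_processes P B -> 0 < k <= 1 ->
    ((C * expR (- ((\sum_(j < n) \sum_(i < m) (`|c j i| + e) ^+ 2 / (2 * h)) / k ^+ 2)))%:E <=
      P (\bigcap_(j in [set: 'I_n]) \bigcap_(i in [set: 'I_m])
           mesh_increment B h j i @^-1` [set y : R | (`|k * y - c j i| <= e)%R]))%E.
Proof.
move=> e0; pose p : R := 2 * e * normal_peak (Num.sqrt h).
have p0 : 0 < p by rewrite !mulr_gt0// normal_peak_gt0// gt_eqF// sqrtr_gt0.
exists ((p ^+ m) ^+ n); first by rewrite !exprn_gt0.
move=> d Omega P B k bmB indB /andP[k0 k1].
have kE j i : [set y : R | (`|k * y - c j i| <= e)%R] = [set y : R | (`|y - c j i / k| <= e / k)%R].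
  have H y : `|y - c j i / k| * k = `|k * y - c j i|.
    by rewrite -[X in _ * X](gtr0_norm k0) -normrM mulrBl divfK ?gt_eqF// [y * k]mulrC.
  by apply/seteqP; split => y /=; rewrite ler_pdivlMr// H.
have mZ j i : measurable [set y : R | (`|k * y - c j i| <= e)%R].
  rewrite kE (_ : [set y : R | _] = `[c j i / k - e / k, c j i / k + e / k]%classic)//.
  by apply/seteqP; split => y; rewrite /= in_itv/= ler_distl.
rewrite [X in (_ <= X)%E](mesh_joint bmB indB h0 mZ).
set S := \sum_j _.
have -> : (p ^+ m) ^+ n * expR (- (S / k ^+ 2)) =
    \prod_(j < n) \prod_(i < m) (p * expR (- ((`|c j i| + e) ^+ 2 / (2 * h) / k ^+ 2))).
  transitivity (\prod_(j < n) (p ^+ m * expR (\sum_(i < m) - ((`|c j i| + e) ^+ 2 / (2 * h) / k ^+ 2)))).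
    rewrite big_split/= prodr_const card_ord -expR_sum; congr (_ * expR _).
    rewrite /S mulr_suml -sumrN; apply: eq_bigr => j _.
    by rewrite mulr_suml -sumrN.
  by apply: eq_bigr => j _; rewrite expR_sum big_split/= prodr_const card_ord.
have pe0 (z : R) : 0 <= p * expR z by rewrite mulr_ge0 ?expR_ge0// ltW.
rewrite -prodEFin; apply: (andP (prode_le _)).2 => j; rewrite -prodEFin.
apply: prode_le => i; rewrite lee_fin pe0 kE /=.
apply: le_trans (normal_lower (c j i / k) h0 (divr_gt0 e0 k0)).
rewrite lee_fin normrM (gtr0_norm (_ : 0 < k^-1)) ?invr_gt0// -mulrDl.
have -> : - ((`|c j i| + e) / k) ^+ 2 / (2 * h) = - ((`|c j i| + e) ^+ 2 / (2 * h) / k ^+ 2).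
  by field; rewrite !gt_eqF.
apply: ler_wpM2r; first exact: expR_ge0.
rewrite /p; apply: ler_wpM2r; first exact: normal_peak_ge0.
apply: ler_wpM2l => //.
by rewrite ler_pdivlMr// ler_piMr// ltW.
Qed.

End energy_lower_bound.

(** * Measurability of open events *)

Section path_space_measurability.
Context {R : realType}.

Lemma near_0right (a : R) : 0 < a -> (0 : R)^'+ [set z : R | 0 < z < a].
Proof.
move=> a0; exists a => //= z; rewrite /ball/= sub0r normrN => za z0.
by rewrite z0/= (le_lt_trans (ler_norm _) za).
Qed.

(** Compactness in its near-covering form, with the filter [0^'+] on radii. It yields both uniform
    continuity and the positive distance of a compact set from a closed one. *)
Lemma compact_uniform_radius (U : topologicalType) (K : set U) (Q : R -> U -> Prop) :
  compact K -> (forall r s u, 0 < s -> s <= r -> Q r u -> Q s u) ->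
  (forall u, K u -> exists2 r : R, 0 < r & \forall v \near u, Q r v) ->
  exists2 r : R, 0 < r & forall u, K u -> Q r u.
Proof.
move=> /compact_near_coveringP cK Qle HK.
have [u Ku|r /= r0 Hr] := cK R (0 : R)^'+ Q _.
  have [r r0 Hr] := HK u Ku.
  exists ([set v | Q r v], [set z : R | 0 < z < r]) => /=; first by split => //; exact: near_0right.
  by move=> [v z] [/= Qv /andP[z0 zr]]; exact: Qle z0 (ltW zr) Qv.
have r20 : 0 < r / 2 by rewrite divr_gt0.
exists (r / 2) => // u; apply: (Hr (r / 2)) => //.
by rewrite /ball/= sub0r normrN gtr0_norm//; lra.
Qed.

Lemma uniformly_continuous_itv (h : R -> R) (a b e : R) : continuous h -> 0 < e ->
  exists2 delta : R, 0 < delta & forall s t, a <= s <= b ->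
    `|t - s| < delta -> `|h t - h s| <= e.
Proof.
move=> ch e0.
have [||r r0 Hr] := @compact_uniform_radius R `[a, b]%classic
  (fun r s => forall t, `|t - s| < r -> `|h t - h s| <= e) (@segment_compact R a b).
- by move=> r s u _ sr Q t tu; apply: Q; exact: lt_le_trans sr.
- move=> x _; have e20 : 0 < e / 2 by rewrite divr_gt0.
  have /cvgrPdist_le/(_ _ e20)/nbhs_ballP[r /= r0 Hr] := ch x.
  have r20 : 0 < r / 2 by rewrite divr_gt0.
  exists (r / 2) => //; apply/nbhs_ballP; exists (r / 2) => // s; rewrite /ball/= => xs t ts.
  have h1 : `|h x - h s| <= e / 2 by apply: Hr; apply: (lt_trans xs); lra.
  have h2 : `|h x - h t| <= e / 2.
    by apply: Hr; rewrite /ball/=; have := ler_distD s x t; rewrite (distrC s t); lra.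
  by apply: le_trans (ler_distD (h x) _ _) _; rewrite (distrC (h t)); lra.
by exists r => // s t sab; apply: Hr; rewrite /= in_itv.
Qed.

Variables (T : R) (n : nat).
Hypothesis T0 : 0 < T.
Implicit Types f g : path_space (R:=R) T n.

Lemma path_uniformly_continuous f e : 0 < e ->
  exists2 delta : R, 0 < delta & forall s t, 0 <= s <= T -> 0 <= t <= T ->
    `|t - s| < delta -> forall j, `|path_coord f j t - path_coord f j s| <= e.
Proof.
move=> e0.
have /choice[D HD] (j : 'I_n) : exists delta : R, 0 < delta /\ forall s t,
    0 <= s <= T -> 0 <= t <= T -> `|t - s| < delta -> `|path_coord f j t - path_coord f j s| <= e.
  have [delta d0 H] := uniformly_continuous_itv 0 T (@path_coord_continuous _ _ _ f (ltW T0) j) e0.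
  exists delta; split => // s t sT tT /(H _ _ sT) /=.
  by rewrite !clamp_id.
exists (\big[Num.min/1]_j D j).
  by elim/big_ind: _ => // [y z y0 z0|j _]; [rewrite lt_min y0|exact: (HD j).1].
move=> s t sT tT st j; apply: (HD j).2 => //; apply: lt_le_trans st _.
exact: bigmin_le_cond.
Qed.

Lemma path_le_of_rat f g (c e : R) : 0 < e ->
  (forall (s : rat) j, 0 <= (ratr s : R) <= T -> `|path_coord g j (ratr s) - path_coord f j (ratr s)| <= c) ->
  forall t, 0 <= t <= T -> forall j, `|path_coord g j t - path_coord f j t| <= c + e.
Proof.
move=> e0 H t tT j.
have e20 : 0 < e / 2 by rewrite divr_gt0.
have [d1 d10 H1] := path_uniformly_continuous f e20.
have [d2 d20 H2] := path_uniformly_continuous g e20.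
pose d := Num.min d1 d2; have d0 : 0 < d by rewrite lt_min d10.
have /andP[t0 tT'] := tT.
have : Num.max 0 (t - d) < Num.min T (t + d).
  by rewrite gt_max !lt_min T0 /=; apply/andP; split; [|apply/andP; split]; lra.
move=> /rat_in_itvoo[q]; rewrite in_itv/= gt_max lt_min => /andP[/andP[q0 qt] /andP[qT tq]].
have qT' : 0 <= (ratr q : R) <= T by rewrite !ltW.
have qd : `|t - ratr q| < d by rewrite ltr_norml; apply/andP; split; lra.
have := H1 _ _ qT' tT (lt_le_trans qd _) j; rewrite ge_min lexx => /(_ isT) h1.
have := H2 _ _ qT' tT (lt_le_trans qd _) j; rewrite ge_min lexx orbT => /(_ isT) h2.
have h := H q j qT'.
have -> : path_coord g j t - path_coord f j t =
  (path_coord g j t - path_coord g j (ratr q)) + (path_coord g j (ratr q) - path_coord f j (ratr q))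
  - (path_coord f j t - path_coord f j (ratr q)) by ring.
by apply: le_trans (ler_normB _ _) _; apply: le_trans (lerD (ler_normD _ _) (lexx _)) _; lra.
Qed.

(* Sampling at rational times makes this a countable intersection, and the boxes
   themselves are countably many. *)
Definition path_box (m p : nat) (q : seq (seq rat)) : set (path_space (R:=R) T n) :=
  [set g | forall (s : rat) j, 0 <= (ratr s : R) <= T ->
    `|path_coord g j (ratr s) - ratr (nth 0 (nth [::] q j) (Num.trunc (ratr s * m.+1%:R : R)))|
      <= p.+1%:R^-1].

Lemma path_box_nbhs (O : set (path_space (R:=R) T n)) f : open O -> O f ->
  exists m p q, path_box m p q f /\ path_box m p q `<=` O.
Proof.
move=> oO Of.
have /nbhs_path[e e0 eO] : nbhs f O by exact: open_nbhs_nbhs.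
(* At rational times [f] and [g] are both within [p.+1%:R^-1 < e / 8] of the centre of the box; a
   further [e / 8] covers all other times. *)
have [p Hp] := exists_natS_gt (8 / e).
have [ph phE] : exists ph : R, ph = p.+1%:R^-1 by exists p.+1%:R^-1.
have p0 : 0 < ph by rewrite phE invr_gt0.
have pe : ph < e / 8 by rewrite phE -[e / 8]invf_div ltf_pV2// posrE// divr_gt0.
have p20 : 0 < ph / 2 by rewrite divr_gt0.
have [delta d0 Hd] := path_uniformly_continuous f p20.
have [m Hm] := exists_natS_gt delta^-1.
have md : m.+1%:R^-1 < delta by rewrite -[delta]invrK ltf_pV2// posrE// invr_gt0.
have /choice[v Hv] (ji : 'I_n * nat) : exists v : rat,
    `|path_coord f ji.1 (ji.2%:R / m.+1%:R) - ratr v| <= ph / 2.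
  have : path_coord f ji.1 (ji.2%:R / m.+1%:R) - ph / 2 <
         path_coord f ji.1 (ji.2%:R / m.+1%:R) + ph / 2 by lra.
  move=> /rat_in_itvoo[v]; rewrite in_itv/= => /andP[v1 v2].
  by exists v; rewrite ler_norml; apply/andP; split; lra.
(* The successor includes the cell that contains [T] itself. *)
pose M := (Num.trunc (T * m.+1%:R)).+1.
exists m, p, [seq [seq v (j, i) | i <- iota 0 M] | j <- enum 'I_n].
have fB : path_box m p [seq [seq v (j, i) | i <- iota 0 M] | j <- enum 'I_n] f.
  move=> s j sT; rewrite -phE (nth_map j) ?size_enum_ord// nth_ord_enum.
  have /andP[s0 sT'] := sT; have m0 : 0 < m.+1%:R :> R by [].
  have sm0 : 0 <= ratr s * m.+1%:R :> R by rewrite mulr_ge0.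
  have iM : (Num.trunc (ratr s * m.+1%:R : R) < M)%N.
    by rewrite ltnS; apply: le_truncn; rewrite ler_pM2r.
  rewrite (nth_map 0%N) ?size_iota// nth_iota// add0n.
  set i := Num.trunc _.
  have /andP[i1 i2] := truncn_itv sm0; rewrite -/i in i1 i2.
  have h1 : i%:R / m.+1%:R <= ratr s :> R by rewrite ler_pdivrMr.
  have iT : 0 <= (i%:R / m.+1%:R : R) <= T.
    by rewrite (le_trans h1)// andbT; apply: divr_ge0.
  have /Hd : `|ratr s - i%:R / m.+1%:R| < delta.
    rewrite ger0_norm ?subr_ge0//; apply: le_lt_trans md.
    by rewrite lerBlDl -[X in _ + X]mul1r -mulrDl natr1 ler_pdivlMr// ltW.
  move=> /(_ iT sT j) h2; have h3 := Hv (j, i); rewrite /= in h3.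
  by apply: le_trans (ler_distD _ _ _) _; apply: le_trans (lerD h2 h3) _; lra.
split => // g gB; apply: eO.
have e80 : 0 < e / 8 by rewrite divr_gt0.
move=> t tT j; apply: le_lt_trans (@path_le_of_rat f g (e / 4) (e / 8) e80 _ t tT j) _; last by lra.
move=> s i sT; have := gB s i sT; have := fB s i sT; rewrite -phE.
set c := ratr (nth _ _ _) => h1 h2; apply: le_trans (ler_distD c _ _) _.
by rewrite (distrC c); lra.
Qed.

Lemma measurable_path_preimage d (Omega : measurableType d) (X : Omega -> path_space (R:=R) T n)
    (O : set (path_space T n)) :
  (forall t, 0 <= t <= T -> forall j, measurable_fun setT (fun w => path_coord (X w) j t)) ->
  open O -> measurable (X @^-1` O).
Proof.
move=> mX oO.
have -> : X @^-1` O = \bigcup_(mpq : nat * nat * seq (seq rat))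
    (if `[< path_box mpq.1.1 mpq.1.2 mpq.2 `<=` O >] then X @^-1` path_box mpq.1.1 mpq.1.2 mpq.2
     else set0).
  apply/seteqP; split => [w Ow|w [[[m p] q] _ /=]].
    have [m [p [q [Bw BO]]]] := path_box_nbhs oO Ow.
    by exists (m, p, q) => //=; case: ifPn => // /asboolPn.
  by case: ifPn => // /asboolP BO Bw; exact: BO.
apply: countable_bigcupT_measurable => [|[[m p] q] /=]; first exact: countableP.
case: ifPn => // _.
have -> : X @^-1` path_box m p q = \bigcap_(s : rat) \bigcap_(j in [set: 'I_n])
   [set w | 0 <= (ratr s : R) <= T -> `|path_coord (X w) j (ratr s) -
     ratr (nth 0 (nth [::] q j) (Num.trunc (ratr s * m.+1%:R : R)))| <= p.+1%:R^-1].
  by apply/seteqP; split => w Hw; [move=> s _ j _; exact: Hw|move=> s j; exact: (Hw s Logic.I j Logic.I)].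
rewrite -[X in measurable X]setCK setC_bigcap; apply: measurableC.
apply: bigcupT_measurable_rat => s; apply: measurableC.
apply: fin_bigcap_measurable; first exact: finite_finset.
move=> j _; have [sT|sT] := boolP (0 <= (ratr s : R) <= T); last first.
  by rewrite (_ : [set w | _] = setT)//; apply/seteqP; split => w //= _ /negP; rewrite sT.
set c := ratr (nth _ _ _).
have -> : [set w | true -> `|path_coord (X w) j (ratr s) - c| <= p.+1%:R^-1] =
    setT `&` (fun w => path_coord (X w) j (ratr s)) @^-1` `[c - p.+1%:R^-1, c + p.+1%:R^-1]%classic.
  by rewrite setTI; apply/seteqP; split => w; rewrite /= in_itv/= ler_distl => H; [exact: H|move=> _].
by apply: mX.
Qed.

End path_space_measurability.

(** * Stability and shadowing *)

Section barrier.
Context {R : realType}.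
Notation mu := (@lebesgue_measure R).

(* Induction on [s] in disguise: a first time at which some [psi i] vanishes would
   contradict the last hypothesis. *)
Lemma barrier (I : finType) (T : R) (psi : I -> R -> R) : 0 < T ->
  (forall i, continuous (psi i)) -> (forall i, psi i 0 < 0) ->
  (forall s, 0 < s <= T -> (forall t, 0 <= t <= s -> forall i, psi i t <= 0) ->
    forall i, psi i s < 0) ->
  forall t, 0 <= t <= T -> forall i, psi i t < 0.
Proof.
move=> T0 cpsi psi0 step.
pose S := [set s : R | 0 <= s <= T /\ forall t, 0 <= t <= s -> forall i, psi i t < 0].
have S0 : S 0.
  split; first by rewrite lexx ltW.
  by move=> t t0 i; rewrite (_ : t = 0)//; apply/le_anti; rewrite andbC.
have supS : has_sup S by split; [exists 0|exists T => s [/andP[]]].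
set c := sup S.
have c0 : 0 <= c by exact: sup_upper_bound S0.
have cT : c <= T by apply: ge_sup; [exists 0|move=> s [/andP[]]].
have below t : 0 <= t < c -> forall i, psi i t < 0.
  move=> /andP[t0 tc] i.
  have [s [_ Ss] ts] := sup_gt supS.1 tc.
  by apply: Ss; rewrite t0 ltW.
have le0 i : psi i c <= 0.
  have [c00|c00] := eqVneq c 0; first by rewrite c00; apply/ltW.
  have cpos : 0 < c by rewrite lt_neqAle eq_sym c00.
  rewrite leNgt; apply/negP => pc.
  have /nbhs_ballP[r /= r0 Hr] : \forall t \near c, 0 < psi i t by exact: (cvgr_gt _ (cpsi i c)).
  pose t := Num.max 0 (c - r / 2).
  have tc : t < c by rewrite gt_max cpos/=; lra.
  have t0 : 0 <= t by rewrite le_max lexx.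
  have : 0 < psi i t.
    apply: Hr; rewrite /ball/= ger0_norm ?subr_ge0 ?(ltW tc)//.
    by have : c - r / 2 <= t by [rewrite le_max lexx orbT]; lra.
  by rewrite ltNge ltW// below// t0.
have lec t : 0 <= t <= c -> forall i, psi i t <= 0.
  move=> /andP[t0]; rewrite le_eqVlt => /orP[/eqP->//|tc] i.
  by apply/ltW/below; rewrite t0.
have ltc i : psi i c < 0.
  have [->//|c00] := eqVneq c 0.
  by apply: step => //; rewrite cT lt_neqAle eq_sym c00 c0.
have [r r0 Hr] : exists2 r : R, 0 < r & forall t, `|c - t| < r -> forall i, psi i t < 0.
  have H i : \forall t \near c, psi i t < 0 by exact: (cvgr_lt _ (cpsi i c)).
  have /nbhs_ballP[r /= r0 Hr] := @filter_forall _ _ _ (nbhs c) (nbhs_filter c) H.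
  by exists r.
have Tc : c = T.
  apply/le_anti; rewrite cT/= leNgt; apply/negP => ltcT.
  pose s := Num.min T (c + r / 2).
  have cs : c < s by rewrite lt_min ltcT/=; lra.
  have : S s.
    split; first by rewrite (le_trans c0 (ltW cs)) ge_min lexx.
    move=> t /andP[t0 ts]; have [tc|ct] := ltP t c; first by apply: below; rewrite t0.
    apply: Hr; rewrite ler0_norm ?subr_le0// opprB.
    by have : s <= c + r / 2 by [rewrite ge_min lexx orbT]; lra.
  by move/(sup_upper_bound supS); rewrite leNgt cs.
move=> t /andP[t0]; rewrite -Tc le_eqVlt => /orP[/eqP->//|tc].
by apply: below; rewrite t0.
Qed.

Lemma continuous_expR_scaled (a L : R) : continuous (fun t => a * expR (L * t)).
Proof.
move=> t; apply: cvgM; first exact: cvg_cst.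
apply: continuous_comp; last exact: continuous_expR.
by apply: cvgM; [exact: cvg_cst|exact: cvg_id].
Qed.

Lemma Rintegral_expR (a L s : R) : 0 < s ->
  \int[mu]_(r in `[0, s]) (a * L * expR (L * r)) = a * expR (L * s) - a.
Proof.
move=> s0; pose F r := a * expR (L * r).
have dF (r : R) : is_derive r 1 F (a * L * expR (L * r)).
  have d1 : is_derive r (1 : R) (fun t => L * t) L.
    by rewrite -[X in is_derive _ _ _ X]mulr1; exact: is_deriveZ.
  by rewrite -mulrA; apply: is_deriveZ; rewrite mulrC; apply: is_derive1_comp.
have cF : continuous F by exact: continuous_expR_scaled.
rewrite /Rintegral (@continuous_FTC2 R _ F)//.
- by rewrite /F mulr0 expR0 mulr1.
- exact/continuous_subspaceT/continuous_expR_scaled.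
- split.
  + by move=> r _; have [] := dF r.
  + exact: cvg_at_right_filter (cF 0).
  + exact: cvg_at_left_filter (cF s).
- by move=> r _; rewrite derive1E; exact: (@derive_val _ _ _ _ _ _ _ (dF r)).
Qed.

End barrier.

Section noise_stability.
Context {R : realType} (T : R) (n : nat).
Hypothesis T0 : 0 < T.
Implicit Types f h : path_space (R:=R) T n.

Lemma noise0 (u : 'I_n -> R -> R) j : noise u j 0 = u j 0.
Proof. by rewrite /noise set_itv1 Rintegral_set1 subr0. Qed.

(* The barrier for [`|h - f|] is [a * expR (L * t)]: below it the gap of [h] is at least
   [g / 2], so that the drift is [L]-Lipschitz. *)
Lemma noise_stability f (e : R) : 0 < e -> exists2 delta : R, 0 < delta &
  forall h, (forall t, 0 <= t <= T -> forall j,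
    `|noise (path_coord h) j t - noise (path_coord f) j t| <= delta) -> path_near f e h.
Proof.
move=> e0; have [g g0 gf] := path_gapped T0 f.
pose L : R := repulsion_lip n (g / 2).
have L0 : 0 <= L by exact: repulsion_lip_ge0.
pose e' := Num.min e (g / 4).
have e'0 : 0 < e' by rewrite lt_min e0 divr_gt0.
have e'e : e' <= e by rewrite ge_min lexx.
have e'g : e' <= g / 4 by rewrite ge_min lexx orbT.
clearbody e'.
have g20 : 0 < g / 2 by rewrite divr_gt0.
(* Scaled so that the barrier stays below [e'] up to time [T]. *)
pose a := e' * expR (- (L * T)).
have a0 : 0 < a by rewrite mulr_gt0 ?expR_gt0.
have ae t : t <= T -> a * expR (L * t) <= e'.
  move=> tT; rewrite /a -mulrA -expRD ler_piMr ?(ltW e'0)// -expR0 ler_expR addrC subr_le0.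
  exact: ler_wpM2l.
(* The half makes the inequality at the barrier strict: [a / 2 + (a * expR (L * s) - a) < a * expR
   (L * s)]. *)
exists (a / 2) => [|h Hh]; first by rewrite divr_gt0.
have cf := @path_coord_continuous _ _ _ f (ltW T0).
have ch := @path_coord_continuous _ _ _ h (ltW T0).
pose psi j t := `|path_coord h j (clamp 0 T t) - path_coord f j (clamp 0 T t)| - a * expR (L * t).
suff H : forall t, 0 <= t <= T -> forall j, psi j t < 0.
  move=> t tT j; have := H t tT j; rewrite /psi clamp_id// subr_lt0 => /lt_le_trans; apply.
  by apply: le_trans e'e; apply: ae; case/andP: tT.
apply: barrier => //.
- move=> j t; apply: cvgB.
    by apply: cvg_norm; apply: cvgB; [exact: ch|exact: cf].
  exact: continuous_expR_scaled.
- move=> j; have T00 : 0 <= (0 : R) <= T by rewrite lexx ltW.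
  have := Hh 0 T00 j; rewrite /psi !noise0 clamp_id// mulr0 expR0 mulr1; lra.
move=> s /andP[s0 sT] Hs j.
have sT' : 0 <= s <= T by rewrite ltW.
have Hs' t : 0 <= t <= s -> forall i, `|path_coord h i t - path_coord f i t| <= a * expR (L * t).
  move=> ts i; have := Hs t ts i; rewrite /psi clamp_id ?subr_le0//.
  by case/andP: ts => -> /= /le_trans; apply.
pose r h' := @clamped_repulsion R n T (path_coord h') j.
have crh : continuous (r h) by exact: (@continuous_clamped_repulsion R n T _ T0 ch (@path_coord_neq _ _ _ h) j).
have crf : continuous (r f) by exact: (@continuous_clamped_repulsion R n T _ T0 cf (@path_coord_neq _ _ _ f) j).
have cd : continuous (r h \- r f) by move=> t; apply: cvgB; [exact: crh|exact: crf].
have : `|\int[lebesgue_measure]_(t in `[0, s]) (r h \- r f) t| <= a * expR (L * s) - a.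
  rewrite -(Rintegral_expR _ _ s0); apply: normr_Rintegral_le => //.
  - exact: ltW.
  - exact: continuous_expR_scaled.
  move=> t ts; have tT : 0 <= t <= T by case/andP: ts => -> /= /le_trans; apply.
  rewrite /r /= !clamped_repulsionE// mulrAC mulrC; apply: repulsion_dist => //.
  - by move=> k l kl; apply: le_trans (gf t tT k l kl); lra.
  - have ht i : `|path_coord h i t - path_coord f i t| <= e'.
      by apply: le_trans (Hs' t ts i) _; apply: ae; case/andP: tT.
    by move=> k l kl; apply: le_trans (gapped_near (gf t tT) ht kl); lra.
  - exact: Hs'.
rewrite RintegralB//; [|exact: continuous_integrable..].
rewrite /r !Rintegral_clamped_repulsion//.
have := Hh s sT' j; rewrite /psi clamp_id// /noise.
set A := Rintegral _ _ _; set B := Rintegral _ _ _.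
set u := path_coord h j s; set v := path_coord f j s => h1 h2.
rewrite subr_lt0 (_ : u - v = (u - A - (v - B)) + (A - B)); last by ring.
apply: le_lt_trans (ler_normD _ _) _.
apply: le_lt_trans (lerD h1 h2) _.
by move: (a * expR _) => z; lra.
Qed.

End noise_stability.

(** * Piecewise linear interpolation over a mesh *)

Section interpolation.
Context {R : realType}.
Notation mu := (@lebesgue_measure R).

(** Sorting the intervals is avoided: the images []c (u i), c (v i)[] are disjoint inside
    [[c a, c b]], and Lebesgue measure adds up their lengths. *)
Lemma disjoint_increments (c : R -> R) (a b : R) (m : nat) (u v : 'I_m -> R) :
  {homo c : s t / s <= t} -> a <= b ->
  (forall i, [/\ a <= u i, u i < v i & v i <= b]) ->
  trivIset [set: 'I_m] (fun i => `]u i, v i[%classic) ->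
  \sum_(i < m) (c (v i) - c (u i)) <= c b - c a.
Proof.
move=> hc ab uv tuv.
pose F i := `]c (u i), c (v i)[%classic.
have len (y z : R) : y <= z -> mu `]y, z[ = (z - y)%:E.
  rewrite le_eqVlt lebesgue_measure_itv/= lte_fin => /orP[/eqP->|->]; last by rewrite EFinB.
  by rewrite ltxx subrr.
have tF : trivIset [set: 'I_m] F.
  move=> i j _ _ [y [/=]]; rewrite /F /= !in_itv/= => /andP[y1 y2] /andP[y3 y4].
  have [//|/eqP ij] := eqVneq i j.
  have /trivIsetP/(_ i j Logic.I Logic.I) := tuv.
  move=> /(_ (introN eqP ij)) /open_itv_apart; have [_ -> _] := uv i; have [_ -> _] := uv j.
  by move=> /(_ isT isT)/orP[/= /hc|/= /hc] ?; exfalso; lra.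
have := @measure_fin_bigcup _ _ _ mu _ [set: 'I_m] F finite_finset tF _.
have E : [set: 'I_m] = [set` index_enum 'I_m].
  by apply/seteqP; split => // i _; exact: mem_index_enum.
rewrite [in X in _ = X]E -fsbig_seq ?index_enum_uniq// => H.
rewrite -lee_fin -sumEFin (eq_bigr (fun i => mu (F i))); last first.
  by move=> i _; rewrite /F len//; apply: hc; have [_ /ltW] := uv i.
rewrite -H//; last by move=> i _; exact: measurable_itv.
apply: (@le_trans _ _ (mu `[c a, c b])).
  rewrite le_measure ?inE//; first by apply: fin_bigcup_measurable; [exact: finite_finset|move=> i _; exact: measurable_itv].
  move=> y [i _]; rewrite /F /= !in_itv/= => /andP[y1 y2]; have [h1 _ h2] := uv i.
  by rewrite (le_trans (hc _ _ h1) (ltW y1)) (le_trans (ltW y2) (hc _ _ h2)).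
rewrite lebesgue_measure_itv/= lte_fin; case: ltP => [_|h]; first by rewrite EFinB.
by rewrite lee_fin subr_ge0 hc.
Qed.

(* Both sides are the length of the overlap of [[a, b]] and [[p, q]]. *)
Lemma clamp_overlap (a b p q : R) : a <= b -> p <= q ->
  clamp a b q - clamp a b p = clamp p q b - clamp p q a.
Proof.
move=> ab pq; rewrite /clamp.
have /orP[bp|pb] := le_total b p.
  rewrite (min_idPr bp) (min_idPr (le_trans bp pq)) (min_idPl (le_trans bp pq)).
  by rewrite (min_idPl (le_trans ab (le_trans bp pq))) (max_idPl bp) (max_idPl (le_trans ab bp)) !subrr.
have /orP[qa|aq] := le_total q a.
  rewrite (min_idPl (le_trans qa ab)) (min_idPl pb) (min_idPr (le_trans qa ab)) (min_idPr qa).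
  by rewrite (max_idPl qa) (max_idPl (le_trans pq qa)) !subrr.
rewrite (min_idPl pb) (min_idPl aq) (minC b q) (maxC p a).
have m1 : a <= Num.min q b by rewrite le_min aq ab.
have m2 : p <= Num.min q b by rewrite le_min pb pq.
by rewrite (max_r m1) (max_r m2).
Qed.

Lemma mesh_cell (h : R) (m : nat) (t : R) : 0 < h -> (0 < m)%N -> 0 <= t <= m%:R * h ->
  exists k : 'I_m, k%:R * h <= t <= k.+1%:R * h.
Proof.
move=> h0 m0 /andP[t0 tm].
pose k := Num.trunc (t / h).
have /andP[k1 k2] := truncn_itv (divr_ge0 t0 (ltW h0)).
rewrite -/k ler_pdivlMr// in k1; rewrite -/k ltr_pdivrMr// in k2.
(* At [t = m%:R * h] the truncation gives [m], and the last cell is taken. *)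
have [km|mk] := ltnP k m; first by exists (Ordinal km); rewrite /= k1 ltW.
have mp : (m.-1 < m)%N by rewrite prednK.
exists (Ordinal mp); rewrite /= prednK// tm andbT; apply: le_trans k1.
by rewrite ler_pM2r// ler_nat (leq_trans (leq_pred m)).
Qed.

Variables (n m : nat) (h : R).
Hypothesis h0 : 0 < h.

(** The piecewise linear path with increments [D] over the mesh. Written as a sum of clamped ramps,
    its increment over any interval is a sum of slopes times overlaps, with no case analysis on
    cells. *)
Definition interpolation (y : 'I_n -> R) (D : 'I_n -> 'I_m -> R) (j : 'I_n) (t : R) : R :=
  y j + \sum_(i < m) D j i / h * (clamp (i%:R * h) (i.+1%:R * h) t - i%:R * h).

Lemma mesh_le (i : nat) : i%:R * h <= i.+1%:R * h.
Proof. by rewrite ler_pM2r// ler_nat. Qed.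

(** The ramps before cell [k] are saturated and telescope; those after it vanish. *)
Lemma interpolationE y (w : 'I_n -> R -> R) j (k : 'I_m) t :
  k%:R * h <= t <= k.+1%:R * h ->
  interpolation y (fun j i => w j (i.+1%:R * h) - w j (i%:R * h)) j t =
    y j + (w j (k%:R * h) - w j 0) +
      (w j (k.+1%:R * h) - w j (k%:R * h)) / h * (t - k%:R * h).
Proof.
move=> /andP[kt tk]; rewrite /interpolation -addrA; congr (_ + _).
rewrite (bigD1 k)//= clamp_id ?kt// addrC; congr (_ + _).
rewrite (eq_bigr (fun i : 'I_m => if (i < k)%N then w j (i.+1%:R * h) - w j (i%:R * h) else 0)); last first.
  move=> i ik; case: ifPn => [ltik|]; last first.
    rewrite -leqNgt leq_eqVlt val_eqE eq_sym (negbTE ik)/= => ki.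
    have it : t <= i%:R * h by apply: le_trans tk _; rewrite ler_pM2r// ler_nat.
    have -> : clamp (i%:R * h) (i.+1%:R * h) t = i%:R * h.
      by rewrite /clamp (min_idPl (le_trans it (mesh_le i))) (max_idPl it).
    by rewrite subrr mulr0.
  have it : i.+1%:R * h <= t by apply: le_trans kt; rewrite ler_pM2r// ler_nat.
  have -> : clamp (i%:R * h) (i.+1%:R * h) t = i.+1%:R * h.
    by rewrite /clamp (min_idPr it) (max_idPr (mesh_le i)).
  by rewrite -mulrBl -natrB// subSnn mul1r divfK ?gt_eqF.
rewrite -big_mkcondr/= (eq_bigl (fun i : 'I_m => (i < k)%N)); last first.
  by move=> i; rewrite andbC; case: ltnP => //= ik; rewrite -val_eqE ltn_eqF.
rewrite -(big_mkord (fun i => (i < k)%N) (fun i => w j (i.+1%:R * h) - w j (i%:R * h))).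
rewrite -(big_nat_widen 0 k m xpredT); last exact: ltnW.
by rewrite (telescope_sumr (fun i => w j (i%:R * h)))// mul0r.
Qed.

(** Weight the slopes [D j i / h] by the overlap [l i z] of cell [i] with interval [z]. Jensen
    bounds the energy over interval [z] by the weighted sum of squared slopes, and the overlaps
    inside one cell add up to at most [h]. *)
Lemma interpolation_energy y (D : 'I_n -> 'I_m -> R) :
  energy_le 0 (m%:R * h) (interpolation y D) (\sum_(j < n) \sum_(i < m) D j i ^+ 2 / h).
Proof.
move=> r p q pq tpq.
pose l (i : 'I_m) (z : 'I_r) :=
  clamp (i%:R * h) (i.+1%:R * h) (q z) - clamp (i%:R * h) (i.+1%:R * h) (p z).
have mh0 : 0 <= m%:R * h by rewrite mulr_ge0// ltW.
have l0 i z : 0 <= l i z.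
  by rewrite subr_ge0; apply: clamp_le; have [_ /ltW] := pq z.
have lpq z : \sum_(i < m) l i z <= q z - p z.
  have [_ ltpq _] := pq z.
  rewrite (eq_bigr (fun i : 'I_m => clamp (p z) (q z) (i.+1%:R * h) - clamp (p z) (q z) (i%:R * h))); last first.
    by move=> i _; rewrite /l clamp_overlap ?(ltW ltpq)// mesh_le.
  rewrite -(big_mkord xpredT (fun i => clamp (p z) (q z) (i.+1%:R * h) - clamp (p z) (q z) (i%:R * h))).
  rewrite (telescope_sumr (fun i => clamp (p z) (q z) (i%:R * h)))//.
  have /andP[_ h1] := clamp_itv (m%:R * h) (ltW ltpq).
  have /andP[h2 _] := clamp_itv (0%:R * h) (ltW ltpq).
  lra.
have lh i : \sum_(z < r) l i z <= h.
  apply: le_trans (disjoint_increments (clamp_le (i%:R * h) (i.+1%:R * h)) mh0 pq tpq) _.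
  have /andP[_ h1] := clamp_itv (m%:R * h) (mesh_le i).
  have /andP[h2 _] := clamp_itv 0 (mesh_le i).
  have h3 : i.+1%:R * h = i%:R * h + h by rewrite -natr1 mulrDl mul1r.
  by rewrite h3 in h1 h2 *; lra.
have vE j z : interpolation y D j (q z) - interpolation y D j (p z) = \sum_(i < m) D j i / h * l i z.
  rewrite /interpolation opprD addrACA subrr add0r -sumrB.
  by apply: eq_bigr => i _; rewrite -mulrBr /l; congr (_ * _); ring.
have CS j z : (\sum_(i < m) D j i / h * l i z) ^+ 2 / (q z - p z) <= \sum_(i < m) (D j i / h) ^+ 2 * l i z.
  have [_ ltpq _] := pq z; have d0 : 0 < q z - p z by rewrite subr_gt0.
  set A := \sum_i _; pose c := A / (q z - p z).
  apply: (@le_trans _ _ (\sum_(i < m) (2 * c * (D j i / h * l i z) - c ^+ 2 * l i z))).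
    rewrite sumrB -!mulr_sumr -/A.
    have -> : A ^+ 2 / (q z - p z) = 2 * c * A - c ^+ 2 * (q z - p z).
      by rewrite /c; field; rewrite gt_eqF.
    by rewrite lerD2l lerN2 ler_wpM2l// sqr_ge0.
  apply: ler_sum => i _; rewrite -subr_ge0.
  rewrite (_ : _ - _ = (D j i / h - c) ^+ 2 * l i z); last by ring.
  by rewrite mulr_ge0// sqr_ge0.
apply: (@le_trans _ _ (\sum_(z < r) \sum_(j < n) \sum_(i < m) (D j i / h) ^+ 2 * l i z)).
  by apply: ler_sum => z _; apply: ler_sum => j _; rewrite vE.
rewrite exchange_big/=; apply: ler_sum => j _.
rewrite exchange_big/=; apply: ler_sum => i _.
rewrite -mulr_sumr; apply: le_trans (ler_wpM2l (sqr_ge0 _) (lh i)) _.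
by rewrite (_ : _ * h = D j i ^+ 2 / h)//; field; rewrite gt_eqF.
Qed.

End interpolation.

(** * Paths of small rate close to a given path *)

Section shadowing.
Context {R : realType} (n : nat).

Lemma energy_le_restrict (a b c K : R) (phi : 'I_n -> R -> R) : c <= b ->
  energy_le a b phi K -> energy_le a c phi K.
Proof.
move=> cb H m u v uv; apply: H => i; have [h1 h2 h3] := uv i.
by split => //; exact: le_trans cb.
Qed.

(** On each interval [A ^+ 2 <= (1 + th) * B ^+ 2 + (1 + th^-1) * (A - B) ^+ 2]. A small [th] barely
    raises the energy of [v], and a still smaller [eta] pays for [th^-1]. *)
Lemma energy_le_perturb (s K th eta : R) (phi v : 'I_n -> R -> R) : 0 <= s -> 0 < th ->
  energy_le 0 s v K ->
  (forall j p q, 0 <= p -> p <= q -> q <= s ->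
    `|phi j q - phi j p - (v j q - v j p)| <= eta * (q - p)) ->
  energy_le 0 s phi ((1 + th) * K + (1 + th^-1) * (n%:R * eta ^+ 2 * s)).
Proof.
move=> s0 th0 vK H m p q pq tpq.
have ti0 : 0 < th^-1 by rewrite invr_gt0.
have S1 := vK _ _ _ pq tpq.
have S2 : \sum_(i < m) (q i - p i) <= s.
  by have := disjoint_increments (fun _ _ => id) s0 pq tpq; rewrite subr0.
apply: (@le_trans _ _ (\sum_(i < m) \sum_(j < n) ((1 + th) * ((v j (q i) - v j (p i)) ^+ 2 / (q i - p i)) +
    (1 + th^-1) * (eta ^+ 2 * (q i - p i))))).
  apply: ler_sum => i _; apply: ler_sum => j _.
  have [p0 lpq qs] := pq i; have d0 : 0 < q i - p i by rewrite subr_gt0.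
  have := H j _ _ p0 (ltW lpq) qs.
  set A := phi j (q i) - _; set B := v j (q i) - _; set d := q i - p i in d0 *.
  move=> Hd; have Hd2 : (A - B) ^+ 2 <= (eta * d) ^+ 2.
    rewrite -[leLHS]real_normK ?num_real// ler_pXn2r ?nnegrE//.
    exact: le_trans Hd.
  rewrite ler_pdivrMr// mulrDl -!mulrA mulVf ?gt_eqF// mulr1.
  have E : (1 + th) * B ^+ 2 + (1 + th^-1) * (A - B) ^+ 2 - A ^+ 2 = th^-1 * ((A - B) - th * B) ^+ 2.
    by field; rewrite gt_eqF.
  have : 0 <= (1 + th) * B ^+ 2 + (1 + th^-1) * (A - B) ^+ 2 - A ^+ 2.
    by rewrite E mulr_ge0 ?sqr_ge0// ltW.
  have : (1 + th^-1) * (A - B) ^+ 2 <= (1 + th^-1) * (eta * d) ^+ 2 by rewrite ler_wpM2l//; lra.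
  by rewrite (_ : eta * (eta * (d * d)) = (eta * d) ^+ 2); [rewrite -(expr2 B); lra|ring].
under eq_bigr do rewrite big_split/= -mulr_sumr sumr_const card_ord.
rewrite big_split/= -mulr_sumr.
apply: lerD; first by rewrite ler_wpM2l//; lra.
rewrite (eq_bigr (fun i => (1 + th^-1) * (n%:R * eta ^+ 2) * (q i - p i))); last first.
  by move=> i _; rewrite -[LHS]mulr_natl; ring.
rewrite -mulr_sumr [leRHS]mulrA; apply: ler_wpM2l => //.
by rewrite mulr_ge0 ?addr_ge0 ?(ltW ti0)// mulr_ge0// sqr_ge0.
Qed.

Lemma gapped_exists (y : 'I_n -> R) : (forall k l, k != l -> y k != y l) ->
  exists2 g : R, 0 < g & gapped g y.
Proof.
move=> yi; pose G (kl : 'I_n * 'I_n) := if kl.1 == kl.2 then 1 else `|y kl.1 - y kl.2|.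
exists (\big[Num.min/1]_kl G kl).
  elim/big_ind: _ => // [a b a0 b0|[k l] _]; first by rewrite lt_min a0.
  rewrite /G/=; case: eqVneq => // kl.
  by rewrite normr_gt0 subr_eq0 yi.
move=> k l kl; apply: (@le_trans _ _ (G (k, l))); first exact: bigmin_le_cond.
by rewrite /G/= (negbTE kl).
Qed.

Lemma continuous_clamp_itv (a b c : R) (h : R -> R) : a <= c -> c <= b ->
  continuous (h \o clamp a b) -> continuous (h \o clamp a c).
Proof.
move=> ac cb ch.
have -> : h \o clamp a c = (h \o clamp a b) \o clamp a c.
  apply/funext => t /=; rewrite (@clamp_id _ a b)//.
  by have /andP[-> /le_trans->] := clamp_itv t ac.
have cc : continuous (id \o clamp a c : R -> R).
  by apply: continuous_clamp => // e e0; exists e => // u v _ _ /ltW.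
by move=> t; apply: continuous_comp; [exact: cc|exact: ch].
Qed.

Variables (T : R).
Hypothesis T0 : 0 < T.
Implicit Types f : path_space (R:=R) T n.

(* The second summand is the integral of the drift of [f], not of the shadow: no
   equation has to be solved. *)
Definition shadow f (v : 'I_n -> R -> R) (j : 'I_n) (t : R) : R :=
  v j t + (path_coord f j t - noise (path_coord f) j t).

(** The noise of the shadow differs from [v] by the integral of a difference of two drifts, which is
    of order [delta] thanks to the gap. The horizon [s] is free because the gap of [f] is at first
    known on initial intervals only. *)
Lemma shadow_energy f v (s g delta K th : R) : 0 < s -> s <= T -> 0 < g -> 0 < th ->
  (forall t, 0 <= t <= s -> gapped g ((path_coord f)^~ t)) ->
  (forall t, 0 <= t <= s -> forall j, `|v j t - noise (path_coord f) j t| <= delta) ->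
  delta <= g / 4 -> energy_le 0 s v K ->
  [/\ forall j, absolutely_continuous_on 0 s (shadow f v j),
      forall t, 0 <= t <= s -> gapped (g / 2) ((shadow f v)^~ t) &
      energy_le 0 s (noise (shadow f v))
        ((1 + th) * K + (1 + th^-1) * (n%:R * (repulsion_lip n (g / 2) * delta) ^+ 2 * s))].
Proof.
move=> s0 sT g0 th0 gf vf dg vK.
have cf j : continuous (path_coord f j \o clamp 0 s).
  by apply: (continuous_clamp_itv (ltW s0) sT); apply: path_coord_continuous; exact: ltW.
have fi t : 0 <= t <= s -> forall k l, k != l -> path_coord f k t != path_coord f l t.
  by move=> ts k l kl; apply: (gapped_neq g0 (gf t ts)).
have sfE j t : shadow f v j t = v j t + \int[lebesgue_measure]_(r in `[0, t]) repulsion ((path_coord f)^~ r) j.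
  by rewrite /shadow /noise; ring.
have acs j : absolutely_continuous_on 0 s (shadow f v j).
  have := absolutely_continuousD (absolutely_continuous_of_energy j vK)
    (@absolutely_continuous_repulsion R n s (path_coord f) s0 cf fi j).
  by congr absolutely_continuous_on; apply/funext => t; rewrite sfE.
have sf t : 0 <= t <= s -> forall k, `|shadow f v k t - path_coord f k t| <= delta.
  move=> ts k; have := vf t ts k; rewrite /shadow.
  by rewrite (_ : v k t + _ - _ = v k t - noise (path_coord f) k t)//; ring.
have g20 : 0 < g / 2 by rewrite divr_gt0.
have gs t : 0 <= t <= s -> gapped (g / 2) ((shadow f v)^~ t).
  by move=> ts k l kl; apply: le_trans (gapped_near (gf t ts) (sf t ts) kl); lra.
split => //; apply: (@energy_le_perturb s K th _ _ v (ltW s0) th0 vK).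
have cs j := absolutely_continuous_continuous (ltW s0) (acs j).
have si t (ts : 0 <= t <= s) := gapped_neq g20 (gs t ts).
have gf2 t : 0 <= t <= s -> gapped (g / 2) ((path_coord f)^~ t).
  by move=> ts k l kl; apply: le_trans (gf t ts k l kl); lra.
move=> j p q p0 pq qs.
have := int_repulsion_dist s0 g20 cf cs gf2 gs sf j p0 pq qs.
have crf := @continuous_clamped_repulsion R n s (path_coord f) s0 cf fi j.
have crs := @continuous_clamped_repulsion R n s (shadow f v) s0 cs si j.
pose J (w : 'I_n -> R -> R) t := \int[lebesgue_measure]_(r in `[0, t]) repulsion (w^~ r) j.
have Jf t : t <= s -> \int[lebesgue_measure]_(r in `[0, t]) clamped_repulsion s (path_coord f) j r =
    J (path_coord f) t by exact: Rintegral_clamped_repulsion.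
have Js t : t <= s -> \int[lebesgue_measure]_(r in `[0, t]) clamped_repulsion s (shadow f v) j r =
    J (shadow f v) t by exact: Rintegral_clamped_repulsion.
have ps : p <= s by exact: le_trans qs.
rewrite -(Rintegral_diff crs p0 pq) -(Rintegral_diff crf p0 pq) (Js q qs) (Js p ps) (Jf q qs) (Jf p ps).
have nE t : noise (shadow f v) j t = v j t + J (path_coord f) t - J (shadow f v) t.
  by rewrite [LHS]/noise sfE.
rewrite !nE; move: (J _ q) (J _ p) (J (shadow f v) q) (J (shadow f v) p) => A B A' B'.
rewrite distrC => H; apply: le_trans H.
by rewrite le_eqVlt; apply/orP; left; apply/eqP; congr (`| _ |); ring.
Qed.

Variable x : 'rV[R]_n.
Hypothesis xch : chamber n x.

(* The gap of [f] is not known in advance.  As long as it is at least [ga / 2], the shadow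
   has rate at most [alpha'], so its gap and then that of [f] exceed [ga / 2]. *)
Lemma path_shadowing (alpha alpha' e : R) : 0 <= alpha -> alpha < alpha' -> 0 < e ->
  exists2 delta : R, 0 < delta & forall f v,
    (forall j, path_coord f j 0 = x 0 j) -> (forall j, v j 0 = x 0 j) ->
    energy_le 0 T v (2 * alpha) ->
    (forall t, 0 <= t <= T -> forall j, `|v j t - noise (path_coord f) j t| <= delta) ->
    exists2 u, (dyson_rate x u <= alpha'%:E)%E & path_near u e f.
Proof.
move=> al0 alal e0.
have xi k l : k != l -> x 0 k != x 0 l.
  by rewrite neq_ltn => /orP[kl|lk]; [rewrite lt_eqF// xch|rewrite gt_eqF// xch].
have [g2 g20 Hg2] := @gap_bound R n (x 0) T (2 * alpha') xi.
have [gx gx0 Hgx] := gapped_exists xi.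
pose ga := Num.min g2 gx.
have ga0 : 0 < ga by rewrite lt_min g20.
have ga1 : ga <= g2 by rewrite ge_min lexx.
have ga2 : ga <= gx by rewrite ge_min lexx orbT.
clearbody ga.
have g0 : 0 < ga / 2 by rewrite divr_gt0.
(* The energy may grow by [2 * (alpha' - alpha)]: one half is spent on [th], the other on the drift
   error. *)
pose th := (alpha' - alpha) / (2 * alpha + 1).
have th0 : 0 < th by rewrite divr_gt0 ?subr_gt0// ltr_wpDl// mulr_ge0.
have thE : th * (2 * alpha) <= alpha' - alpha.
  rewrite /th mulrAC ler_pdivrMr ?ltr_wpDl ?mulr_ge0// ler_wpM2l ?subr_ge0 ?(ltW alal)//; lra.
clearbody th.
(* The shadow keeps half of the gap [ga / 2] of [f]. *)
pose L : R := repulsion_lip n (ga / 2 / 2).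
have L0 : 0 <= L by exact: repulsion_lip_ge0.
pose C := (1 + th^-1) * (n%:R * L ^+ 2 * T) + 1.
have C0 : 0 < C.
  rewrite ltr_wpDl// mulr_ge0 ?addr_ge0 ?invr_ge0 ?(ltW th0)//.
  by rewrite mulr_ge0 ?(ltW T0)// mulr_ge0// sqr_ge0.
pose d1 := Num.min 1 ((alpha' - alpha) / C).
have d10 : 0 < d1 by rewrite lt_min ltr01 divr_gt0// subr_gt0.
pose delta := Num.min d1 (Num.min (ga / 8) (e / 2)).
have delta0 : 0 < delta by rewrite lt_min d10 lt_min !divr_gt0.
have dd1 : delta <= d1 by rewrite ge_min lexx.
have dga : delta <= ga / 8 by rewrite !ge_min lexx/= orbT.
have de : delta <= e / 2 by rewrite !ge_min lexx !orbT.
have d11 : delta <= 1 by apply: le_trans dd1 _; rewrite ge_min lexx.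
have dC : delta * C <= alpha' - alpha.
  by rewrite -ler_pdivlMr//; apply: le_trans dd1 _; rewrite ge_min lexx orbT.
clearbody delta.
have dg : delta <= ga / 2 / 4 by lra.
have Kle s : 0 < s -> s <= T ->
    (1 + th) * (2 * alpha) + (1 + th^-1) * (n%:R * (L * delta) ^+ 2 * s) <= 2 * alpha'.
  move=> s0 sT.
  have h1 : (1 + th^-1) * (n%:R * (L * delta) ^+ 2 * s) <= (1 + th^-1) * (n%:R * L ^+ 2 * T) * delta.
    rewrite -[leRHS]mulrA; apply: ler_wpM2l; first by rewrite addr_ge0// invr_ge0 ltW.
    rewrite (_ : n%:R * (L * delta) ^+ 2 * s = n%:R * L ^+ 2 * (delta ^+ 2 * s)); last by ring.
    rewrite -[leRHS]mulrA; apply: ler_wpM2l; first by rewrite mulr_ge0// sqr_ge0.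
    by rewrite (mulrC T) ler_pM ?sqr_ge0 ?(ltW s0)// expr2 ler_piMr// ltW.
  have h2 : (1 + th^-1) * (n%:R * L ^+ 2 * T) * delta <= delta * C.
    by rewrite mulrC ler_wpM2l ?(ltW delta0)// /C lerDl.
  lra.
exists delta => // f v fx vx vK vf.
have fE (j : 'I_n) : path_coord f j 0 = x 0 j by [].
have gf : forall t, 0 <= t <= T -> gapped (ga / 2) ((path_coord f)^~ t).
  pose psi (kl : 'I_n * 'I_n) t :=
    if kl.1 == kl.2 then -1 else ga / 2 - `|path_coord f kl.1 (clamp 0 T t) - path_coord f kl.2 (clamp 0 T t)|.
  have H : forall t, 0 <= t <= T -> forall kl, psi kl t < 0.
    apply: barrier => //.
    - move=> [k l]; rewrite /psi/=; case: eqP => _; first exact: cst_continuous.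
      move=> t; apply: cvgB; first exact: cvg_cst.
      by apply: cvg_norm; apply: cvgB; apply: path_coord_continuous; exact: ltW.
    - move=> [k l]; rewrite /psi/=; case: eqVneq => [_|kl]; first by rewrite ltrN10.
      by rewrite clamp_id ?lexx ?(ltW T0)// !fE; have := Hgx k l kl; lra.
    move=> s /andP[s0 sT] Hs [k l]; rewrite /psi/=; case: eqVneq => [_|kl]; first by rewrite ltrN10.
    have tsT t : 0 <= t <= s -> 0 <= t <= T by case/andP => -> /= /le_trans; apply.
    have gs t : 0 <= t <= s -> gapped (ga / 2) ((path_coord f)^~ t).
      move=> ts k' l' kl'; have := Hs t ts (k', l').
      by rewrite /psi/= (negbTE kl') subr_le0 clamp_id// tsT.
    have [acs gsh Esh] := shadow_energy s0 sT g0 th0 gs (fun t ts => vf t (tsT t ts))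
       dg (energy_le_restrict sT vK).
    have ss : 0 <= s <= s by rewrite (ltW s0) lexx.
    have cs j := absolutely_continuous_continuous (ltW s0) (acs j).
    have si t (ts : 0 <= t <= s) := gapped_neq (divr_gt0 g0 (ltr0Sn R 1)) (gsh t ts).
    have [_ Ish] := (energy_noise_le s0 cs si (2 * alpha')).1
      (fun m p q pq tpq => le_trans (Esh m p q pq tpq) (Kle s s0 sT)).
    have sx j : shadow f v j 0 = x 0 j by rewrite /shadow noise0 subrr addr0.
    (* At time [s] the shadow has gap at least [ga]. As [f] is within [delta <= ga / 8] of it, the
       gap of [f] exceeds [ga / 2]. *)
    have gsk := Hg2 s _ s0 sT acs si sx Ish s ss k l kl.
    rewrite clamp_id ?tsT//.
    have sf j : `|shadow f v j s - path_coord f j s| <= delta.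
      have := vf s (tsT s ss) j; rewrite /shadow.
      by rewrite (_ : v j s + _ - _ = v j s - noise (path_coord f) j s)//; ring.
    have := sf k; have := sf l; have := ler_normB (shadow f v k s - path_coord f k s) (shadow f v l s - path_coord f l s).
    have := ler_normD (path_coord f k s - path_coord f l s) (shadow f v k s - path_coord f k s - (shadow f v l s - path_coord f l s)).
    rewrite (_ : _ + (_ - _ - _) = shadow f v k s - shadow f v l s); last by ring.
    lra.
  move=> t tT k l kl; have := H t tT (k, l); rewrite /psi/= (negbTE kl) clamp_id//; lra.
have [acs gsh Esh] := shadow_energy T0 (lexx T) g0 th0 gf vf dg vK.
have cs j := absolutely_continuous_continuous (ltW T0) (acs j).
have sf t j : 0 <= t <= T -> `|shadow f v j t - path_coord f j t| <= delta.
  move=> tT; have := vf t tT j; rewrite /shadow.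
  by rewrite (_ : v j t + _ - _ = v j t - noise (path_coord f) j t)//; ring.
have [|u uE] := @path_of_coord R T n (fun j => shadow f v j \o clamp 0 T) (ltW T0) cs.
  move=> t tT i j ij /=; rewrite !clamp_id//.
  have nij : i != j by rewrite -val_eqE ltn_eqF.
  have := gf t tT i j nij; rewrite distrC ger0_norm; last by rewrite subr_ge0 ltW// path_coord_lt.
  by have := sf t i tT; have := sf t j tT; rewrite !ler_norml => /andP[h1 h2] /andP[h3 h4]; lra.
have uE' t j : 0 <= t <= T -> path_coord u j t = shadow f v j t.
  by move=> tT; rewrite uE//= clamp_id.
exists u.
  apply/dyson_rate_leP => //; split.
    by move=> j; rewrite uE' ?lexx ?(ltW T0)// /shadow noise0 subrr addr0.
  move=> m p q pq tpq; apply: le_trans (Kle T T0 (lexx T)); apply: le_trans (Esh m p q pq tpq).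
  have nE t j : 0 <= t <= T -> noise (path_coord u) j t = noise (shadow f v) j t.
    move=> /[dup] tT /andP[t0 tT']; rewrite /noise uE'//; congr (_ - _).
    apply: eq_Rintegral => r; rewrite inE/= in_itv/= => /andP[r0 rt].
    by congr repulsion; apply/funext => i; rewrite uE'// r0 (le_trans rt).
  rewrite le_eqVlt; apply/orP; left; apply/eqP.
  apply: eq_bigr => i _; apply: eq_bigr => j _; have [p0 lpq qT] := pq i.
  by rewrite !nE ?p0 ?qT ?(le_trans p0 (ltW lpq)) ?(le_trans (ltW lpq) qT).
move=> t tT j; rewrite uE'// distrC; apply: le_lt_trans (sf t j tT) _; lra.
Qed.

(** Each [u] in the sublevel set has a radius free of [F]; half of it serves for all paths near [u],
    and compactness makes the choice uniform. *)
Lemma rate_separation (F : set (path_space (R:=R) T n)) M : closed F ->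
  (forall f, F f -> ~ (dyson_rate x f <= M%:E)%E) ->
  exists2 e : R, 0 < e & forall u f, (dyson_rate x u <= M%:E)%E -> path_near u e f -> ~ F f.
Proof.
move=> cF FM.
have oF : open (~` F) by exact: closed_openC.
have cK : compact [set f : path_space T n | (dyson_rate x f <= M%:E)%E] by exact: dyson_rate_compact.
have [||r r0 Hr] := @compact_uniform_radius R _ _
  (fun e (u : path_space (R:=R) T n) => forall f, path_near u e f -> ~ F f) cK.
- by move=> r s u _ sr Q f uf; apply: Q => t tT j; exact: lt_le_trans (uf t tT j) sr.
- move=> u uM; have /nbhs_path[e e0 eF] : nbhs u (~` F).
    by apply: open_nbhs_nbhs; split => // /FM.
  have e20 : 0 < e / 2 by rewrite divr_gt0.
  exists (e / 2) => //; apply/nbhs_path; exists (e / 2) => // u' uu f uf; apply: eF => t tT j.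
  have := uu t tT j; have := uf t tT j.
  by have := ler_distD (path_coord u' j t) (path_coord f j t) (path_coord u j t); lra.
by exists r => // u f uM; exact: Hr.
Qed.

End shadowing.

(** * Large deviation bounds *)

Section solution.
Context {R : realType} {d : measure_display} {Omega : measurableType d}.
Variables (P : probability Omega R) (T : R) (n : nat) (x : 'rV[R]_n).
Variables (B : 'I_n -> R -> Omega -> R) (kappa : R) (X : Omega -> path_space T n).
Hypotheses (T0 : 0 < T) (bmB : forall j, brownian_motion P (B j))
  (solX : strong_solution P B kappa x X).

Lemma solution_regular : exists2 N : set Omega, measurable N /\ P N = 0%E &
  forall w, ~ N w -> [/\ forall j, path_coord (X w) j 0 = x 0 j, forall j, B j 0 w = 0,
    forall j, {within `[0, +oo[, continuous (fun t => B j t w)} &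
    forall t, 0 <= t <= T -> forall j,
      noise (path_coord (X w)) j t = x 0 j + Num.sqrt kappa * B j t w].
Proof.
have a1 := ae_forall_ord (fun j => bm_start (bmB j)).
have a2 := ae_forall_ord (fun j => bm_continuous (bmB j)).
have [N [mN N0 HN]] := ae_and (ae_and (sol_start solX) a1) (ae_and a2 (sol_sde solX)).
exists N => // w nN.
have [[h1 h2] [h3 h4]] : ((forall j, path_coord (X w) j 0 = x 0 j) /\ (forall j, B j 0 w = 0)) /\
   ((forall j, {within `[0, +oo[, continuous (fun t => B j t w)}) /\
   (forall t : R, t \in `[0, T] -> forall j, path_coord (X w) j t =
      x 0 j + Num.sqrt kappa * B j t w + \int[lebesgue_measure]_(s in `[0, t]) drift (X w) j s)).
  by apply: contrapT => nH; apply: nN; apply: HN.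
split => // t tT j; rewrite /noise h4; last by rewrite in_itv.
by rewrite addrK.
Qed.

(** The augmented filtration is generated by measurable events, its null events included by
    definition, so adaptedness gives measurability. *)
Lemma measurable_solution t j : 0 <= t <= T ->
  measurable_fun setT (fun w => path_coord (X w) j t).
Proof.
move=> tT _ U mU; rewrite setTI.
have tT' : t \in `[0, T] by rewrite in_itv.
suff : augmented_filtration P B t `<=` measurable by apply; exact: (sol_adapted solX tT' j mU).
apply: smallest_sub; first exact: sigma_algebra_measurable.
move=> A [[i _ [s [V [s0 mV ->]]]]|[mA _]] //.
rewrite -[X in measurable X]setTI; apply: (bm_measurable (bmB i)) => //.
by move: s0; rewrite /= in_itv/= => /andP[].
Qed.

Lemma measurable_solution_open (O : set (path_space T n)) : open O -> measurable (X @^-1` O).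
Proof.
by move=> oO; apply: (measurable_path_preimage T0) oO => t tT j; exact: measurable_solution.
Qed.

(** The exceptional event joins a null set to one chain event per coordinate and cell. Its rate
    [a ^+ 2 / (32 * h)] exceeds any given level when the mesh is fine. *)
Lemma solution_off_event m (h a : R) : 0 < kappa <= 1 -> 0 < h -> 0 < a ->
  24 <= a ^+ 2 / (32 * h) ->
  exists2 A : set Omega,
    measurable A /\ (P A <= ((n * m)%:R * (4 * expR (- (a ^+ 2 / (32 * h) / kappa))))%:E)%E &
    forall w, ~ A w -> [/\ forall j, path_coord (X w) j 0 = x 0 j, forall j, B j 0 w = 0,
      forall t, 0 <= t <= T -> forall j,
        noise (path_coord (X w)) j t = x 0 j + Num.sqrt kappa * B j t w &
      forall j (i : 'I_m) t, i%:R * h <= t <= i.+1%:R * h ->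
        `|Num.sqrt kappa * B j t w - Num.sqrt kappa * B j (i%:R * h) w| <= a].
Proof.
move=> /andP[k0 k1] h0 a0 q24; have [N [mN N0] HN] := solution_regular.
set k := Num.sqrt kappa; have sk0 : 0 < k by rewrite sqrtr_gt0.
have ak : a ^+ 2 / (32 * h * k ^+ 2) = a ^+ 2 / (32 * h) / kappa.
  by rewrite sqr_sqrtr ?(ltW k0)//; field; rewrite !gt_eqF.
have ih0 (i : nat) : 0 <= i%:R * h by rewrite mulr_ge0// ltW.
pose osc (ji : 'I_n * 'I_m) := chain_event (B ji.1) k (ji.2%:R * h) h a.
have mosc ji : measurable (osc ji).
  by apply: (measurable_chain_event (bmB ji.1)) => //; exact: ltW.
have mU : measurable (\bigcup_ji osc ji).
  by apply: fin_bigcup_measurable => //; exact: finite_finset.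
exists (N `|` \bigcup_ji osc ji).
  split; first exact: measurableU.
  apply: (le_trans (measureU2 _ mN mU)); rewrite [X in (X + _)%E]N0 add0e.
  apply: (le_trans (measure_bigcup_fin_le _ mosc)).
  apply: (@le_trans _ _ (\sum_(ji : 'I_n * 'I_m) (4 * expR (- (a ^+ 2 / (32 * h) / kappa)))%:E)%E).
    apply: lee_sum => ji _; rewrite -ak; apply: (chain_event_prob (bmB ji.1)) => //.
    by rewrite ak ler_pdivlMr//; apply: le_trans q24; nra.
  by rewrite sumEFin lee_fin sumr_const card_prod !card_ord -[X in X <= _]mulr_natl.
move=> w /not_orP[nN nosc]; have [X0 B0 cB XB] := HN w nN; split => // j i t it.
rewrite -mulrBr normrM (gtr0_norm sk0).
apply: (@chain_event_oscillation R d Omega (B j) k (i%:R * h) h a w) => //.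
- exact: ltW.
- by move=> H; apply: nosc; exists (j, i).
- by rewrite (_ : i%:R * h + h = i.+1%:R * h)// -natr1 mulrDl mul1r.
Qed.

End solution.

Section deviation_bounds.
Context {R : realType} (T : R) (n : nat) (x : 'rV[R]_n).
Hypotheses (T0 : 0 < T) (xch : chamber n x).

Lemma fine_mesh (a K : R) : 0 < a -> exists (m : nat) (h : R),
  [/\ (0 < m)%N, 0 < h, m%:R * h = T & K <= a ^+ 2 / (32 * h)].
Proof.
move=> a0; have [N HN] := exists_natS_gt (K * (32 * T) / a ^+ 2); set m := N.+1 in HN.
have mR0 : 0 < m%:R :> R by rewrite ltr0n.
have h0 : 0 < T / m%:R by rewrite divr_gt0.
exists m, (T / m%:R); split => //; first by rewrite mulrCA divff ?mulr1 ?gt_eqF.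
rewrite invfM invf_div !mulrA ler_pdivlMr// -ler_pdivrMl; last by rewrite divr_gt0 ?exprn_gt0.
rewrite invf_div (_ : _ * _ = K * (32 * T) / a ^+ 2); last by ring.
exact: ltW.
Qed.

Lemma dyson_upper (F : set (path_space T n)) (alpha alpha' eta : R) : closed F ->
  0 < alpha -> alpha < alpha' -> 0 < eta ->
  (forall f, F f -> ~ (dyson_rate x f <= alpha'%:E)%E) ->
  exists2 C : R, 0 < C & forall (d : measure_display) (Omega : measurableType d)
    (P : probability Omega R) (B : 'I_n -> R -> Omega -> R) (X : Omega -> path_space T n) (kappa : R),
    0 < kappa <= 1 -> (forall j, brownian_motion P (B j)) -> independent_processes P B ->
    strong_solution P B kappa x X ->
    (law P X F <= (C * expR (- ((alpha - eta) / kappa)))%:E)%E.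
Proof.
move=> cF al0 alal eta0 FM.
have [e e0 He] := rate_separation T0 xch cF FM.
have [delta d0 Hd] := path_shadowing T0 xch (ltW al0) alal e0.
(* Inside a cell [W] and its interpolation both move by at most [a], so they differ by at most
   [delta]. In [24 + alpha], the threshold of [chain_event_prob] is [24], and [alpha] makes a large
   oscillation at least as rare as a large energy. *)
pose a := delta / 2; have a0 : 0 < a by rewrite divr_gt0.
have [m [h [m0 h0 mh q24]]] := fine_mesh (24 + alpha) a0.
have [C C0 HC] := mesh_energy_tail n m h0 al0 eta0.
exists (C + (n * m)%:R * 4 + 1); first by rewrite ltr_wpDl// addr_ge0// mulr_ge0.
move=> d Omega P B X kappa /andP[k0 k1] bmB indB solX.
pose k := Num.sqrt kappa; have sk0 : 0 < k by rewrite sqrtr_gt0.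
have k2 : k ^+ 2 = kappa by rewrite sqr_sqrtr// ltW.
have [A [mA PA] HA] := HC d Omega P B k bmB indB sk0.
have k01 : 0 < kappa <= 1 by rewrite k0.
have q24' : 24 <= a ^+ 2 / (32 * h) by lra.
have [A' [mA' PA'] HA'] := solution_off_event bmB solX m k01 h0 a0 q24'.
have mF : measurable (X @^-1` F).
  rewrite (_ : X @^-1` F = ~` (X @^-1` (~` F))); last by rewrite preimage_setC setCK.
  apply: measurableC.
  by apply: (measurable_solution_open T0 bmB solX); exact: closed_openC.
have sub : X @^-1` F `<=` A' `|` A.
  move=> w Fw; apply: contrapT => /not_orP[/HA'[X0 B0 XB ob] nA].
  pose W j t := k * B j t w.
  pose v := interpolation h (x 0) (fun j (i : 'I_m) => W j (i.+1%:R * h) - W j (i%:R * h)).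
  have vE j (i : 'I_m) t := @interpolationE R n m h h0 (x 0) W j i t.
  have W0 j : W j 0 = 0 by rewrite /W B0 mulr0.
  have [||t tT j|u uM uX] := Hd (X w) v X0.
  - move=> j; rewrite /v (vE j (Ordinal m0) 0) /= ?mul0r ?lexx ?mul1r ?(ltW h0)//.
    by rewrite !subrr mulr0 !addr0.
  - rewrite -mh => r p q pq tpq; apply: le_trans (interpolation_energy h0 _ _ pq tpq) _.
    apply: le_trans (HA w nA); rewrite le_eqVlt; apply/orP; left; apply/eqP.
    by apply: eq_bigr => j _; apply: eq_bigr => i _; rewrite /W -mulrBr.
  - have [i it] : exists i : 'I_m, i%:R * h <= t <= i.+1%:R * h by apply: mesh_cell => //; rewrite mh.
    rewrite /v (vE j i t it) XB// -/(W j t) W0 subr0.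
    have h1 := ob j i t it.
    have h2 : `|W j (i.+1%:R * h) - W j (i%:R * h)| <= a.
      by apply: ob; rewrite lexx andbT ler_pM2r// ler_nat.
    set D := W j (i.+1%:R * h) - _ in h2 *.
    have /andP[it1 it2] := it.
    have h3 : `|D / h * (t - i%:R * h)| <= a.
      rewrite mulrAC normrM [X in _ * X]gtr0_norm ?invr_gt0// ler_pdivrMr// normrM.
      apply: ler_pM => //; rewrite ger0_norm ?subr_ge0// lerBlDl.
      by rewrite (_ : i%:R * h + h = i.+1%:R * h)// -natr1 mulrDl mul1r.
    rewrite (_ : _ - _ = D / h * (t - i%:R * h) - (W j t - W j (i%:R * h))); last by ring.
    apply: le_trans (ler_normB _ _) _; apply: le_trans (lerD h3 h1) _.
    by rewrite /a; lra.
  exact: He u (X w) uM uX Fw.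
rewrite /law; apply: (@le_trans _ _ (P (A' `|` A))).
  by rewrite le_measure ?inE//; exact: measurableU.
apply: (le_trans (measureU2 _ mA' mA)); apply: le_trans (leeD PA' PA) _.
have qk : expR (- (a ^+ 2 / (32 * h) / kappa)) <= expR (- ((alpha - eta) / kappa)).
  by rewrite ler_expR lerN2 ler_pM2r ?invr_gt0//; lra.
rewrite -EFinD lee_fin k2; set z := expR (- ((alpha - eta) / kappa)) in qk *.
apply: (@le_trans _ _ ((n * m)%:R * (4 * z) + C * z)); first by rewrite lerD2r ler_wpM2l// ler_pM2l.
by rewrite -subr_ge0 (_ : _ - _ = z) ?expR_ge0//; ring.
Qed.

Lemma dyson_lower (O : set (path_space T n)) f (E eta : R) : open O -> O f ->
  (dyson_rate x f <= E%:E)%E -> 0 < eta ->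
  exists C kappa0 : R, [/\ 0 < C, 0 < kappa0 &
    forall (d : measure_display) (Omega : measurableType d)
    (P : probability Omega R) (B : 'I_n -> R -> Omega -> R) (X : Omega -> path_space T n) (kappa : R),
    0 < kappa < kappa0 -> (forall j, brownian_motion P (B j)) -> independent_processes P B ->
    strong_solution P B kappa x X ->
    ((C * expR (- ((E + eta) / kappa)))%:E <= law P X O)%E].
Proof.
move=> oO Of fE eta0.
have E0 : 0 <= E by rewrite -lee_fin; apply: le_trans fE; exact: dyson_rate_ge0.
have /nbhs_path[e e0 eO] : nbhs f O by exact: open_nbhs_nbhs.
have [delta d0 Hd] := noise_stability T0 f e0.
have [fx fenergy] := (dyson_rate_leP x T0 f E).1 fE.
(* Three errors of size [a] add up: the one at the mesh points and the oscillations of [k * B] and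
   of [phi] in a cell. In [25 + E + eta], [24] is the threshold of [chain_event_prob], [E + eta] the
   target rate, and the last [1] yields a factor [expR (- kappa^-1) <= kappa] that makes the
   oscillation event negligible. *)
pose a := delta / 4; have a0 : 0 < a by rewrite divr_gt0.
have [m [h [m0 h0 mh q24]]] := fine_mesh (25 + E + eta) a0.
have mR0 : 0 < m%:R :> R by rewrite ltr0n.
(* By [rate_noise_increment], [phi] then moves by at most [a] within a cell. *)
have Eh : 2 * E * h <= a ^+ 2.
  move: q24; rewrite ler_pdivlMr ?mulr_gt0//; have : 0 <= E * h by [rewrite mulr_ge0// ltW].
  by have := mulr_gt0 eta0 h0; lra.
pose phi := noise (path_coord f).
have ihT (i : 'I_m) : i.+1%:R * h <= T by rewrite -mh ler_pM2r// ler_nat.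
have ih0 (i : nat) : 0 <= i%:R * h by rewrite mulr_ge0// ltW.
have iS (i : nat) : i.+1%:R * h = i%:R * h + h by rewrite -natr1 mulrDl mul1r.
have phia j (i : 'I_m) t : i%:R * h <= t <= i.+1%:R * h -> `|phi j t - phi j (i%:R * h)| <= a.
  move=> /andP[]; rewrite le_eqVlt => /orP[/eqP<- _|it ti]; first by rewrite subrr normr0 ltW.
  rewrite -(ler_pXn2r (_ : 0 < 2)%N) ?nnegrE ?(ltW a0)// real_normK ?num_real//.
  apply: le_trans (rate_noise_increment T0 j fE (ih0 i) it (le_trans ti (ihT i))) _.
  apply: le_trans Eh; apply: ler_wpM2l; first by rewrite mulr_ge0.
  by rewrite lerBlDl -iS.
pose c (j : 'I_n) (i : 'I_m) := phi j (i.+1%:R * h) - phi j (i%:R * h).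
have ca j i : `|c j i| <= a by apply: phia; rewrite lexx andbT ler_pM2r// ler_nat.
have cE : \sum_(j < n) \sum_(i < m) c j i ^+ 2 / h <= 2 * E.
  have := @fenergy m (fun i => i%:R * h) (fun i => i.+1%:R * h).
  rewrite exchange_big/= => H; apply: le_trans (H _ _).
  - rewrite le_eqVlt; apply/orP; left; apply/eqP.
    apply: eq_bigr => i _; apply: eq_bigr => j _.
    by rewrite mesh_step.
  - by move=> i; split => //; rewrite ltr_pM2r// ltr_nat.
  move=> i i' _ _ [y [/=]]; rewrite !in_itv/= => /andP[y1 y2] /andP[y3 y4].
  apply/val_inj/eqP; rewrite eqn_leq /=; apply/andP; split.
    by rewrite -ltnS -(ltr_nat R) -(ltr_pM2r h0); exact: lt_trans y4.
  by rewrite -ltnS -(ltr_nat R) -(ltr_pM2r h0); exact: lt_trans y2.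
pose Q : R := (n * m)%:R * (2 * a + 1) + 1.
have Q0 : 0 < Q by rewrite ltr_wpDl// mulr_ge0// addr_ge0// mulr_ge0// ltW.
(* The errors at the mesh points accumulate to at most [m%:R * ep <= a], and the bound on [ep * Q]
   keeps the cost of the tube below [E + eta]. *)
pose ep := Num.min 1 (Num.min (a / m%:R) (eta * (2 * h) / Q)).
have ep0 : 0 < ep by rewrite !lt_min ltr01 !divr_gt0// !mulr_gt0.
have ep1 : ep <= 1 by rewrite ge_min lexx.
have epa : m%:R * ep <= a by rewrite mulrC -ler_pdivlMr// !ge_min lexx orbT.
have epQ : ep * Q <= eta * (2 * h) by rewrite -ler_pdivlMr// !ge_min lexx !orbT.
clearbody ep.
have SE : \sum_(j < n) \sum_(i < m) (`|c j i| + ep) ^+ 2 / (2 * h) <= E + eta.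
  apply: (@le_trans _ _ (\sum_(j < n) \sum_(i < m) (2^-1 * (c j i ^+ 2 / h) + ep * (2 * a + 1) / (2 * h)))).
    apply: ler_sum => j _; apply: ler_sum => i _.
    rewrite [leRHS](_ : _ = (c j i ^+ 2 + ep * (2 * a + 1)) / (2 * h)); last by field; rewrite gt_eqF.
    rewrite ler_pM2r ?invr_gt0 ?mulr_gt0// -[c j i ^+ 2]real_normK ?num_real//.
    by have := ca j i; have := normr_ge0 (c j i); move: `|c j i| => z z0 za; nra.
  under eq_bigr do rewrite big_split/= -mulr_sumr sumr_const card_ord.
  rewrite big_split/= -mulr_sumr sumr_const card_ord -mulrnA.
  apply: lerD; first by move: cE; move: (\sum_j _) => z; lra.
  rewrite -[X in X <= _]mulr_natl mulrA ler_pdivrMr ?mulr_gt0//; apply: le_trans epQ.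
  by rewrite /Q mulnC mulrDr mulr1 -subr_ge0 (_ : _ - _ = ep) ?(ltW ep0)//; ring.
have [C C0 HC] := mesh_tube_lower h0 c ep0.
have nm0 : 0 < 8 * (n * m)%:R + 1 :> R by rewrite ltr_wpDl// mulr_ge0.
(* For such [kappa] the oscillation event takes away at most half of the lower bound for the tube:
   [4 * (n * m) * kappa <= C / 2]. *)
exists (C / 2), (Num.min 1 (C / (8 * (n * m)%:R + 1))); split; rewrite ?divr_gt0//.
  by rewrite lt_min ltr01 divr_gt0.
move=> d Omega P B X kappa /andP[k0]; rewrite lt_min => /andP[k1 kC] bmB indB solX.
rewrite ltr_pdivlMr// in kC.
pose k := Num.sqrt kappa; have sk0 : 0 < k by rewrite sqrtr_gt0.
have k2 : k ^+ 2 = kappa by rewrite sqr_sqrtr// ltW.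
have sk1 : 0 < k <= 1 by rewrite sk0 -sqrtr1 ler_wsqrtr// ltW.
have k01 : 0 < kappa <= 1 by rewrite k0 ltW.
have q24' : 24 <= a ^+ 2 / (32 * h) by lra.
have [A' [mA' PA'] HA'] := solution_off_event bmB solX m k01 h0 a0 q24'.
pose z := expR (- ((E + eta) / kappa)).
have z0 : 0 < z by exact: expR_gt0.
have kz : expR (- kappa^-1) <= kappa.
  rewrite expRN -[leRHS]invrK lef_pV2 ?posrE ?expR_gt0 ?invr_gt0//.
  by apply: le_trans (expR_ge1Dx _); lra.
have {}PA' : (P A' <= ((n * m)%:R * (4 * (kappa * z)))%:E)%E.
  apply: (le_trans PA'); rewrite lee_fin ler_wpM2l// ler_pM2l//.
  apply: (@le_trans _ _ (expR (- kappa^-1) * z)); last by rewrite ler_pM2r.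
  rewrite /z -expRD ler_expR -opprD lerN2 -{1}[kappa^-1]mul1r -mulrDl ler_pM2r ?invr_gt0//; lra.
have mO : measurable (X @^-1` O) by exact: (measurable_solution_open T0 bmB solX).
pose A := \bigcap_(j in [set: 'I_n]) \bigcap_(i in [set: 'I_m])
  mesh_increment B h j i @^-1` [set y : R | (`|k * y - c j i| <= ep)%R].
have PA : ((C * z)%:E <= P A)%E.
  apply: le_trans (HC d Omega P B k bmB indB sk1).
  rewrite lee_fin ler_pM2l// /z ler_expR lerN2 k2 ler_pM2r ?invr_gt0//.
have mAy j i : measurable [set y : R | (`|k * y - c j i| <= ep)%R].
  rewrite (_ : [set y : R | _] = setT `&` (fun y : R => k * y) @^-1` `[c j i - ep, c j i + ep]%classic).
    have mk : measurable_fun setT (fun y : R => k * y).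
      by apply: measurable_funM; [exact: measurable_cst|exact: measurable_id].
    by apply: mk => //; exact: measurable_itv.
  by rewrite setTI; apply/seteqP; split => y; rewrite /= in_itv/= ler_distl.
have mA : measurable A.
  apply: fin_bigcap_measurable; first exact: finite_finset.
  move=> j _; apply: fin_bigcap_measurable; first exact: finite_finset.
  by move=> i _; exact: (measurable_mesh_increment bmB h0 j i (mAy j i)).
have sub : A `<=` A' `|` X @^-1` O.
  move=> w Aw; have [|/HA'[X0 B0 XB ob]] := pselect (A' w); [by left|right].
  apply: eO; apply: Hd => t tT j.
  have [i it] : exists i : 'I_m, i%:R * h <= t <= i.+1%:R * h by apply: mesh_cell => //; rewrite mh.
  rewrite XB// -/k.
  have mesh (r : nat) : (r <= m)%N -> `|x 0 j + k * B j (r%:R * h) w - phi j (r%:R * h)| <= r%:R * ep.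
    elim: r => [_|r IH rm].
      by rewrite !mul0r B0 mulr0 addr0 /phi noise0 fx subrr normr0.
    have := Aw j Logic.I (Ordinal rm) Logic.I; rewrite /= /mesh_increment /increment /c /=.
    have := IH (ltnW rm); set u := B j (r%:R * h) w; set u' := B j (r.+1%:R * h) w.
    set p := phi j (r%:R * h); set p' := phi j (r.+1%:R * h) => h1 h2.
    rewrite (_ : x 0 j + k * u' - p' = (x 0 j + k * u - p) + (k * (u' - u) - (p' - p))); last by ring.
    apply: le_trans (ler_normD _ _) _; apply: le_trans (lerD h1 h2) _.
    by rewrite -(natr1 r) mulrDl mul1r.
  have h1 := mesh i (ltnW (ltn_ord i)); have h2 := ob j i t it; have h3 := phia j i t it.
  have h4 : i%:R * ep <= a.
    by apply: le_trans epa; rewrite ler_pM2r// ler_nat ltnW.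
  rewrite -/phi (_ : _ - _ = (x 0 j + k * B j (i%:R * h) w - phi j (i%:R * h)) +
    (k * B j t w - k * B j (i%:R * h) w) - (phi j t - phi j (i%:R * h))); last by ring.
  apply: le_trans (ler_normB _ _) _; apply: le_trans (lerD (ler_normD _ _) (lexx _)) _.
  have : a = delta / 4 by [].
  by move: a a0 h1 h2 h3 h4 {ob PA' q24 q24' HA' Eh phia ca Q Q0 epa epQ} => a a0 h1 h2 h3 h4 aE; lra.
rewrite /law -/z.
have H : (P A <= P A' + P (X @^-1` O))%E.
  apply: (@le_trans _ _ (P (A' `|` X @^-1` O))); last exact: (measureU2 _ mA' mO).
  by rewrite le_measure ?inE//; exact: measurableU.
have := le_trans (le_trans PA H) (leeD PA' (lexx _)).
rewrite -leeBlDl// -EFinB; apply: le_trans.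
rewrite lee_fin [leRHS](_ : _ = (C - (n * m)%:R * (4 * kappa)) * z); last by ring.
apply: ler_wpM2r; first exact: ltW.
by move: kC; move: (n * m)%:R => q; lra.
Qed.

End deviation_bounds.

(** * Exponential bounds on the logarithmic scale *)

Section log_scale.
Context {R : realType}.

(** The quantity inside the norm is [k * ln C], so one threshold serves every [a]. *)
Lemma log_scale (C e kappa0 : R) : 0 < C -> 0 < e -> 0 < kappa0 ->
  exists k1 : R, [/\ 0 < k1, k1 <= kappa0 & forall k a, 0 < k < k1 ->
    `|k * ln (C * expR (- (a / k))) + a| <= e].
Proof.
move=> C0 e0 k0; exists (Num.min kappa0 (e / (`|ln C| + 1))); split.
- by rewrite lt_min k0 divr_gt0// ltr_wpDl.
- by rewrite ge_min lexx.
move=> k a /andP[kp]; rewrite lt_min => /andP[_]; rewrite ltr_pdivlMr ?ltr_wpDl// => ke.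
rewrite lnM ?posrE ?expR_gt0// expRK mulrDr mulrN mulrCA divff ?gt_eqF// mulr1 subrK.
by rewrite normrM (gtr0_norm kp); apply: le_trans (ltW ke); rewrite ler_pM2l// lerDl.
Qed.

Lemma le_limf_einf_log (p : R -> \bar R) (C a b kappa0 : R) : 0 < C -> 0 < kappa0 ->
  (forall k, 0 < k < kappa0 -> ((C * expR (- (a / k)))%:E <= p k)%E) -> a < b ->
  ((- b)%:E <= limf_einf (fun k : R => k%:E * lne (p k)) (0%R : R)^'+)%E.
Proof.
move=> C0 k0 Hp ab; have ba0 : 0 < b - a by rewrite subr_gt0.
have [k1 [k10 k1k Hk]] := log_scale C0 ba0 k0.
rewrite limf_einfE; apply: le_ereal_sup_tmp.
exists (ereal_inf ((fun k : R => k%:E * lne (p k))%E @` [set z : R | 0 < z < k1])).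
  by exists [set z : R | 0 < z < k1] => //; exact: near_0right.
apply: le_ereal_inf_tmp => _ [k /= kk1 <-]; have /andP[kp kk] := kk1.
have H : ((C * expR (- (a / k)))%:E <= p k)%E by apply: Hp; rewrite kp (lt_le_trans kk).
have q0 : 0 < C * expR (- (a / k)) by rewrite mulr_gt0 ?expR_gt0.
apply: (@le_trans _ _ (k%:E * lne (C * expR (- (a / k)))%:E)%E); last first.
  apply: lee_wpmul2l; first by rewrite lee_fin ltW.
  by rewrite lee_lne// in_itv/= leey andbT ?lee_fin ?(ltW q0)//; apply: le_trans H; rewrite lee_fin ltW.
rewrite lne_EFin// -EFinM lee_fin; have := Hk k a kk1; rewrite ler_norml => /andP[+ _]; lra.
Qed.

Lemma limf_esup_log_le (p : R -> \bar R) (C a b kappa0 : R) : 0 < C -> 0 < kappa0 ->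
  (forall k, 0 < k < kappa0 -> (0 <= p k <= (C * expR (- (a / k)))%:E)%E) -> b < a ->
  (limf_esup (fun k : R => k%:E * lne (p k)) (0%R : R)^'+ <= (- b)%:E)%E.
Proof.
move=> C0 k0 Hp ba; have ab0 : 0 < a - b by rewrite subr_gt0.
have [k1 [k10 k1k Hk]] := log_scale C0 ab0 k0.
rewrite limf_esupE.
apply: (@le_trans _ _ (ereal_sup ((fun k : R => k%:E * lne (p k))%E @` [set z : R | 0 < z < k1]))).
  by apply: ereal_inf_lbound; exists [set z : R | 0 < z < k1] => //; exact: near_0right.
apply: ge_ereal_sup => _ [k /= kk1 <-]; have /andP[kp kk] := kk1.
have /andP[p0 H] : (0 <= p k <= (C * expR (- (a / k)))%:E)%E by apply: Hp; rewrite kp (lt_le_trans kk).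
have q0 : 0 < C * expR (- (a / k)) by rewrite mulr_gt0 ?expR_gt0.
apply: (@le_trans _ _ (k%:E * lne (C * expR (- (a / k)))%:E)%E).
  apply: lee_wpmul2l; first by rewrite lee_fin ltW.
  by rewrite lee_lne// in_itv/= leey andbT ?lee_fin ?(ltW q0).
rewrite lne_EFin// -EFinM lee_fin; have := Hk k a kk1; rewrite ler_norml => /andP[_]; lra.
Qed.

End log_scale.

Theorem proposition1p5 (R : realType) (T : R) (n : nat) (x : 'rV[R]_n)
    (d : R -> measure_display)
    (Omega : forall kappa : R, measurableType (d kappa))
    (P : forall kappa : R, probability (Omega kappa) R)
    (B : forall kappa : R, 'I_n -> R -> Omega kappa -> R)
    (X : forall kappa : R, Omega kappa -> path_space T n) :
  0 < T -> (1 <= n)%N -> chamber n x ->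
  (forall kappa : R, 0 < kappa <= 4 ->
     [/\ forall j, brownian_motion (P kappa) (B kappa j),
         independent_processes (P kappa) (B kappa)
       & strong_solution (P kappa) (B kappa) kappa x (X kappa)]) ->
  good_rate_function (dyson_rate x : path_space T n -> \bar R) /\
  ldp_0right (fun kappa => law (P kappa) (X kappa))
             (dyson_rate x : path_space T n -> \bar R).
Proof.
move=> T0 _ xch sol; split; first exact: dyson_rate_good.
split=> [ U oU | F cF ].
  rewrite leeNl; apply: le_ereal_inf_tmp => _ [f Uf <-]; rewrite leeNl.
  case fE : (dyson_rate x f) => [E| |]; last first.
  - by have := dyson_rate_ge0 x f; rewrite fE.
  - by rewrite leNye.
  apply/lee_subgt0Pr => e e0.
  have e20 : 0 < e / 2 by rewrite divr_gt0.
  have fE' : (dyson_rate x f <= E%:E)%E by rewrite fE.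
  have [C [k0 [C0 k00 HC]]] := dyson_lower T0 oU Uf fE' e20.
  rewrite -EFinN -EFinB (_ : - E - e = - (E + e)); last by ring.
  apply: (@le_limf_einf_log R _ C (E + e / 2) _ (Num.min k0 4)) => //.
  - by rewrite lt_min k00 ltr0n.
  - move=> k /andP[kp]; rewrite lt_min => /andP[kk0 k4].
    have [|bm ind so] := sol k; first by rewrite kp ltW.
    by apply: HC => //; rewrite kp.
  - lra.
have law_le1 k : 0 < k <= 4 -> (0 <= law (P k) (X k) F <= 1)%E.
  move=> k4; have [bm ind so] := sol k k4.
  rewrite measure_ge0 /=; apply: probability_le1.
  rewrite (_ : X k @^-1` F = ~` (X k @^-1` (~` F))); last by rewrite preimage_setC setCK.
  by apply: measurableC; apply: (measurable_solution_open T0 bm so); exact: closed_openC.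
set I := ereal_inf _.
(* Arguing with each real [b] below [I] treats a finite and an infinite infimum alike. *)
have claim (b : R) : (b%:E < I)%E ->
    (limf_esup (fun k : R => k%:E * lne (law (P k) (X k) F)) (0%R : R)^'+ <= (- b)%:E)%E.
  (* For negative [b] it is enough that probabilities are at most [1]; otherwise [b] leaves room for
     a positive [al]. *)
  move=> bI; have [b0|b0] := ltP b 0.
    apply: (@limf_esup_log_le R _ 1 0 b 4) => // k /andP[k0 k4].
    by rewrite mul0r oppr0 expR0 mulr1; apply: law_le1; rewrite k0 ltW.
  have [c bc cI] : exists2 c : R, b < c & (c%:E < I)%E.
    move: bI; case: I => [r| |]//; last by exists (b + 1); rewrite ?ltrDl ?ltry.
    by rewrite lte_fin => br; exists ((b + r) / 2); rewrite ?lte_fin; lra.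
  have cF' f : F f -> ~ (dyson_rate x f <= c%:E)%E.
    move=> Ff; apply/negP; rewrite -ltNge; apply: (lt_le_trans cI).
    by apply: ereal_inf_lbound; exists f.
  (* [al] lies below [c], and [al - eta] is the midpoint of [b] and [c], which provides both strict
     inequalities. *)
  pose al := (b + 3 * c) / 4; pose eta := (c - b) / 4.
  have al0 : 0 < al by rewrite /al; lra.
  have alc : al < c by rewrite /al; lra.
  have eta0 : 0 < eta by rewrite /eta; lra.
  have [C C0 HC] := dyson_upper T0 xch cF al0 alc eta0 cF'.
  apply: (@limf_esup_log_le R _ C (al - eta) b 1) => //.
    move=> k /andP[k0 k1]; have k4 : 0 < k <= 4 by rewrite k0 (le_trans (ltW k1))// ler1n.
    have [bm ind so] := sol k k4; have /andP[-> _] := law_le1 k k4.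
    by apply: HC bm ind so; rewrite k0 ltW.
  by rewrite /al /eta; lra.
case IE : I claim => [r| |] claim.
- apply/lee_addgt0Pr => e e0; rewrite -EFinN -EFinD (_ : - r + e = - (r - e)); last by ring.
  by apply: claim; rewrite lte_fin; lra.
- rewrite leeNr (_ : - limf_esup _ _ = +oo)%E//; apply/eqyP => b _.
  by rewrite leeNr; exact: claim (ltry _).
- by rewrite leey.
Qed.
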